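(* Let $\widehat{\mathcal B}_n$ be the compressed random binary search tree, and let $t$ be a full binary tree. Then $N_t(\widehat{\mathcal B}_n)$ is asymptotically normal: there exist constants $\hat\beta_t>0$ and $\hat\gamma_t>0$ such that, as $n\to\infty$, $$\frac{N_t(\widehat{\mathcal B}_n)-n\hat\beta_t}{\sqrt n}\overset{\mathrm d}{\longrightarrow}N(0,\hat\gamma_t^2),$$ with convergence of mean and variance. In particular, $N_t(\widehat{\mathcal B}_n)/n\overset{\mathrm p}{\longrightarrow}\hat\beta_t$. Furthermore, there exists a limiting fringe tree distribution given by a random full binary tree $\widehat{\mathcal B}^*_\infty$ such that for every full binary tree $t$, $$\mathbb{P}(\widehat{\mathcal B}^*_\infty=t)=\tfrac32\hat\beta_t,$$ and (quenched version) $$\mathbb{P}(\widehat{\mathcal B}^*_n=t\mid\widehat{\mathcal B}_n)=\frac{N_t(\widehat{\mathcal B}_n)}{|\widehat{\mathcal B}_n|}\overset{\mathrm p}{\longrightarrow}\mathbb{P}(\widehat{\mathcal B}^*_\infty=t)$$ and (annealed version) $$\mathbb{P}(\widehat{\mathcal B}^*_n=t)=\mathbb{E}\frac{N_t(\widehat{\mathcal B}_n)}{|\widehat{\mathcal B}_n|}\to\mathbb{P}(\widehat{\mathcal B}^*_\infty=t).$$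
   Context: Trees. A binary tree is a (finite, non-empty) rooted tree in which each child is labelled left or right and each node has at most one left and at most one right child. It is full if each node has outdegree 0 or 2. $|T|$ is the number of nodes of $T$. For $v\in T$, the fringe tree $T^v$ consists of $v$ and all its descendants, and $N_t(T):=|\{v\in T:T^v=t\}|$ (equality as binary trees). The random fringe tree $T^*$ of a tree $T$ is $T^v$ for a uniformly random node $v$ of $T$ (if $T$ is random, first condition on $T$). The compression $\widehat T$ of a binary tree $T$ is the full binary tree obtained by deleting all nodes of outdegree 1 and connecting the remaining nodes in the obvious way. Binary search tree. The random binary search tree $\mathcal B_n$ is defined recursively from $n$ distinct real numbers: $\mathcal B_0$ is empty, $\mathcal B_1$ is a single node, and for $n\ge2$ a uniformly random one of the numbers (the pivot) is chosen at the root, and the left and right subtrees of the root are constructed recursively, independently, from the set of numbers smaller, respectively larger, than the pivot. $\widehat{\mathcal B}_n$ is the compression of $\mathcal B_n$, and $\widehat{\mathcal B}^*_n$ is its random fringe tree. ''Convergence of mean and variance'' means that the mean and variance of the left-hand side converge to those of the limit. *)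

(* Defs.v *)
From HB Require Import structures.
From mathcomp Require Import all_boot all_order all_algebra.
From mathcomp Require Import all_classical all_reals all_analysis.

Set Implicit Arguments.
Unset Strict Implicit.
Unset Printing Implicit Defensive.

Import Order.TTheory GRing.Theory Num.Theory.
Import numFieldNormedType.Exports.

Local Open Scope classical_set_scope.
Local Open Scope ring_scope.

(* A missing left or right child is encoded as [EmptyTree].
   The (non-empty) binary trees of the theory are thus the values other than
   [EmptyTree], which itself represents the empty binary search tree. *)
Inductive btree := EmptyTree | BNode of btree & btree.

Fixpoint btree_encode (T : btree) : GenTree.tree unit :=
  match T with
  | EmptyTree => GenTree.Leaf tt
  | BNode l r => GenTree.Node 0 [:: btree_encode l; btree_encode r]
  end.

Fixpoint btree_decode (u : GenTree.tree unit) : option btree :=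
  match u with
  | GenTree.Leaf _ => Some EmptyTree
  | GenTree.Node _ [:: ul; ur] =>
      match btree_decode ul, btree_decode ur with
      | Some l, Some r => Some (BNode l r)
      | _, _ => None
      end
  | _ => None
  end.

Lemma btree_encodeK : pcancel btree_encode btree_decode.
Proof. by elim=> //= l -> r ->. Qed.

HB.instance Definition _ := Countable.copy btree (pcan_type btree_encodeK).
HB.instance Definition _ := isPointed.Build btree EmptyTree.
HB.instance Definition _ := @isMeasurable.Build default_measure_display
  btree discrete_measurable discrete_measurable0
  discrete_measurableC discrete_measurableU.

(* A node is identified with the path leading to it from the root
   ([false] = left, [true] = right). *)
Definition address := seq bool.

HB.instance Definition _ := Countable.on address.
HB.instance Definition _ := isPointed.Build address [::].
HB.instance Definition _ := @isMeasurable.Build default_measure_display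
  address discrete_measurable discrete_measurable0
  discrete_measurableC discrete_measurableU.

Fixpoint nodes (T : btree) : seq address :=
  match T with
  | EmptyTree => [::]
  | BNode l r =>
      [::] :: map (cons false) (nodes l) ++ map (cons true) (nodes r)
  end.

Definition bsize (T : btree) : nat := size (nodes T).

(* Only meaningful for [v \in nodes T]; otherwise the value is [EmptyTree]. *)
Fixpoint fringe (T : btree) (v : address) : btree :=
  match v, T with
  | [::], _ => T
  | b :: v', BNode l r => fringe (if b then r else l) v'
  | _ :: _, EmptyTree => EmptyTree
  end.

Definition fringe_count (t T : btree) : nat :=
  count (fun v => fringe T v == t) (nodes T).

Definition outdegree (T : btree) (v : address) : nat :=
  match fringe T v with
  | EmptyTree => 0%N
  | BNode l r => ((l != EmptyTree) + (r != EmptyTree))%N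
  end.

Definition full (T : btree) : bool :=
  (T != EmptyTree) &&
  all (fun v => (outdegree T v == 0)%N || (outdegree T v == 2)%N) (nodes T).

Fixpoint compress (T : btree) : btree :=
  match T with
  | BNode l EmptyTree => if l is EmptyTree then T else compress l
  | BNode EmptyTree r => compress r
  | BNode l r => BNode (compress l) (compress r)
  | EmptyTree => EmptyTree
  end.

(* [bst_pmf s T] is the probability that the random binary search tree built
   from the set of (distinct) numbers listed in [s] is [T]: conditionally on the
   pivot [x], which is uniform in [s], the two subtrees of the root are
   independent random binary search trees built from the smaller and the larger
   numbers.  (For [s] empty the second sum is empty.) *)
Fixpoint bst_pmf (R : realType) (s : seq R) (T : btree) : R :=
  match T with
  | EmptyTree => (s == [::])%:R
  | BNode l r =>
      (size s)%:R^-1 *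
      \sum_(x <- s)
        bst_pmf [seq y <- s | y < x] l * bst_pmf [seq y <- s | x < y] r
  end.

Section RandomTrees.
Context d (Omega : measurableType d) (R : realType) (P : probability Omega R).

Definition is_random_bst (s : seq R) (B : Omega -> btree) : Prop :=
  forall T : btree, P [set w | B w = T] = (bst_pmf s T)%:E.

(* Conditionally on the random tree [T], the node [V] of [T] is uniform.  There
   is no constraint on [V] where [T] is [EmptyTree], which has no node. *)
Definition is_random_node (T : Omega -> btree) (V : Omega -> address) : Prop :=
  forall (tau : btree) (v : address), v \in nodes tau ->
    P [set w | T w = tau /\ V w = v] =
    (P [set w | T w = tau] * ((bsize tau)%:R^-1)%:E)%E.

(* Conditional probability of an event given a random variable with countably
   many values, as a random variable; it has the value 0 on the null event that
   [X] takes a value of probability 0. *)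
Definition cond_prob (A : set Omega) (X : Omega -> btree) (w : Omega) : R :=
  fine (P (A `&` X @^-1` [set X w])) / fine (P (X @^-1` [set X w])).

Definition cvg_in_probability (X : nat -> Omega -> R) (c : R) : Prop :=
  forall e : R, 0 < e -> P [set w | e < `|X n w - c|] @[n --> \oo] --> 0%E.

Definition cvg_in_distribution (X : nat -> Omega -> R)
    (mu : probability (measurableTypeR R) R) : Prop :=
  forall r : R, {for r, continuous (fun y : R => mu `]-oo, y]%classic)} ->
    P [set w | X n w <= r] @[n --> \oo] --> mu `]-oo, r]%classic.

End RandomTrees.

(* Main.v *)
Require Import Defs.
From HB Require Import structures.
From mathcomp Require Import all_boot all_order all_algebra.
From mathcomp Require Import all_classical all_reals all_analysis.
From mathcomp Require Import measurable_realfun.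
From mathcomp Require Import ring lra zify.

Set Implicit Arguments.
Unset Strict Implicit.
Unset Printing Implicit Defensive.

Import Order.TTheory GRing.Theory Num.Theory.
Import numFieldNormedType.Exports.

Local Open Scope classical_set_scope.
Local Open Scope ring_scope.

(* The number of fringe subtrees equal to [t], centred by [(n + 1) beta], is an
   additive functional of the binary search tree, up to a bounded toll that is
   nonzero only when the compressed tree is [t] itself.  Conditioning on the
   root gives the quicksort recursion [a_n = (2 / n) \sum_(k < n) a_k + b_n],
   whose solution is linear in [n] up to [O(sup_(k >= n) |b_k|)]; this yields
   the mean, and then, as the toll probability decays exponentially, the
   variance and a fourth moment bound.  The asymptotic variance is positive,
   since otherwise [(n + 1) beta] would be asymptotically an integer, whereas
   [0 < beta < 1].

   Asymptotic normality is proved by Trotter's operator method.  The operators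
   [h |-> E h(. + Y_n)] and the Gaussian ones of variance proportional to
   [n + 1] commute and are contractions, and the Gaussian ones satisfy the
   recursion exactly, so that the error at [n] is at most about [n / K] times
   the one at [K].  The latter is bounded by a third order Taylor expansion, and
   one takes [K] to be a small multiple of [n].  Test functions are rescaled
   logistic functions, between which an indicator is sandwiched. *)

(** * Random binary search trees as weighted trees *)

(** Probability is reduced to finite sums: [bstE n] averages over the trees with [n] nodes, and
    random variables enter only at the end, once the null event of a tree of the wrong size is
    discarded. In the operator method, matching the first two moments at scale [1 / sqrt N] leaves
    an error of order [(K / N)^(3/2)] at [K]; the magnification [N / K] turns it into
    [(K / N)^(1/2)], which is still small. A second order error would not survive. This is why third
    absolute moments are needed; they are interpolated between the second and the fourth. The
    constant 3/2 is the inverse of the density of surviving nodes: leaves have rate 1/3 and make up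
    about half of a full tree, so about [2 n / 3] nodes survive. The limit law is a mixture with the
    weights of the series that defines [fringe_rate], so that its point masses are immediate and its
    total mass is this density times 3/2. The proportion of fringe trees equal to [t] is delicate
    because the compressed size may be 1, for a path; an exact identity with bounded coefficients
    replaces a lower bound on it. *)

Lemma bsize_node l r : bsize (BNode l r) = (bsize l + bsize r).+1.
Proof. by rewrite /bsize /= size_cat !size_map. Qed.

Lemma bsize_eq0 T : (bsize T == 0)%N = (T == EmptyTree).
Proof. by case: T => [|l r]; [rewrite eqxx | rewrite bsize_node]. Qed.

(** Trees of height at most [h]: the height gives a structural recursion, and a tree with at most
    [h] nodes has height at most [h], so that filtering by size loses nothing. *)
Fixpoint trees_upto (h : nat) : seq btree :=
  if h is h'.+1 then
    EmptyTree :: [seq BNode l r | l <- trees_upto h', r <- trees_upto h']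
  else [:: EmptyTree].

Lemma trees_uptoS h : trees_upto h.+1 =
  EmptyTree :: [seq BNode l r | l <- trees_upto h, r <- trees_upto h].
Proof. by []. Qed.

Arguments trees_upto : simpl never.

Lemma trees_upto_uniq h : uniq (trees_upto h).
Proof.
elim: h => // h IH; rewrite trees_uptoS; apply/andP; split.
  by apply/negP => /allpairsP[[l r] /= [_ _]].
by apply: allpairs_uniq => // -[a b] [c e] /= _ _ [-> ->].
Qed.

Lemma mem_trees_upto h T : (bsize T <= h)%N -> T \in trees_upto h.
Proof.
elim: h T => [|h IH] [|l r] //; rewrite bsize_node ltnS => lrh.
rewrite trees_uptoS inE /=; apply/allpairsP; exists (l, r); split=> //=; apply: IH.
  exact: leq_trans (leq_addr _ _) lrh.
exact: leq_trans (leq_addl _ _) lrh.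
Qed.

Definition trees n := [seq T <- trees_upto n | bsize T == n].

Lemma mem_trees n T : (T \in trees n) = (bsize T == n).
Proof.
rewrite mem_filter; apply: andb_idr => /eqP <-.
exact: mem_trees_upto.
Qed.

Lemma trees_uniq n : uniq (trees n).
Proof. by rewrite filter_uniq // trees_upto_uniq. Qed.

Lemma perm_trees n h : (n <= h)%N ->
  perm_eq (trees n) [seq T <- trees_upto h | bsize T == n].
Proof.
move=> nh; apply: uniq_perm; rewrite ?filter_uniq ?trees_upto_uniq //.
move=> T; rewrite mem_trees mem_filter; apply/esym/andb_idr => /eqP eT.
by rewrite mem_trees_upto // eT.
Qed.

Section Expectation.
Context {R : realType}.
Implicit Types F G : btree -> R.

(** The hook length formula: the product over the nodes of the inverse sizes of their fringe trees
    is the probability of [T] among the trees of its size. *)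
Fixpoint bst_weight (T : btree) : R :=
  match T with
  | EmptyTree => 1
  | BNode l r => (bsize T)%:R^-1 * (bst_weight l * bst_weight r)
  end.

Lemma bst_weight_gt0 T : 0 < bst_weight T.
Proof.
elim: T => [|l IHl r IHr]; first exact: ltr01.
by rewrite /= bsize_node mulr_gt0 ?invr_gt0 ?ltr0n // mulr_gt0.
Qed.

Definition bstE n F : R := \sum_(T <- trees n) bst_weight T * F T.

Lemma bstE_upto n h F : (n <= h)%N ->
  bstE n F = \sum_(T <- trees_upto h | bsize T == n) bst_weight T * F T.
Proof. by move=> nh; rewrite /bstE (perm_big _ (perm_trees nh)) big_filter. Qed.

Lemma bstE0 F : bstE 0 F = F EmptyTree.
Proof. by rewrite /bstE /trees /= big_seq1 mul1r. Qed.

(** Conditioning on the root: the left subtree has uniform size [k], and given [k] the two subtrees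
    are independent. *)
Lemma bstES n F : bstE n.+1 F =
  n.+1%:R^-1 * \sum_(k < n.+1) bstE k (fun l => bstE (n - k)%N (fun r => F (BNode l r))).
Proof.
rewrite (bstE_upto _ (leqnn _)) big_mkcond trees_uptoS big_cons /= add0r.
rewrite big_allpairs_dep.
under eq_bigr => l _ do rewrite -big_mkcond.
rewrite mulr_sumr.
under [RHS]eq_bigr => k _.
  rewrite (bstE_upto _ (ltn_ord k : (k <= n)%N)) mulr_sumr.
  under eq_bigr => l _ do rewrite (bstE_upto _ (leq_subr k n)).
  over.
(* All inner sums range over the same list [trees_upto n], so they can be exchanged; for a given [l]
   only [k = bsize l] contributes, and nothing if [l] has more than [n] nodes. *)
rewrite [RHS](exchange_big_dep xpredT) //=; apply: eq_bigr => l _.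
transitivity (\sum_(i < n.+1 | bsize l == i) \sum_(r <- trees_upto n |
   bsize r == (n - i)%N) bst_weight (BNode l r) * F (BNode l r)); last first.
  apply: eq_bigr => i /eqP li; rewrite !mulr_sumr; apply: eq_bigr => r /eqP rE.
  have := ltn_ord i; rewrite ltnS => /subnKC; rewrite -rE -{1}li => lr.
  by rewrite /= bsize_node lr; ring.
case: (leqP (bsize l) n) => ln.
  rewrite (big_pred1 (Ordinal (ln : (bsize l < n.+1)%N))); last first.
    by move=> i; rewrite /= -val_eqE /= eq_sym.
  apply: eq_bigl => r; rewrite bsize_node eqSS.
  by apply/eqP/eqP => /=; [move <- ; rewrite addKn | move->; rewrite subnKC].
rewrite big_pred0 => [|r]; last first.
  by rewrite bsize_node eqSS gtn_eqF // (leq_trans ln) // leq_addr.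
by rewrite big_pred0 // => i; rewrite gtn_eqF // (leq_ltn_trans _ ln) // -ltnS.
Qed.

Lemma eq_bstE n F G : (forall T, bsize T = n -> F T = G T) -> bstE n F = bstE n G.
Proof.
move=> FG; rewrite /bstE; apply: eq_big_seq => T.
by rewrite mem_trees => /eqP /FG ->.
Qed.

Lemma le_bstE n F G : (forall T, bsize T = n -> F T <= G T) -> bstE n F <= bstE n G.
Proof.
move=> FG; rewrite /bstE big_seq [leRHS]big_seq; apply: ler_sum => T.
by rewrite mem_trees => /eqP /FG FGT; rewrite ler_pM2l // bst_weight_gt0.
Qed.

Lemma bstED n F G : bstE n (fun T => F T + G T) = bstE n F + bstE n G.
Proof. by rewrite /bstE -big_split; apply: eq_bigr => T _; rewrite mulrDr. Qed.

Lemma bstEZ n a F : bstE n (fun T => a * F T) = a * bstE n F.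
Proof. by rewrite /bstE mulr_sumr; apply: eq_bigr => T _; rewrite mulrCA. Qed.

Lemma bstEZr n a F : bstE n (fun T => F T * a) = bstE n F * a.
Proof. by rewrite /bstE mulr_suml; apply: eq_bigr => T _; rewrite mulrA. Qed.

Lemma bstEN n F : bstE n (fun T => - F T) = - bstE n F.
Proof. by rewrite /bstE -sumrN; apply: eq_bigr => T _; rewrite mulrN. Qed.

Lemma bstEB n F G : bstE n (fun T => F T - G T) = bstE n F - bstE n G.
Proof. by rewrite bstED bstEN. Qed.

Lemma bstE_cst n a : bstE n (fun=> a) = a.
Proof.
elim/ltn_ind: n => -[|n] IH; first by rewrite bstE0.
rewrite bstES (eq_bigr (fun=> a)) => [|k _].
  by rewrite sumr_const card_ord -(mulr_natl a) mulKf ?pnatr_eq0.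
by rewrite !IH // ltnS ?leq_subr // -ltnS.
Qed.

Lemma bstE_ge0 n F : (forall T, bsize T = n -> 0 <= F T) -> 0 <= bstE n F.
Proof. by move=> F0; rewrite -(bstE_cst n 0) le_bstE. Qed.

Lemma ler_norm_bstE n F : `|bstE n F| <= bstE n (fun T => `|F T|).
Proof.
rewrite /bstE (le_trans (ler_norm_sum _ _ _)) // ler_sum // => T _.
by rewrite normrM (gtr0_norm (bst_weight_gt0 T)).
Qed.

Lemma bstE_le_cst n F a : (forall T, bsize T = n -> F T <= a) -> bstE n F <= a.
Proof. by move=> Fa; rewrite -(bstE_cst n a) le_bstE. Qed.

(* The number of smaller elements determines a unique pivot, so the sum over
   pivots in [bst_pmf] has exactly one non-zero term. *)
Lemma bst_pmfE (s : seq R) T : uniq s ->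
  bst_pmf s T = (size s == bsize T)%:R * bst_weight T.
Proof.
elim: T s => [|l IHl r IHr] s us /=; first by rewrite mulr1 size_eq0.
transitivity ((size s)%:R^-1 * \sum_(x <- sort <=%O s)
   ((count (< x) s == bsize l) && (count (> x) s == bsize r))%:R *
   (bst_weight l * bst_weight r)).
  congr (_ * _); have -> : \sum_(x <- sort <=%O s)
      ((count (< x) s == bsize l) && (count (> x) s == bsize r))%:R *
        (bst_weight l * bst_weight r) =
    \sum_(x <- s)
      ((count (< x) s == bsize l) && (count (> x) s == bsize r))%:R *
        (bst_weight l * bst_weight r) :> R.
    by apply: perm_big; rewrite perm_sort.
  apply: eq_bigr => x _; rewrite IHl ?filter_uniq // IHr ?filter_uniq //.
  by rewrite !size_filter -mulnb natrM mulrACA.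
rewrite -mulr_suml [LHS]mulrA [RHS]mulrA; congr (_ * _).
rewrite -/(sort <=%O s); set s' := sort <=%O s.
have ss' : perm_eq s s' by rewrite perm_sym perm_sort.
have szE : size s = size s' by rewrite size_sort.
have srt : sorted <%O s' by rewrite sort_lt_sorted.
rewrite bsize_node szE. rewrite (big_nth 0) big_mkord.
have cl i : (i < size s')%N -> count (< s'`_i) s = i.
  by move=> ?; rewrite (permP ss'); exact: count_lt_nth.
have cr i : (i < size s')%N -> count (> s'`_i) s = (size s' - i.+1)%N.
  move=> ilt; rewrite -(count_predC (<= s'`_i) s') (count_le_nth 0) // addKn.
  by rewrite (permP ss'); apply: eq_count => y /=; rewrite ltNge.
under eq_bigr => i _ do rewrite cl // cr //.
have [e|ne] := eqVneq (size s') (bsize l + bsize r).+1; last first.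
  rewrite big1 ?mulr0 ?mul0r // => i _; apply/eqP; rewrite pnatr_eq0 eqb0.
  apply: contra ne => /andP[/eqP <- /eqP <-].
  by rewrite -addSn subnKC.
have lt : (bsize l < size s')%N by rewrite e ltnS leq_addr.
rewrite (bigD1 (Ordinal lt)) //= eqxx big1 ?addr0.
  by rewrite e subSS addKn eqxx mulr1 mul1r.
by move=> i ne; rewrite (_ : (i == bsize l :> nat) = false) //; apply/negbTE.
Qed.

End Expectation.

(** * Compression and fringe counts *)

Lemma btree_eqE l r l' r' :
  (BNode l r == BNode l' r') = (l == l') && (r == r').
Proof. by apply/eqP/andP => [[-> ->]|[/eqP-> /eqP->]]. Qed.

Lemma fringe_count_node t l r : fringe_count t (BNode l r) =
  ((BNode l r == t) + fringe_count t l + fringe_count t r)%N.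
Proof. by rewrite /fringe_count /= count_cat !count_map addnA. Qed.

Lemma fringe_count_small t T : (bsize T < bsize t)%N -> fringe_count t T = 0%N.
Proof.
elim: T => [//|l IHl r IHr] ltt; rewrite fringe_count_node.
move: (ltt); rewrite bsize_node => ltt'.
rewrite IHl ?IHr ?addn0; [|lia|lia].
by apply/eqP; rewrite eqb0; apply: contraTneq ltt => ->; rewrite ltnn.
Qed.

Lemma fringe_count_self t : t != EmptyTree -> fringe_count t t = 1%N.
Proof.
case: t => // l r _; rewrite fringe_count_node eqxx.
by rewrite !fringe_count_small // bsize_node; lia.
Qed.

Lemma fringe_count_le t T : (fringe_count t T <= bsize T)%N.
Proof. exact: count_size. Qed.

Lemma nodes_uniq T : uniq (nodes T).
Proof.
elim: T => //= l IHl r IHr; apply/andP; split.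
  by rewrite mem_cat; apply/norP; split; apply/mapP => -[].
rewrite cat_uniq !map_inj_uniq ?IHl ?IHr ?andbT //= => [|u v []//|u v []//].
by apply/hasPn => _ /mapP[v _ ->]; apply/mapP => -[].
Qed.

Lemma fringe_nodes T v : (fringe T v == EmptyTree) = (v \notin nodes T).
Proof.
elim: T v => [|l IHl r IHr] [|b v] //=; rewrite inE mem_cat /=.
have inj c : injective (cons c : address -> address) by move=> u w [].
case: b; rewrite ?IHl ?IHr mem_map //; congr negb.
  by rewrite (_ : (_ \in _) = false) //; apply/mapP => -[].
by rewrite orbC (_ : (_ \in _) = false) //; apply/mapP => -[].
Qed.

Lemma full_node l r : full (BNode l r) =
  (l == EmptyTree) && (r == EmptyTree) || full l && full r.
Proof.
rewrite /full /= all_cat !all_map /outdegree /=.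
rewrite (@eq_all _ _ (fun v => (outdegree l v == 0)%N || (outdegree l v == 2)%N)) //.
rewrite (@eq_all _ (preim _ _) (fun v => (outdegree r v == 0)%N || (outdegree r v == 2)%N)) //.
by case: (eqVneq l EmptyTree) => [->|_]; case: (eqVneq r EmptyTree) => [->|_] /=; rewrite ?andbF.
Qed.

Definition branching (T : btree) : bool :=
  if T is BNode l r then (l == EmptyTree) == (r == EmptyTree) else false.

Lemma compress_node l r : compress (BNode l r) =
  if branching (BNode l r) then BNode (compress l) (compress r)
  else if l == EmptyTree then compress r else compress l.
Proof. by case: l => [|? ?]; case: r. Qed.

Lemma compress_eq0 T : (compress T == EmptyTree) = (T == EmptyTree).
Proof.
elim: T => // l IHl r IHr; rewrite compress_node /branching.
by case: (eqVneq l EmptyTree) IHl => [->|_] IHl; case: (eqVneq r EmptyTree) IHr => [->|_] IHr.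
Qed.

Lemma full_compress T : T != EmptyTree -> full (compress T).
Proof.
elim: T => // l IHl r IHr _; rewrite compress_node /branching.
case: (eqVneq l EmptyTree) IHl => [->|l0] IHl; case: (eqVneq r EmptyTree) IHr => [->|r0] IHr //=.
- exact: IHr.
- exact: IHl.
- by rewrite full_node IHl // IHr // orbT.
Qed.

Lemma full_neq0 t : full t -> t != EmptyTree.
Proof. by case/andP. Qed.

Lemma compress_full t : full t -> compress t = t.
Proof.
elim: t => // l IHl r IHr; rewrite full_node => /orP[/andP[/eqP -> /eqP ->]//|].
move=> /andP[fl fr]; rewrite compress_node /branching IHl // IHr //.
by rewrite (negbTE (full_neq0 fl)) (negbTE (full_neq0 fr)).
Qed.

Lemma full_branching t : full t -> branching t.
Proof.
case: t => // l r; rewrite full_node /branching => /orP[/andP[-> ->]//|].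
by move=> /andP[/full_neq0/negbTE-> /full_neq0/negbTE->].
Qed.

Definition leaf : btree := BNode EmptyTree EmptyTree.

(** There is one more leaf than there are inner nodes. This turns the size of a compressed tree into
    a fringe count. *)
Lemma bsize_full t : full t -> (bsize t).+1 = (2 * fringe_count leaf t)%N.
Proof.
elim: t => // l IHl r IHr; rewrite full_node fringe_count_node bsize_node btree_eqE.
move=> /orP[/andP[/eqP -> /eqP ->]//|/andP[fl fr]].
move: (IHl fl) (IHr fr); rewrite (negbTE (full_neq0 fl)) /=; lia.
Qed.

(** A root of outdegree 1 disappears and leaves the compressed tree of its child; without
    [branching] a copy of [t] would be counted again at such deleted ancestors. *)
Definition toll (t T : btree) : bool := branching T && (compress T == t).

Lemma fringe_count_compress_node t l r : t != EmptyTree ->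
  fringe_count t (compress (BNode l r)) =
  (fringe_count t (compress l) + fringe_count t (compress r) +
   toll t (BNode l r))%N.
Proof.
move=> t0; rewrite compress_node /toll compress_node.
case: ifP => /= br; first by rewrite fringe_count_node -addnA addnC.
rewrite addn0; case: (eqVneq l EmptyTree) br => [->//|_].
by case: (eqVneq r EmptyTree) => // -> _; rewrite addn0.
Qed.

Lemma toll_fringe_count t T : t != EmptyTree -> toll t T ->
  fringe_count t (compress T) = 1%N.
Proof. by move=> t0 /andP[_ /eqP ->]; rewrite fringe_count_self. Qed.

Lemma bsize_compress T : (bsize (compress T) <= bsize T)%N.
Proof.
elim: T => // l IHl r IHr; rewrite compress_node.
case: ifP => _; first by rewrite !bsize_node ltnS leq_add.
by case: ifP => _; rewrite bsize_node; lia.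
Qed.

Lemma fringe_count_compress_le t T :
  (fringe_count t (compress T) <= bsize T)%N.
Proof. exact: leq_trans (fringe_count_le _ _) (bsize_compress T). Qed.

(** * Gaussian expectations *)

Section Gaussian.
Context {R : realType}.
Notation mu := (@lebesgue_measure R).
Implicit Types (f g h : R -> R) (s t l x y : R).

Lemma integral_translation h c : continuous h -> (forall x, 0 <= h x) ->
  (\int[mu]_x (h x)%:E = \int[mu]_x (h (x + c))%:E)%E.
Proof.
move=> ch h0; pose F (x : R^o) := x + c.
have F'E : F^`()%classic = cst 1.
  by apply/funext => x; rewrite /F derive1E deriveD// derive_id derive_cst addr0.
rewrite (@increasing_ge0_integration_by_substitutionT _ F) //; first last.
- exact: cvg_addrr.
- exact: cvg_addrr_Ny.
- by rewrite F'E; exact: is_cvg_cst.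
- by rewrite F'E; exact: is_cvg_cst.
- by rewrite F'E => ?; exact: cvg_cst.
- by move=> x y xy; rewrite /F ltrD2r.
by apply: eq_integral => x _; rewrite F'E /= !fctE mulr1.
Qed.

(** Completing the square in [y]: the joint density is the density of the sum times the conditional
    density of the first variable given the sum, and the latter integrates to 1. *)
Lemma normal_pdf_convE s t u y : 0 < s -> 0 < t ->
  normal_pdf 0 s y * normal_pdf 0 t (u - y) =
  normal_pdf 0 (Num.sqrt (s ^+ 2 + t ^+ 2)) u *
  normal_pdf (u * s ^+ 2 / (s ^+ 2 + t ^+ 2))
    (s * t / Num.sqrt (s ^+ 2 + t ^+ 2)) y.
Proof.
move=> s0 t0; set q := s ^+ 2 + t ^+ 2.
have q0 : 0 < q by rewrite addr_gt0 ?exprn_gt0.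
have r0 : 0 < Num.sqrt q by rewrite sqrtr_gt0.
have rE : Num.sqrt q ^+ 2 = q by rewrite sqr_sqrtr // ltW.
have v0 : 0 < s * t / Num.sqrt q by rewrite divr_gt0 ?mulr_gt0.
rewrite !normal_pdfE ?gt_eqF // mulrACA [RHS]mulrACA; congr (_ * _).
  rewrite /normal_peak -!invfM; congr (_^-1).
  rewrite -!sqrtrM; try by rewrite mulrn_wge0 // mulr_ge0 ?pi_ge0 ?sqr_ge0.
  congr Num.sqrt; rewrite rE exprMn exprVn rE exprMn !mulr2n.
  by field; rewrite gt_eqF.
rewrite /normal_fun -!expRD; congr expR.
rewrite rE !subr0 exprMn exprVn rE exprMn !mulr2n /q; field.
by rewrite !lt0r_neq0 ?addr_gt0 ?exprn_gt0 ?mulr_gt0.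
Qed.

Definition gaussE s f : R := (\int[mu]_y (f y * normal_pdf 0 s y))%R.

Definition gauss_int s f :=
  mu.-integrable setT (EFin \o (fun y => f y * normal_pdf 0 s y)).

Lemma gauss_int_dom s f g : measurable_fun setT f ->
  (forall y, `|f y| <= g y) -> gauss_int s g -> gauss_int s f.
Proof.
move=> mf fg; apply: le_integrable => //.
  by apply/measurable_EFinP/measurable_funM => //; exact: measurable_normal_pdf.
move=> y _ /=; rewrite lee_fin !normrM ler_wpM2r //.
by rewrite (le_trans (fg y)) // ler_norm.
Qed.

Lemma gauss_intD s f g : gauss_int s f -> gauss_int s g ->
  gauss_int s (fun y => f y + g y).
Proof.
move=> fi gi; have := integrableD measurableT fi gi.
by apply: eq_integrable => // y _ /=; rewrite mulrDl.
Qed.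

Lemma gauss_intZ s a f : gauss_int s f -> gauss_int s (fun y => a * f y).
Proof.
move=> fi; have := integrableZl measurableT a fi.
by apply: eq_integrable => // y _ /=; rewrite -EFinM mulrA.
Qed.

Lemma gauss_intN s f : gauss_int s f -> gauss_int s (fun y => - f y).
Proof.
move=> /(gauss_intZ (-1)); congr gauss_int.
by apply/funext => y; rewrite mulN1r.
Qed.

Lemma gauss_int_cst s a : gauss_int s (fun=> a).
Proof.
have := integrableZl measurableT a (integrable_normal_pdf 0 s).
by apply: eq_integrable.
Qed.

Lemma gaussED s f g : gauss_int s f -> gauss_int s g ->
  gaussE s (fun y => f y + g y) = gaussE s f + gaussE s g.
Proof.
move=> fi gi; rewrite /gaussE -RintegralD //.
by apply: eq_Rintegral => y _; rewrite mulrDl.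
Qed.

Lemma gaussEZ s a f : gauss_int s f ->
  gaussE s (fun y => a * f y) = a * gaussE s f.
Proof.
move=> fi; rewrite /gaussE -RintegralZl //.
by apply: eq_Rintegral => y _; rewrite mulrA.
Qed.

Lemma gaussEN s f : gauss_int s f -> gaussE s (fun y => - f y) = - gaussE s f.
Proof.
move=> fi; rewrite -mulN1r -gaussEZ //; congr gaussE.
by apply/funext => y; rewrite mulN1r.
Qed.

Lemma gaussEB s f g : gauss_int s f -> gauss_int s g ->
  gaussE s (fun y => f y - g y) = gaussE s f - gaussE s g.
Proof. by move=> fi gi; rewrite gaussED ?gaussEN //; exact: gauss_intN. Qed.

Lemma gaussE_cst s a : gaussE s (fun=> a) = a.
Proof.
rewrite /gaussE RintegralZl //; last exact: integrable_normal_pdf.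
by rewrite /Rintegral integral_normal_pdf mulr1.
Qed.

Lemma le_gaussE s f g : gauss_int s f -> gauss_int s g ->
  (forall y, f y <= g y) -> gaussE s f <= gaussE s g.
Proof.
move=> fi gi fg; apply: le_Rintegral => // y _.
by rewrite ler_wpM2r // normal_pdf_ge0.
Qed.

Lemma ler_norm_gaussE s f g : gauss_int s f -> gauss_int s g ->
  (forall y, `|f y| <= g y) -> `|gaussE s f| <= gaussE s g.
Proof.
move=> fi gi fg; rewrite ler_norml -gaussEN //.
apply/andP; split; apply: le_gaussE => //; first exact: gauss_intN.
  by move=> y; have := fg y; rewrite ler_norml => /andP[].
by move=> y; have := fg y; rewrite ler_norml => /andP[].
Qed.

Lemma gaussE_sum s (I : Type) (r : seq I) (w : I -> R) (F : I -> R -> R) :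
  (forall i, gauss_int s (F i)) ->
  gauss_int s (fun y => \sum_(i <- r) w i * F i y) /\
  gaussE s (fun y => \sum_(i <- r) w i * F i y) = \sum_(i <- r) w i * gaussE s (F i).
Proof.
move=> Fi; elim: r => [|i r [IHi IH]].
  have -> : (fun y => \sum_(i <- [::]) w i * F i y) = fun=> 0.
    by apply/funext => y; rewrite big_nil.
  by rewrite big_nil gaussE_cst; split=> //; exact: gauss_int_cst.
have -> : (fun y => \sum_(i <- i :: r) w i * F i y) =
  fun y => w i * F i y + \sum_(i <- r) w i * F i y.
  by apply/funext => y; rewrite big_cons.
have wi := gauss_intZ (w i) (Fi i).
split; first exact: gauss_intD.
by rewrite gaussED // gaussEZ // big_cons IH.
Qed.

(** Translation by [y] in the inner integral, then Tonelli, which applies because [h] is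
    nonnegative; the bound [M] makes the inner integrals finite. *)
Lemma gaussE_conv s t h M : 0 < s -> 0 < t -> continuous h ->
  (forall x, 0 <= h x <= M) ->
  gaussE s (fun y => gaussE t (fun z => h (y + z))) =
  gaussE (Num.sqrt (s ^+ 2 + t ^+ 2)) h.
Proof.
move=> s0 t0 ch hM; set r := Num.sqrt _.
have mh : measurable_fun setT h by exact: continuous_measurable_fun.
have h0 x : 0 <= h x by case/andP: (hM x).
have p0 m v (x : R) : 0 <= normal_pdf m v x by exact: normal_pdf_ge0.
have mp m v := measurable_normal_pdf m v : measurable_fun setT (normal_pdf m v : R -> R).
have hi v y : gauss_int v (fun z => h (y + z)).
  apply: (@gauss_int_dom v _ (fun=> M)); last exact: gauss_int_cst.
    by apply: measurableT_comp => //; exact: measurable_funD.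
  by move=> z; rewrite ger0_norm //; case/andP: (hM (y + z)).
transitivity (fine (\int[mu]_y \int[mu]_z (h (y + z) * normal_pdf 0 t z *
    normal_pdf 0 s y)%:E)%E).
  apply: (congr1 fine); apply: eq_integral => y _.
  under [RHS]eq_integral do rewrite mulrC EFinM.
  rewrite ge0_integralZl //; last 3 first.
  - by apply/measurable_EFinP; case/integrableP: (hi t y) => /measurable_EFinP.
  - by move=> z _; rewrite lee_fin mulr_ge0.
  - by rewrite lee_fin.
  rewrite EFinM muleC fineK //; exact: integrable_fin_num (hi t y).
transitivity (fine (\int[mu]_y \int[mu]_u (h u * normal_pdf 0 t (u - y) *
    normal_pdf 0 s y)%:E)%E).
  apply: (congr1 fine); apply: eq_integral => y _.
  rewrite [RHS](@integral_translation (fun u => h u * normal_pdf 0 t (u - y) * normal_pdf 0 s y) y); first last.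
  - by move=> u; rewrite !mulr_ge0.
  - move=> u; apply: cvgM; last exact: cvg_cst.
    apply: cvgM; first exact: ch.
    have cs : {for u, continuous (fun u : R => u - y)}.
      by apply: cvgB; [exact: cvg_id | exact: cvg_cst].
    apply: (continuous_comp cs); apply: continuous_normal_pdf.
    by rewrite gt_eqF.
  by apply: eq_integral => z _; rewrite addrK addrC.
rewrite (@fubini_tonelli _ _ _ _ _ mu mu
   (fun yu => (h yu.2 * normal_pdf 0 t (yu.2 - yu.1) * normal_pdf 0 s yu.1)%:E)) //=; first last.
- by move=> [y u]; rewrite lee_fin !mulr_ge0.
- apply/measurable_EFinP; apply: measurable_funM.
    apply: measurable_funM; first exact: (measurableT_comp mh).
    by apply: (measurableT_comp (mp _ _)); exact: measurable_funB.
  exact: (measurableT_comp (mp _ _)).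
rewrite /gaussE /Rintegral; apply: (congr1 fine); apply: eq_integral => u _.
under eq_integral do
  rewrite -mulrA (mulrC (normal_pdf 0 t _)) normal_pdf_convE // mulrA EFinM.
rewrite ge0_integralZl //; last 3 first.
- by apply/measurable_EFinP; exact: measurable_normal_pdf.
- by move=> y _; rewrite lee_fin.
- by rewrite lee_fin mulr_ge0.
by rewrite integral_normal_pdf mule1.
Qed.

End Gaussian.

(** * Taylor expansion and the logistic test function *)

Section Taylor.
Context {R : realType}.
Implicit Types (f g : R -> R) (x y z : R).

Lemma ler_norm_mvt f f1 x y K :
  (forall z, is_derive z 1 f (f1 z)) ->
  (forall z, `|z - x| <= `|y - x| -> `|f1 z| <= K) ->
  `|f y - f x| <= K * `|y - x|.
Proof.
move=> df f1K.
have cf : continuous f.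
  move=> z; apply/differentiable_continuous/derivable1_diffP.
  by have := df z; case.
have mvt a b : a <= b -> exists2 c, a <= c <= b & f b - f a = f1 c * (b - a).
  move=> ab; have [c cab ->] := MVT_segment ab (fun z _ => df z) (continuous_subspaceT cf).
  by exists c.
case: (leP x y) => [xy|/ltW yx].
  have [c /andP[xc cy] ->] := mvt _ _ xy; rewrite normrM ler_wpM2r //.
  by apply: f1K; rewrite !ger0_norm ?subr_ge0 ?lerD2r.
have [c /andP[xc cy] e] := mvt _ _ yx.
rewrite distrC e normrM (distrC x y) ler_wpM2r //; apply: f1K.
by rewrite !ler0_norm ?subr_le0 // lerN2 lerD2r.
Qed.

(** The mean value inequality is applied twice, to the remainder and to its derivative. A Lipschitz
    estimate of [f2] at [x] stands in for a third derivative, at the price of the constant [M]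
    instead of [M / 6]. *)
Lemma taylor2 f f1 f2 x y M : 0 <= M ->
  (forall z, is_derive z 1 f (f1 z)) ->
  (forall z, is_derive z 1 f1 (f2 z)) ->
  (forall z, `|z| <= `|y| -> `|f2 (x + z) - f2 x| <= M * `|z|) ->
  `|f (x + y) - f x - f1 x * y - f2 x / 2 * y ^+ 2| <= M * `|y| ^+ 3.
Proof.
move=> M0 df df1 f2M.
have dlin a z : is_derive z 1 (fun w : R => a * (w - x)) a.
  have d0 := @is_deriveB R R R id (cst x) z 1 1 0 (is_derive_id _ _) (is_derive_cst _ _ _).
  have d1 := @is_deriveZ R R _ _ a z 1 _ d0.
  by apply: (is_derive_eq d1); rewrite subr0 /GRing.scale /= mulr1.
have dsq a z : is_derive z 1 (fun w : R => a / 2 * (w - x) ^+ 2) (a * (z - x)).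
  have d1 : is_derive z 1 (fun w : R => w - x) 1.
    have := dlin 1 z; congr (is_derive _ _ _ _); apply/funext => w; exact: mul1r.
  have d2 := @is_deriveX R R (fun w : R => w - x) 2 z 1 1 d1.
  have d3 := @is_deriveZ R R _ _ (a / 2) z 1 _ d2.
  have -> : (fun w : R => a / 2 * (w - x) ^+ 2) =
    (a / 2) *: ((fun w : R => w - x) ^+ 2) by apply/funext => w.
by apply: (is_derive_eq d3); rewrite /GRing.scale /= expr1; field.
pose g1 w := f1 w - f1 x - f2 x * (w - x).
have dg1 z : is_derive z 1 g1 (f2 z - f2 x).
  have d1 := @is_deriveB R R R f1 (cst (f1 x)) z 1 _ 0 (df1 z) (is_derive_cst _ _ _).
  have := @is_deriveB R R R _ _ z 1 _ _ d1 (dlin (f2 x) z).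
  by rewrite subr0.
pose g w := f w - f x - f1 x * (w - x) - f2 x / 2 * (w - x) ^+ 2.
have dg z : is_derive z 1 g (g1 z).
  have d1 := @is_deriveB R R R f (cst (f x)) z 1 _ 0 (df z) (is_derive_cst _ _ _).
  have d2 := @is_deriveB R R R _ _ z 1 _ _ d1 (dlin (f1 x) z).
  have := @is_deriveB R R R _ _ z 1 _ _ d2 (dsq (f2 x) z).
  by rewrite subr0.
have g1x : g1 x = 0 by rewrite /g1 !subrr mulr0 subr0.
have gx : g x = 0 by rewrite /g !subrr expr0n !mulr0 !subr0.
have g1M z : `|z - x| <= `|y| -> `|g1 z| <= M * `|y| ^+ 2.
  move=> zy; have -> : g1 z = g1 z - g1 x by rewrite g1x subr0.
  have K0 : 0 <= M * `|y| by rewrite mulr_ge0.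
  apply: le_trans (_ : M * `|y| * `|z - x| <= _).
    apply: (ler_norm_mvt dg1) => w wz.
    have wy := le_trans wz zy.
    have := f2M (w - x) wy; rewrite (addrC x) subrK => /le_trans; apply.
    by rewrite ler_wpM2l.
  by rewrite expr2 mulrA ler_wpM2l.
have := @ler_norm_mvt g g1 x (x + y) (M * `|y| ^+ 2) dg.
have -> : x + y - x = y by rewrite addrC addKr.
rewrite gx subr0 => /(_ g1M); rewrite -mulrA -exprSr /g.
by have -> : x + y - x = y by rewrite addrC addKr.
Qed.

Lemma ler_norm_expR1 z : `|expR z - 1| <= expR `|z| * `|z|.
Proof.
have := @ler_norm_mvt expR expR 0 z (expR `|z|) (@is_derive_expR R).
rewrite subr0 expR0; apply => w; rewrite subr0 => wz.
by rewrite ger0_norm ?expR_ge0 // ler_expR (le_trans (ler_norm w)).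
Qed.

Lemma taylor2_expR y :
  `|expR y - 1 - y - y ^+ 2 / 2| <= expR `|y| * `|y| ^+ 3.
Proof.
have := @taylor2 expR expR expR 0 y (expR `|y|) (expR_ge0 _) (@is_derive_expR R) (@is_derive_expR R).
rewrite add0r expR0 mul1r mul1r (mulrC _ (y ^+ 2)); apply => z zy.
rewrite add0r (le_trans (ler_norm_expR1 z)) // ler_wpM2r //.
by rewrite ler_expR.
Qed.

(** A smooth decreasing step from 1 to 0. Its derivatives are polynomials in the function itself, so
    they are bounded by algebra from [0 <= logistic x <= 1]. *)
Definition logistic x : R := (1 + expR x)^-1.

Lemma logistic_bounds x : 0 <= logistic x <= 1.
Proof.
have e0 := expR_gt0 x.
rewrite /logistic invr_ge0 invf_le1; last by rewrite addr_gt0.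
by rewrite lerDl (ltW e0) addr_ge0 // ltW.
Qed.

Definition logistic1 x : R := logistic x ^+ 2 - logistic x.
Definition logistic2 x : R := (2 * logistic x - 1) * logistic1 x.

Lemma is_derive_logistic x :
  is_derive x 1 logistic (logistic1 x).
Proof.
have e0 := expR_gt0 x.
have n0 : 1 + expR x != 0 by rewrite gt_eqF // addr_gt0.
have d1 := @is_deriveD R R R (cst 1) expR x 1 0 _ (is_derive_cst _ _ _) (is_derive_expR x).
have dd : derivable (fun z : R => 1 + expR z) x 1 by case: d1 => + _; exact.
have dv : 'D_1 (fun z : R => 1 + expR z) x = expR x.
  by case: d1 => _; rewrite add0r; exact.
split; first exact: derivableV.
rewrite /logistic1 /logistic deriveV // dv.
by rewrite /GRing.scale /=; field.
Qed.

Lemma logisticC x : 1 - logistic (- x) = logistic x.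
Proof.
rewrite /logistic expRN; field.
have := expR_gt0 x => e0; rewrite !gt_eqF ?addr_gt0 //.
Qed.

Lemma logistic_le x : 0 < x -> logistic x <= x^-1.
Proof.
move=> x0; rewrite lef_pV2 ?posrE ?addr_gt0 ?expR_gt0 //.
have := expR_ge1Dx x; lra.
Qed.

Lemma logistic_lip x y : `|logistic (x + y) - logistic x| <= `|y|.
Proof.
have := @ler_norm_mvt logistic _ x (x + y) 1 is_derive_logistic.
rewrite mul1r addrAC subrr add0r; apply => z _.
have /andP[h0 h1] := logistic_bounds z.
rewrite /logistic1 ler_norml; apply/andP; split; nra.
Qed.

Lemma is_derive_logistic1 x : is_derive x 1 logistic1 (logistic2 x).
Proof.
have dx := is_derive_logistic x.
have d2 := @is_deriveX R R logistic 2 x 1 _ dx.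
have d3 := @is_deriveB R R R _ _ x 1 _ _ d2 dx.
by apply: (is_derive_eq d3); rewrite /logistic2 /GRing.scale /= expr1; ring.
Qed.

Lemma logistic1_bound x : `|logistic1 x| <= 1.
Proof.
have /andP[h0 h1] := logistic_bounds x.
rewrite /logistic1 ler_norml; apply/andP; split; nra.
Qed.

Lemma logistic2_bound x : `|logistic2 x| <= 1.
Proof.
have /andP[h0 h1] := logistic_bounds x.
rewrite /logistic2 normrM mulr_ile1 ?logistic1_bound //.
rewrite ler_norml; apply/andP; split; lra.
Qed.

(** [logistic2] is a cubic polynomial in the 1-Lipschitz function [logistic]; on the unit square the
    divided difference of this cubic is at most [6 + 6 + 1 = 13]. *)
Lemma taylor2_logistic x y :
  `|logistic (x + y) - logistic x - logistic1 x * y - logistic2 x / 2 * y ^+ 2|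
    <= 13 * `|y| ^+ 3.
Proof.
apply: (taylor2 _ is_derive_logistic is_derive_logistic1) => // z _.
have := logistic_lip x z; rewrite /logistic2 /logistic1.
have /andP[] := logistic_bounds x; have /andP[] := logistic_bounds (x + z).
set u := logistic x; set v := logistic (x + z) => v0 v1 u0 u1 vu.
have -> : (2 * v - 1) * (v ^+ 2 - v) - (2 * u - 1) * (u ^+ 2 - u) =
  (2 * (v ^+ 2 + u * v + u ^+ 2) - 3 * (v + u) + 1) * (v - u) by ring.
rewrite normrM ler_pM // ler_norml; apply/andP; split; nra.
Qed.

End Taylor.

(** * Gaussian moments from the moment generating function *)

Section GaussianMoments.
Context {R : realType}.
Notation mu := (@lebesgue_measure R).
Implicit Types (f g h : R -> R) (s t l x y : R).

(** Exponential tilting of a Gaussian density is a shift of its mean, so exponential moments are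
    explicit. *)
Lemma normal_pdf_expR s l y : s != 0 ->
  expR (l * y) * normal_pdf 0 s y =
  expR (l ^+ 2 * s ^+ 2 / 2) * normal_pdf (l * s ^+ 2) s y.
Proof.
move=> s0; rewrite !normal_pdfE // mulrCA [RHS]mulrCA; congr (_ * _).
rewrite /normal_fun -!expRD; congr expR; rewrite !mulr2n; field.
by rewrite -mulr2n mulrn_eq0 /= sqrf_eq0.
Qed.

Lemma gauss_int_expR s l : 0 < s -> gauss_int s (fun y => expR (l * y)).
Proof.
move=> s0; have := integrableZl measurableT (expR (l ^+ 2 * s ^+ 2 / 2))
  (integrable_normal_pdf (l * s ^+ 2) s).
apply: eq_integrable => // y _ /=.
by rewrite -EFinM normal_pdf_expR // gt_eqF.
Qed.

Lemma gaussE_expR s l : 0 < s ->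
  gaussE s (fun y => expR (l * y)) = expR (l ^+ 2 * s ^+ 2 / 2).
Proof.
move=> s0; rewrite /gaussE.
under eq_Rintegral => y _ do rewrite normal_pdf_expR ?gt_eqF //.
rewrite RintegralZl //; last exact: integrable_normal_pdf.
by rewrite /Rintegral integral_normal_pdf mulr1.
Qed.

(** A majorant of [expR (|y| / s) |y|^3] with explicit expectation: for [a = |y| / s] one has
    [a^3 <= 6 expR a], and [expR (2 a)] is at most the sum of the two exponentials. *)
Definition gauss_dom s y : R :=
  6 * s ^+ 3 * (expR (2 / s * y) + expR (- (2 / s) * y)).

Lemma gauss_int_dom3 s : 0 < s -> gauss_int s (gauss_dom s).
Proof.
by move=> s0; apply: gauss_intZ; apply: gauss_intD; exact: gauss_int_expR.
Qed.

Lemma gaussE_dom3 s : 0 < s -> gaussE s (gauss_dom s) = 12 * expR 2 * s ^+ 3.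
Proof.
move=> s0; rewrite gaussEZ; last by apply: gauss_intD; exact: gauss_int_expR.
rewrite gaussED ?gaussE_expR //; try exact: gauss_int_expR.
rewrite sqrrN; have -> : (2 / s) ^+ 2 * s ^+ 2 / 2 = 2.
  by rewrite expr_div_n divfK ?expf_neq0 ?gt_eqF // expr2 mulfK.
by ring.
Qed.

Lemma le_gauss_dom s y : 0 < s -> expR (`|y| / s) * `|y| ^+ 3 <= gauss_dom s y.
Proof.
move=> s0; set a := `|y| / s; have a0 : 0 <= a by rewrite divr_ge0 // ltW.
have -> : `|y| = a * s by rewrite divfK // gt_eqF.
have a3 : a ^+ 3 <= 6 * expR a.
  have := expR_ge1Dxn 2 a0; rewrite (_ : 3`!%:R = 6 :> R) //.
  by move=> h; nra.
apply: le_trans (_ : 6 * s ^+ 3 * expR (2 * a) <= _).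
  rewrite (_ : 2 * a = a + a); last by ring.
  rewrite expRD -subr_ge0.
  have -> : 6 * s ^+ 3 * (expR a * expR a) - expR a * (a * s) ^+ 3 =
    s ^+ 3 * expR a * (6 * expR a - a ^+ 3) by ring.
  by rewrite mulr_ge0 ?subr_ge0 // mulr_ge0 ?expR_ge0 ?exprn_ge0 ?ltW.
rewrite ler_wpM2l ?mulr_ge0 ?exprn_ge0 ?(ltW s0) //.
rewrite /a mulrA mulrAC; case: (ger0P y) => _; first by rewrite lerDl expR_ge0.
by rewrite mulrN -mulNr lerDr expR_ge0.
Qed.

Lemma le_gauss_dom3 s y : 0 < s -> `|y| ^+ 3 <= gauss_dom s y.
Proof.
move=> s0; apply: le_trans (le_gauss_dom y s0); rewrite ler_peMl ?exprn_ge0 //.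
by rewrite -expR0 ler_expR divr_ge0 // ltW.
Qed.

Lemma gauss_int_norm3 s : 0 < s -> gauss_int s (fun y => `|y| ^+ 3).
Proof.
move=> s0; apply: gauss_int_dom (gauss_int_dom3 s0).
  by apply: measurable_funX; exact: normr_measurable.
by move=> y; rewrite ger0_norm ?exprn_ge0 // le_gauss_dom3.
Qed.

Lemma gaussE_norm3 s : 0 < s -> gaussE s (fun y => `|y| ^+ 3) <= 12 * expR 2 * s ^+ 3.
Proof.
move=> s0; rewrite -gaussE_dom3 //; apply: le_gaussE.
- exact: gauss_int_norm3.
- exact: gauss_int_dom3.
- by move=> y; exact: le_gauss_dom3.
Qed.

Lemma gauss_int_norm3D s : 0 < s -> gauss_int s (fun y => 1 + `|y| ^+ 3).
Proof.
by move=> s0; apply: gauss_intD; [exact: gauss_int_cst|exact: gauss_int_norm3].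
Qed.

Lemma ler_norm_1D3 y : `|y| <= 1 + `|y| ^+ 3.
Proof.
have := normr_ge0 y; move: `|y| => a a0.
have a3 : 0 <= a ^+ 3 by rewrite exprn_ge0.
have : 0 <= (a - 1) ^+ 2 * (a + 2) by rewrite mulr_ge0 ?sqr_ge0 //; lra.
by have -> : (a - 1) ^+ 2 * (a + 2) = a ^+ 3 - 3 * a + 2 by [ring]; lra.
Qed.

Lemma gauss_int_id s : 0 < s -> gauss_int s id.
Proof.
move=> s0; apply: gauss_int_dom (gauss_int_norm3D s0) => // y /=.
exact: ler_norm_1D3.
Qed.

Lemma gauss_int_sqr s : 0 < s -> gauss_int s (fun y => y ^+ 2).
Proof.
move=> s0; apply: gauss_int_dom (gauss_int_norm3D s0).
  exact: measurable_funX.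
move=> y; rewrite normrX; have := normr_ge0 y; move: `|y| => a a0.
have a3 : 0 <= a ^+ 3 by rewrite exprn_ge0.
have : 0 <= (a - 1) ^+ 2 * (2 * a + 1) by rewrite mulr_ge0 ?sqr_ge0 //; lra.
by have -> : (a - 1) ^+ 2 * (2 * a + 1) = 2 * a ^+ 3 - 3 * a ^+ 2 + 1 by [ring]; lra.
Qed.

Lemma eq0_ler_linear (a C e : R) : 0 < e ->
  (forall t, 0 < t <= e -> `|a| <= C * t) -> a = 0.
Proof.
move=> e0 aC; apply/eqP; rewrite -normr_le0; apply/ler_addgt0Pr => d d0.
rewrite add0r; have C0 : 0 <= C.
  have := aC e; rewrite e0 lexx => /(_ isT) h.
  by rewrite -(pmulr_lge0 _ e0) (le_trans _ h).
have [t0 te td] : exists2 t, 0 < t <= e & C * t <= d.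
  exists (Num.min e (d / (C + 1))).
    by rewrite lt_min e0 divr_gt0 ?ltr_wpDl //= ge_min lexx.
  apply: le_trans (_ : C * (d / (C + 1)) <= _).
    by rewrite ler_wpM2l // ge_min lexx orbT.
  by rewrite mulrCA ler_piMr ?(ltW d0) // ler_pdivrMr ?mul1r ?ltr_wpDl // lerDl.
exact: le_trans (aC _ te) td.
Qed.

(** Both sides of [gaussE_expR] are expanded to second order in [l]. Up to a cubic error the first
    two moments must match the coefficients on the right; letting [l] tend to 0 then identifies
    them. *)
Lemma gaussE_mgf_taylor s l : 0 < s -> `|l| <= s^-1 ->
  `|l * gaussE s id + l ^+ 2 / 2 * (gaussE s (fun y => y ^+ 2) - s ^+ 2)| <=
  (12 * expR 2 + expR 1 + 1) * s ^+ 3 * `|l| ^+ 3.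
Proof.
move=> s0 ls.
have ig := gauss_int_expR l s0; have i1 := gauss_int_id s0.
have i2 := gauss_int_sqr s0; have ic := gauss_int_cst s 1.
have il := gauss_intZ l i1; have il2 := gauss_intZ (l ^+ 2 / 2) i2.
have sn0 : s != 0 by rewrite gt_eqF.
have h1 : `|expR (l ^+ 2 * s ^+ 2 / 2) - 1 - l * gaussE s id -
     l ^+ 2 / 2 * gaussE s (fun y => y ^+ 2)| <= 12 * expR 2 * s ^+ 3 * `|l| ^+ 3.
  have j1 := gauss_intD ig (gauss_intN ic).
  have j2 := gauss_intD j1 (gauss_intN il).
  have j3 := gauss_intD j2 (gauss_intN il2).
  have -> : expR (l ^+ 2 * s ^+ 2 / 2) - 1 - l * gaussE s id -
      l ^+ 2 / 2 * gaussE s (fun y => y ^+ 2) =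
    gaussE s (fun y => expR (l * y) - 1 - l * y - l ^+ 2 / 2 * y ^+ 2).
    by rewrite !gaussEB // gaussE_cst !gaussEZ // gaussE_expR.
  rewrite [leRHS]mulrC -gaussE_dom3 // -gaussEZ; last exact: gauss_int_dom3.
  apply: ler_norm_gaussE => //; first exact/gauss_intZ/gauss_int_dom3.
  move=> y /=.
  have -> : expR (l * y) - 1 - l * y - l ^+ 2 / 2 * y ^+ 2 =
    expR (l * y) - 1 - l * y - (l * y) ^+ 2 / 2 by ring.
  apply: (le_trans (taylor2_expR _)); rewrite normrM exprMn mulrCA.
  rewrite ler_wpM2l ?exprn_ge0 //; apply: le_trans (le_gauss_dom y s0).
  by rewrite ler_wpM2r ?exprn_ge0 // ler_expR mulrC ler_wpM2l.
have h2 : `|expR (l ^+ 2 * s ^+ 2 / 2) - 1 - l ^+ 2 * s ^+ 2 / 2| <=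
   (expR 1 + 1) * s ^+ 3 * `|l| ^+ 3.
  have ls1 : `|l| * s <= 1 by rewrite -ler_pdivlMr // div1r.
  have ls0 : 0 <= `|l| * s by rewrite mulr_ge0 // ltW.
  have -> : l ^+ 2 * s ^+ 2 / 2 = (`|l| * s) ^+ 2 / 2.
    by rewrite exprMn real_normK ?num_real.
  have -> : (expR 1 + 1) * s ^+ 3 * `|l| ^+ 3 = (expR 1 + 1) * (`|l| * s) ^+ 3.
    by ring.
  move: ls1 ls0; set v := `|l| * s => v1 v0; set u := v ^+ 2 / 2.
  have u0 : 0 <= u by rewrite divr_ge0 ?sqr_ge0.
  have u1 : u <= 1 by rewrite /u; nra.
  have := taylor2_expR u; rewrite (ger0_norm u0) => h.
  have eu : expR u <= expR 1 by rewrite ler_expR.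
  have h' : expR u * u ^+ 3 <= expR 1 * u ^+ 3 by rewrite ler_wpM2r ?exprn_ge0.
  have uv : u ^+ 3 <= v ^+ 3 by rewrite lerXn2r ?nnegrE //; rewrite /u; nra.
  have h'' : expR 1 * u ^+ 3 <= expR 1 * v ^+ 3 by rewrite ler_wpM2l ?expR_ge0.
  have u2 : u ^+ 2 / 2 <= v ^+ 3.
    have : v ^+ 4 <= v ^+ 3 by rewrite ler_wiXn2l.
    have : 0 <= v ^+ 3 by rewrite exprn_ge0.
    rewrite /u; nra.
  have u20 : 0 <= u ^+ 2 by rewrite sqr_ge0.
  move: h; rewrite !ler_norml mulrDl mul1r => /andP[ha hb].
  by apply/andP; split; lra.
set G := expR _ in h1 h2.
have -> : l * gaussE s id + l ^+ 2 / 2 * (gaussE s (fun y => y ^+ 2) - s ^+ 2) =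
  (G - 1 - l ^+ 2 * s ^+ 2 / 2) - (G - 1 - l * gaussE s id -
     l ^+ 2 / 2 * gaussE s (fun y => y ^+ 2)) by field.
apply: (le_trans (ler_normB _ _)); apply: (le_trans (lerD h2 h1)).
by rewrite le_eqVlt; apply/orP; left; apply/eqP; ring.
Qed.

(** Taking [l = t] and [l = - t] cancels the quadratic term, which leaves [t |m| <= C t^3], and one
    factor [t] is at most [s^-1]. *)
Lemma gaussE_id s : 0 < s -> gaussE s id = 0.
Proof.
move=> s0; set C := (12 * expR 2 + expR 1 + 1) * s ^+ 3.
apply: (@eq0_ler_linear _ (C * s^-1) s^-1); first by rewrite invr_gt0.
move=> t /andP[t0 ts].
have tn : `|t| <= s^-1 by rewrite gtr0_norm.
have tn' : `|- t| <= s^-1 by rewrite normrN.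
have := gaussE_mgf_taylor s0 tn; have := gaussE_mgf_taylor s0 tn'.
rewrite normrN sqrrN -/C (gtr0_norm t0).
set m := gaussE s id; set w := _ / 2 * _ => h1 h2.
have C0 : 0 <= C.
  by rewrite mulr_ge0 ?exprn_ge0 ?(ltW s0) // !addr_ge0 ?mulr_ge0 ?expR_ge0.
have h3 : t * `|m| <= C * t ^+ 3.
  have -> : t * `|m| = `|t * m| by rewrite normrM (gtr0_norm t0).
  move: h1 h2; rewrite !ler_norml => /andP[? ?] /andP[? ?].
  by apply/andP; split; lra.
rewrite -(ler_pM2l t0) (le_trans h3) //.
have -> : t * (C * s^-1 * t) = C * (t * t * s^-1) by ring.
have -> : t ^+ 3 = t * t * t by ring.
by rewrite ler_wpM2l // ler_wpM2l // mulr_ge0 // ltW.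
Qed.

Lemma gaussE_sqr s : 0 < s -> gaussE s (fun y => y ^+ 2) = s ^+ 2.
Proof.
move=> s0; apply/eqP; rewrite -subr_eq0; apply/eqP.
set C := (12 * expR 2 + expR 1 + 1) * s ^+ 3.
apply: (@eq0_ler_linear _ (2 * C) s^-1); first by rewrite invr_gt0.
move=> t /andP[t0 ts].
have tn : `|t| <= s^-1 by rewrite gtr0_norm.
have := gaussE_mgf_taylor s0 tn.
rewrite gaussE_id // mulr0 add0r -/C (gtr0_norm t0) normrM.
have t2 : 0 < t ^+ 2 / 2 by rewrite divr_gt0 ?exprn_gt0.
rewrite (gtr0_norm t2) => h; rewrite -(ler_pM2l t2) (le_trans h) //.
rewrite exprS; lra.
Qed.

(** By AM-GM, [|y| <= s / 2 + y^2 / (2 s)], and the right-hand side has expectation [s]. *)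
Lemma gaussE_norm_le s : 0 < s ->
  gauss_int s (fun y => `|y|) /\ gaussE s (fun y => `|y|) <= s.
Proof.
move=> s0.
have i1 : gauss_int s (fun y => `|y|).
  apply: gauss_int_dom (gauss_int_norm3D s0); first exact: normr_measurable.
  move=> y; rewrite normr_id; exact: ler_norm_1D3.
split=> //; have i2 := gauss_intZ (s^-1 / 2) (gauss_int_sqr s0).
have ic := gauss_int_cst s (s / 2).
have e : gaussE s (fun y => s / 2 + s^-1 / 2 * y ^+ 2) = s.
  rewrite gaussED // (gaussEZ _ (gauss_int_sqr s0)) gaussE_sqr // gaussE_cst.
  by field; rewrite gt_eqF.
rewrite -[leRHS]e; apply: le_gaussE => //; first exact: gauss_intD.
move=> y; rewrite -(real_normK (num_real y)) -(ler_pM2l s0) mulrDr.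
have -> : s * (s^-1 / 2 * `|y| ^+ 2) = `|y| ^+ 2 / 2 by field; rewrite gt_eqF.
have := sqr_ge0 (`|y| - s); nra.
Qed.

Lemma gaussE_taylor s h c a b C : 0 < s -> gauss_int s h ->
  (forall y, `|h y - c - a * y - b / 2 * y ^+ 2| <= C * `|y| ^+ 3) ->
  `|gaussE s h - c - b / 2 * s ^+ 2| <= C * (12 * expR 2 * s ^+ 3).
Proof.
move=> s0 ih hC.
have C0 : 0 <= C.
  by have := le_trans (normr_ge0 _) (hC 1); rewrite normr1 expr1n mulr1.
have ic := gauss_int_cst s c.
have i1 := gauss_intZ a (gauss_int_id s0).
have i2 := gauss_intZ (b / 2) (gauss_int_sqr s0).
have j1 := gauss_intD ih (gauss_intN ic).
have j2 := gauss_intD j1 (gauss_intN i1).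
have j3 := gauss_intD j2 (gauss_intN i2).
have i3 := gauss_intZ C (gauss_int_norm3 s0).
have -> : gaussE s h - c - b / 2 * s ^+ 2 =
  gaussE s (fun y => h y - c - a * y - b / 2 * y ^+ 2).
  rewrite !gaussEB // gaussE_cst (gaussEZ _ (gauss_int_sqr s0)) gaussE_sqr //.
  by rewrite (gaussEZ _ (gauss_int_id s0)) gaussE_id // mulr0 subr0.
apply: (le_trans (ler_norm_gaussE j3 i3 hC)).
rewrite gaussEZ; last exact: gauss_int_norm3.
by rewrite ler_wpM2l // gaussE_norm3.
Qed.

End GaussianMoments.

(** * The quicksort recursion *)

Section Renewal.
Context {R : realType}.
Implicit Types a b : nat -> R.

Definition renewal_sum b n : R :=
  \sum_(k < n) 2 * b k / (k.+1%:R * k.+2%:R).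

Definition renewal_lim b : R := limn (renewal_sum b).

Lemma renewal_sumS b n : renewal_sum b n.+1 =
  renewal_sum b n + 2 * b n / (n.+1%:R * n.+2%:R).
Proof. by rewrite /renewal_sum big_ord_recr. Qed.

Lemma renewal_sum_dist b M n m : (forall k, (n <= k)%N -> `|b k| <= M) ->
  (n <= m)%N ->
  `|renewal_sum b m - renewal_sum b n| <= 2 * M / n.+1%:R - 2 * M / m.+1%:R.
Proof.
move=> bM; elim: m => [|m IH].
  by rewrite leqn0 => /eqP ->; rewrite !subrr normr0.
rewrite leq_eqVlt => /predU1P[->|]; first by rewrite !subrr normr0.
rewrite ltnS => nm; have := IH nm; have := bM _ nm.
rewrite renewal_sumS addrAC => bm h; apply: (le_trans (ler_normD _ _)).
have q0 : (0 : R) < m.+1%:R * m.+2%:R by rewrite mulr_gt0.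
apply: le_trans (_ : (2 * M / n.+1%:R - 2 * M / m.+1%:R) +
    2 * M / (m.+1%:R * m.+2%:R) <= _).
  apply: lerD => //; rewrite normrM normfV (gtr0_norm q0).
  by rewrite ler_pM2r ?invr_gt0 // normrM ger0_norm // ler_pM2l.
rewrite le_eqVlt; apply/orP; left; apply/eqP.
have e2 : m.+2%:R = m.+1%:R + 1 :> R by rewrite natr1.
have : m.+2%:R != 0 :> R by rewrite pnatr_eq0.
rewrite e2 => m2; field.
by rewrite !nat1r natr1 !pnatr_eq0.
Qed.

Lemma cvg_renewal_sum b M : (forall k, `|b k| <= M) ->
  renewal_sum b n @[n --> \oo] --> renewal_lim b.
Proof.
move=> bM; apply/cvg_ex => /=.
have M0 : 0 <= M by apply: le_trans (bM 0%N).
have h1 : harmonic n @[n --> \oo] --> (0 : R) by exact: cvg_harmonic.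
(* The terms of the series have no sign. By [renewal_sum_dist] this correction, which tends to 0,
   makes the partial sums nondecreasing. *)
pose e n := renewal_sum b n - 2 * M * harmonic n.
have d n m : (n <= m)%N -> `|renewal_sum b m - renewal_sum b n| <=
    2 * M * harmonic n - 2 * M * harmonic m.
  by move=> nm; have := @renewal_sum_dist b M n m (fun k _ => bM k) nm.
have ce : cvgn e.
  apply: nondecreasing_is_cvgn.
    move=> n m /d; rewrite /e ler_norml => /andP[+ _]; lra.
  exists (2 * M) => _ [n _ <-]; have := d 0%N n (leq0n _).
  have hn : 0 <= M * harmonic n by rewrite mulr_ge0 // harmonic_ge0.
  rewrite /e [renewal_sum b 0]big_ord0 [harmonic 0]invr1 mulr1 ler_norml.
  by move=> /andP[_]; lra.
exists (limn e + 2 * M * 0).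
rewrite (_ : renewal_sum b = fun n => e n + 2 * M * harmonic n); last first.
  by apply/funext => n; rewrite /e subrK.
by apply: cvgD => //; apply: cvgMr.
Qed.

Lemma renewal_lim_dist b M n M' : (forall k, `|b k| <= M') ->
  (forall k, (n <= k)%N -> `|b k| <= M) ->
  `|renewal_sum b n - renewal_lim b| <= 2 * M / n.+1%:R.
Proof.
move=> bM' bM; rewrite distrC.
have M0 : 0 <= M by apply: le_trans (bM n (leqnn _)).
have c := cvg_renewal_sum bM'.
have c' : `|renewal_sum b m - renewal_sum b n| @[m --> \oo] -->
    `|renewal_lim b - renewal_sum b n|.
  by apply: cvg_norm; apply: cvgB => //; exact: cvg_cst.
rewrite -(cvg_lim _ c') //; apply: limr_le; first by apply/cvg_ex; eexists; exact: c'.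
near=> m; have nm : (n <= m)%N by near: m; exact: nbhs_infty_ge.
apply: (le_trans (renewal_sum_dist bM nm)).
by rewrite lerBlDr lerDl divr_ge0 // mulr_ge0.
Unshelve. all: end_near. Qed.

(** For [S_n] the sum of the first [n] terms, [S_n / (n (n + 1))] has increment
    [b_n / ((n + 1) (n + 2))]. The induction carries this sum along, multiplied out so that [n = 0]
    causes no division. *)
Lemma renewal_eq a b : a 0%N = b 0%N ->
  (forall n, a n.+1 = 2 / n.+1%:R * (\sum_(k < n.+1) a k) + b n.+1) ->
  forall n, a n = b n + n.+1%:R * renewal_sum b n.
Proof.
move=> a0 aS.
have S n : 2 * \sum_(k < n) a k = n%:R * n.+1%:R * renewal_sum b n /\
    a n = b n + n.+1%:R * renewal_sum b n.
  elim: n => [|n [IH1 IH2]].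
    by rewrite !big_ord0 mulr0 !mul0r a0 /renewal_sum big_ord0 mulr0 addr0.
  have e : 2 * \sum_(k < n.+1) a k = n.+1%:R * n.+2%:R * renewal_sum b n.+1.
    rewrite big_ord_recr mulrDr /= IH1 IH2 renewal_sumS.
    have e1 : n.+1%:R = n%:R + 1 :> R by rewrite natr1.
    have e2 : n.+2%:R = n%:R + 2 :> R by rewrite -natrD addn2.
    have : n.+1%:R != 0 :> R by rewrite pnatr_eq0.
    have : n.+2%:R != 0 :> R by rewrite pnatr_eq0.
    by rewrite e1 e2 => m1 m2; field; rewrite m1 m2.
  split=> //; rewrite aS mulrAC e addrC; congr (_ + _).
  by rewrite -[n.+1%:R * _ * _]mulrA mulrAC divff ?mul1r // pnatr_eq0.
by move=> n; case: (S n).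
Qed.

(** [b n] contributes [M], and the tail of the series, at most [2 M / (n + 1)], contributes [2 M].
    Since [M] bounds only the tolls from [n] on, decaying tolls give a decaying error. *)
Lemma renewal_bound a b M M' n : a 0%N = b 0%N ->
  (forall n, a n.+1 = 2 / n.+1%:R * (\sum_(k < n.+1) a k) + b n.+1) ->
  (forall k, `|b k| <= M') ->
  (forall k, (n <= k)%N -> `|b k| <= M) ->
  `|a n - n.+1%:R * renewal_lim b| <= 3 * M.
Proof.
move=> a0 aS bM' bM; rewrite (renewal_eq a0 aS) -addrA -mulrBr.
apply: (le_trans (ler_normD _ _)); rewrite normrM ger0_norm //.
have := renewal_lim_dist bM' bM.
rewrite ler_pdivlMr ?ltr0n // mulrC; have := bM n (leqnn _); lra.
Qed.

End Renewal.

(** * Decay of the tolls *)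

Section GeometricDecay.
Context {R : realType}.

Lemma geom_half_double n : (2^-1 : R) ^+ n = 2 * 2^-1 ^+ n.+1.
Proof. by rewrite exprS mulrA mulfV ?mul1r. Qed.

Lemma geom_half_gt0 n : 0 < (2^-1 : R) ^+ n.
Proof. by rewrite exprn_gt0 ?invr_gt0. Qed.

Lemma geom_half_le m n : (m <= n)%N -> (2^-1 : R) ^+ n <= 2^-1 ^+ m.
Proof. by move=> mn; rewrite ler_wiXn2l ?invr_ge0 // invf_le1 // ler1n. Qed.

Lemma geom_half_linear n : n.+1%:R * (2^-1 : R) ^+ n <= 1.
Proof.
elim: n => [|n IH]; first by rewrite expr0 mulr1.
have g0 := geom_half_gt0 n; move: IH; rewrite geom_half_double in g0 *.
have n0 : 0 <= n%:R :> R by rewrite ler0n.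
rewrite -[n.+2%:R]natr1 -natr1 in n0 *; move: g0; set g := _ ^+ n.+1 => g0; nra.
Qed.

Lemma geom_half_quad n : n.+1%:R ^+ 2 * (2^-1 : R) ^+ n <= 4.
Proof.
case: n => [|n]; first by rewrite expr0 mulr1 expr1n ler1n.
case: n => [|n]; first by rewrite expr1; lra.
elim: n => [|n IH]; first by rewrite expr2; lra.
apply: le_trans IH; rewrite (geom_half_double n.+2).
have -> : n.+4%:R = n%:R + 4 :> R by rewrite -natrD addn4.
have -> : n.+3%:R = n%:R + 3 :> R by rewrite -natrD addn3.
have n0 : 0 <= n%:R :> R by rewrite ler0n.
by rewrite [leRHS]mulrA ler_pM2r ?geom_half_gt0 //; nra.
Qed.

End GeometricDecay.

Section CompressProbability.
Context {R : realType}.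
Implicit Types t : btree.

Lemma bstE_bool_bounds n (p : pred btree) :
  0 <= @bstE R n (fun T => (p T)%:R) <= 1.
Proof.
rewrite bstE_ge0 ?bstE_le_cst // => T _; by case: (p T); rewrite ?ler0n ?lexx.
Qed.

Lemma bstE_prod n (f g : btree -> R) k :
  bstE k (fun l => bstE n (fun r => f l * g r)) = bstE k f * bstE n g.
Proof. by under eq_bstE => l _ do rewrite bstEZ; rewrite bstEZr. Qed.

Lemma sum_bstE_rev n (f : btree -> R) :
  \sum_(k < n.+1) bstE (n - k)%N f = \sum_(k < n.+1) bstE k f.
Proof.
by rewrite [RHS](reindex_inj rev_ord_inj); apply: eq_bigr => k _; rewrite /= subSS.
Qed.

Lemma bstE_empty n : bstE n (fun T => (T == EmptyTree)%:R) = (n == 0)%N%:R :> R.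
Proof.
rewrite -(bstE_cst n ((n == 0)%N%:R)); apply: eq_bstE => T <-.
by rewrite bsize_eq0.
Qed.

Lemma compress_node_eq_le t t' l r :
  (compress (BNode l r) == BNode t t')%:R <=
  (compress l == t)%:R * (compress r == t')%:R +
  ((l == EmptyTree)%:R * (compress r == BNode t t')%:R +
   (compress l == BNode t t')%:R * (r == EmptyTree)%:R) :> R.
Proof.
rewrite compress_node.
have b (c e : bool) : 0 <= c%:R * e%:R :> R by rewrite mulr_ge0 // ler0n.
case: ifP => br.
  by rewrite btree_eqE -natrM mulnb lerDl addr_ge0.
case: (eqVneq l EmptyTree) => [l0|l0].
  by rewrite mul1r addrCA lerDl addr_ge0.
have -> : r == EmptyTree.
  by move: br; rewrite /branching (negbTE l0); case: (r == EmptyTree).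
by rewrite mul0r add0r mulr1 lerDr.
Qed.

(** If the root survives, the bounds for the two subtrees multiply to [C C' 2^-n], as their sizes
    add up to [n]. If it is deleted, one subtree is empty, which has probability at most
    [2 / (n + 1)] and leaves the same event for the other one. *)
Lemma compress_prob_decay t : exists2 C : R, 0 <= C &
  forall n, bstE n (fun T => (compress T == t)%:R) <= C * 2^-1 ^+ n.
Proof.
elim: t => [|t [C C0 IHt] t' [C' C'0 IHt']].
  exists 1 => // n; under eq_bstE => T _ do rewrite compress_eq0.
  rewrite bstE_empty mul1r; case: n => [|n] /=; first by rewrite expr0.
  exact: ltW (geom_half_gt0 _).
have CC0 : 0 <= C * C' by rewrite mulr_ge0.
exists (4 * (C * C') + 2 ^+ 8); first by rewrite addr_ge0 ?mulr_ge0 ?exprn_ge0.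
elim=> [|n IH].
  rewrite expr0 mulr1; have /andP[_ /le_trans] := bstE_bool_bounds 0 (fun T => compress T == BNode t t').
  by apply; nra.
set q := bstE n _ in IH.
set A := 4 * (C * C') + 2 ^+ 8 in IH *.
have A0 : 2 ^+ 8 <= A by rewrite /A; lra.
have rec : bstE n.+1 (fun T => (compress T == BNode t t')%:R) <=
    C * C' * 2^-1 ^+ n + 2 / n.+1%:R * q.
  rewrite bstES.
  apply: le_trans (_ : n.+1%:R^-1 * \sum_(k < n.+1)
    (C * C' * 2^-1 ^+ n + ((k == 0 :> nat)%:R * q + (n - k == 0)%N%:R * q)) <= _).
    rewrite ler_pM2l ?invr_gt0 ?ltr0n //; apply: ler_sum => k _.
    have kn : (k <= n)%N by rewrite -ltnS.
    apply: le_trans (_ : bstE k (fun l => bstE (n - k)%N (fun r =>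
        (compress l == t)%:R * (compress r == t')%:R +
        ((l == EmptyTree)%:R * (compress r == BNode t t')%:R +
        (compress l == BNode t t')%:R * (r == EmptyTree)%:R))) <= _).
      by apply: le_bstE => l _; apply: le_bstE => r _; exact: compress_node_eq_le.
    under eq_bstE => l _ do rewrite !bstED.
    rewrite !bstED !bstE_prod !bstE_empty; apply: lerD; last apply: lerD.
    - have := ler_pM _ _ (IHt k) (IHt' (n - k)%N).
      have /andP[-> _] := bstE_bool_bounds k (fun T => compress T == t).
      have /andP[-> _] := bstE_bool_bounds (n - k)%N (fun T => compress T == t').
      by rewrite mulrACA -exprD subnKC //; apply.
    - by case: eqP => [->|_]; rewrite ?mul0r // subn0.
    - rewrite mulrC; case: eqP => [e|_]; rewrite ?mul0r // !mul1r.
      by rewrite /q (_ : k = n :> nat) //; apply/eqP; rewrite eqn_leq kn -subn_eq0 e.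
  rewrite !big_split /= sumr_const card_ord -!mulr_suml.
  have -> : \sum_(k < n.+1) ((k == 0 :> nat)%:R : R) = 1.
    by rewrite big_ord_recl big1 ?addr0.
  have -> : \sum_(k < n.+1) ((n - k == 0)%N%:R : R) = 1.
    rewrite (reindex_inj rev_ord_inj) big_ord_recl big1 /= ?addr0 ?subSS ?subn0 ?subnn //.
    by move=> i _; rewrite subSS subKn.
  rewrite -(mulr_natl (C * C' * _)) mulrDr mulKf ?pnatr_eq0 // le_eqVlt; apply/orP; left.
  by apply/eqP; ring.
have g0 := @geom_half_gt0 R n.+1.
(* Up to size 8 the term [2 ^+ 8] makes the bound trivial. Beyond, [2 / (n + 1) <= 1 / 4] is half
   the ratio 1/2, so this part takes one half of the new bound; [4 C C'] provides the other half. *)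
case: (ltnP n 7) => n7.
  have /andP[_ /le_trans] := bstE_bool_bounds n.+1 (fun T => compress T == BNode t t').
  apply; apply: le_trans (_ : 2 ^+ 8 * 2^-1 ^+ 8 <= _).
    by rewrite -exprMn mulfV ?expr1n.
  by rewrite ler_pM ?exprn_ge0 // geom_half_le // ltnW.
apply: (le_trans rec).
have n8 : 8 <= n.+1%:R :> R by rewrite ler_nat.
have q0 : 0 <= q.
  by have /andP[] := bstE_bool_bounds n (fun T => compress T == BNode t t').
have : 2 / n.+1%:R * q <= 4^-1 * q.
  rewrite ler_wpM2r // ler_pdivrMr; lra.
rewrite geom_half_double in IH *; move: g0 IH; set g := 2^-1 ^+ n.+1 => g0 IH.
have : C * C' * (2 * g) <= A / 2 * g.
  rewrite mulrA ler_pM2r // /A; have : (0 : R) <= 2 ^+ 8 by rewrite exprn_ge0.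
  lra.
move=> h1 h2; apply: (le_trans (lerD h1 h2)); clear rec h1 h2 A0; clearbody A q g; lra.
Qed.

Lemma toll_prob_decay t : exists2 C : R, 0 <= C &
  forall n, bstE n (fun T => (toll t T)%:R) <= C * 2^-1 ^+ n.
Proof.
have [C C0 h] := compress_prob_decay t; exists C => // n.
apply: le_trans (h n); apply: le_bstE => T _.
by rewrite /toll ler_nat; case: (branching T).
Qed.

End CompressProbability.

(** * Mean and variance *)

Section Moments.
Context {R : realType}.
Implicit Types t : btree.

Lemma bstES_additive (f g : btree -> R) n :
  (forall l r, f (BNode l r) = f l + f r + g (BNode l r)) ->
  bstE n.+1 f = 2 / n.+1%:R * (\sum_(k < n.+1) bstE k f) + bstE n.+1 g.
Proof.
move=> fg.
have -> : bstE n.+1 f = bstE n.+1 (fun T => f T - g T) + bstE n.+1 g.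
  by rewrite -bstED; apply: eq_bstE => T _; rewrite subrK.
congr (_ + _); rewrite bstES -[RHS]mulrA [RHS]mulrCA; congr (_ * _).
transitivity (\sum_(k < n.+1) (bstE k f + bstE (n - k)%N f)).
  apply: eq_bigr => k _; transitivity (bstE k (fun l =>
      bstE (n - k)%N (fun r => f l + f r))).
    by apply: eq_bstE => l _; apply: eq_bstE => r _; rewrite fg addrK.
  by under eq_bstE => l _ do rewrite bstED bstE_cst; rewrite bstED bstE_cst.
by rewrite big_split /= sum_bstE_rev -mulr2n mulr_natl.
Qed.

Definition toll_prob t n : R := bstE n (fun T => (toll t T)%:R).

(** [2 / ((k + 1) (k + 2))] is the limiting proportion of nodes of the search tree whose fringe tree
    has [k] nodes, and [toll_prob t k] is the probability that such a node becomes the root of a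
    copy of [t]. *)
Definition fringe_rate t : R := renewal_lim (toll_prob t).

Definition fringe_nb t T : R := (fringe_count t (compress T))%:R.

(* Centring by [(bsize T).+1] rather than [bsize T] makes this functional
   exactly additive over the two subtrees of the root, up to the toll. *)
Definition fringe_dev t T : R := fringe_nb t T - (bsize T).+1%:R * fringe_rate t.

Lemma toll_prob_bounds t n : 0 <= toll_prob t n <= 1.
Proof. exact: bstE_bool_bounds. Qed.

Lemma norm_toll_prob t n : `|toll_prob t n| <= 1.
Proof. by have /andP[p0 p1] := toll_prob_bounds t n; rewrite ger0_norm. Qed.

Lemma toll_prob0 t : toll_prob t 0 = 0.
Proof. by rewrite /toll_prob bstE0. Qed.

Lemma toll_prob2 t : toll_prob t 2 = 0.
Proof.
rewrite -(bstE_cst 2 0); apply: eq_bstE => -[|l r] //=; rewrite bsize_node => -[e].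
rewrite /toll /branching -!bsize_eq0.
by case: (bsize l) (bsize r) e => [|[|?]] [|[|?]].
Qed.

Lemma cvg_toll_sum t :
  renewal_sum (toll_prob t) n @[n --> \oo] --> fringe_rate t.
Proof. exact: cvg_renewal_sum (norm_toll_prob t). Qed.

Lemma fringe_rate_ge t n : renewal_sum (toll_prob t) n <= fringe_rate t.
Proof.
apply: (@nondecreasing_cvgn_le _ (renewal_sum (toll_prob t))).
  apply/nondecreasing_seqP => k; rewrite renewal_sumS lerDl divr_ge0 ?mulr_ge0 //.
  by have /andP[] := toll_prob_bounds t k.
by apply/cvg_ex; exists (fringe_rate t); exact: cvg_toll_sum.
Qed.

(** The tolls at sizes 0 and 2 vanish, size 1 contributes at most 1/3, and the tail from 3 on at
    most 1/2. *)
Lemma fringe_rate_lt1 t : fringe_rate t < 1.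
Proof.
have := @renewal_lim_dist R (toll_prob t) 1 3 1 (norm_toll_prob t)
  (fun k _ => norm_toll_prob t k).
rewrite /renewal_sum !big_ord_recr big_ord0 /= toll_prob0 toll_prob2.
have /andP[] := toll_prob_bounds t 1.
by rewrite -/(fringe_rate t) ler_norml => p0 p1 /andP[]; lra.
Qed.

Lemma fringe_rate_gt0 t : full t -> 0 < fringe_rate t.
Proof.
move=> ft; apply: lt_le_trans (fringe_rate_ge t (bsize t).+1).
have p0 : 0 < toll_prob t (bsize t).
  rewrite /toll_prob /bstE (bigD1_seq t) ?trees_uniq ?mem_trees //=.
  rewrite ltr_pwDl //.
    by rewrite /toll full_branching // compress_full // eqxx mulr1 bst_weight_gt0.
  by apply: sumr_ge0 => T _; rewrite mulr_ge0 // ltW // bst_weight_gt0.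
rewrite renewal_sumS ltr_wpDl //; last by rewrite divr_gt0 ?mulr_gt0.
apply: sumr_ge0 => k _; rewrite divr_ge0 ?mulr_ge0 //.
by have /andP[] := toll_prob_bounds t k.
Qed.

Section FixedTree.
Variable t : btree.
Hypothesis t0 : t != EmptyTree.
Notation beta := (fringe_rate t).
Notation Y := (fringe_dev t).

Let beta0 : 0 <= beta.
Proof.
by have := fringe_rate_ge t 0; rewrite /renewal_sum big_ord0.
Qed.

Let beta1 : beta <= 1. Proof. exact: ltW (fringe_rate_lt1 t). Qed.

Lemma fringe_nb_node l r : fringe_nb t (BNode l r) =
  fringe_nb t l + fringe_nb t r + (toll t (BNode l r))%:R.
Proof. by rewrite /fringe_nb fringe_count_compress_node // !natrD. Qed.

Lemma fringe_dev_node l r : Y (BNode l r) = Y l + Y r + (toll t (BNode l r))%:R.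
Proof.
rewrite /fringe_dev fringe_nb_node bsize_node -addSn -addnS natrD; ring.
Qed.

Lemma fringe_dev_toll T : toll t T -> Y T = 1 - (bsize T).+1%:R * beta.
Proof. by move=> tT; rewrite /fringe_dev /fringe_nb toll_fringe_count. Qed.

Lemma norm_fringe_dev T : `|Y T| <= (bsize T).+1%:R.
Proof.
have n0 : 0 <= fringe_nb t T by [].
have n1 : fringe_nb t T <= (bsize T)%:R by rewrite ler_nat fringe_count_compress_le.
have s0 : 0 <= (bsize T)%:R :> R by [].
have s1 : 0 <= (bsize T).+1%:R * beta by rewrite mulr_ge0.
have s2 : 0 <= (bsize T).+1%:R * (1 - beta) by rewrite mulr_ge0 // subr_ge0.
have s3 : (bsize T).+1%:R = (bsize T)%:R + 1 :> R by rewrite natr1.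
rewrite /fringe_dev ler_norml; apply/andP; split; lra.
Qed.

Definition dev_mean n : R := bstE n Y.

Lemma dev_mean_rec n : bstE n.+1 (fringe_nb t) =
  2 / n.+1%:R * (\sum_(k < n.+1) bstE k (fringe_nb t)) + toll_prob t n.+1.
Proof. exact: bstES_additive fringe_nb_node. Qed.

Lemma dev_meanE n : dev_mean n = bstE n (fringe_nb t) - n.+1%:R * beta.
Proof.
rewrite -(bstE_cst n (n.+1%:R * beta)) -bstEB.
by apply: eq_bstE => T <-.
Qed.

Lemma dev_mean_decay : exists2 C : R, 0 <= C &
  forall n, `|dev_mean n| <= C * 2^-1 ^+ n.
Proof.
have [C C0 pC] := @toll_prob_decay R t; exists (3 * C); first by rewrite mulr_ge0.
move=> n; rewrite dev_meanE -mulrA.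
apply: (@renewal_bound R (fun k => bstE k (fringe_nb t)) _ _ 1).
- by rewrite toll_prob0 bstE0 /fringe_nb /fringe_count.
- exact: dev_mean_rec.
- exact: norm_toll_prob.
move=> k nk; have /andP[p0 _] := toll_prob_bounds t k; rewrite ger0_norm //.
by rewrite (le_trans (pC k)) // ler_wpM2l // geom_half_le.
Qed.

Definition dev_sqr n : R := bstE n (fun T => Y T ^+ 2).

(** Whatever makes the second moments satisfy the quicksort recursion. At [n = 0] the sum is empty
    and the value is [dev_sqr 0], that is [beta ^+ 2]. *)
Definition sqr_toll n : R := dev_sqr n - 2 / n%:R * \sum_(k < n) dev_sqr k.

(** Independence factors the cross term into means. On the toll event [Y = 1 - (n + 2) beta] is
    known exactly, so removing the toll changes the square by [2 Y - 1]. *)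
Lemma sqr_tollS n : sqr_toll n.+1 =
  2 / n.+1%:R * (\sum_(k < n.+1) dev_mean k * dev_mean (n - k)%N) +
  toll_prob t n.+1 * (1 - 2 * (n.+2%:R * beta)).
Proof.
rewrite /sqr_toll.
have -> : dev_sqr n.+1 =
    bstE n.+1 (fun T => (Y T - (toll t T)%:R) ^+ 2) +
    toll_prob t n.+1 * (1 - 2 * (n.+2%:R * beta)).
  rewrite -bstEZr -bstED; apply: eq_bstE => T sT.
  by case: (boolP (toll t T)) => [/fringe_dev_toll -> | _]; rewrite ?sT /=; ring.
rewrite addrAC; congr (_ + _); apply/eqP; rewrite subr_eq; apply/eqP.
rewrite bstES.
transitivity (n.+1%:R^-1 * \sum_(k < n.+1)
   (dev_sqr k + dev_sqr (n - k)%N + 2 * (dev_mean k * dev_mean (n - k)%N))).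
  congr (_ * _); apply: eq_bigr => k _.
  transitivity (bstE k (fun l => bstE (n - k)%N (fun r =>
      Y l ^+ 2 + Y r ^+ 2 + 2 * (Y l * Y r)))).
    apply: eq_bstE => l _; apply: eq_bstE => r _.
    by rewrite fringe_dev_node addrK; ring.
  under eq_bstE => l _ do rewrite !bstED bstE_cst bstEZ.
  by rewrite !bstED bstE_cst bstEZ bstE_prod.
rewrite !big_split /= sum_bstE_rev -mulr_sumr; ring.
Qed.

Lemma sqr_toll_decay : exists2 C : R, 0 <= C &
  forall n, `|sqr_toll n| <= C / n.+1%:R.
Proof.
have [C C0 pC] := @toll_prob_decay R t.
have [C' C'0 mC] := dev_mean_decay.
exists (Num.max (beta ^+ 2) (16 * C' ^+ 2 + 16 * C)).
  by rewrite le_max sqr_ge0.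
case=> [|n].
  rewrite /sqr_toll big_ord0 mulr0 subr0 /dev_sqr bstE0 /fringe_dev /fringe_nb /=.
  rewrite !mul1r sub0r sqrrN divr1 ger0_norm ?sqr_ge0 //.
  by rewrite le_max lexx.
rewrite ler_pdivlMr ?ltr0n // le_max; apply/orP; right; rewrite sqr_tollS.
have g0 := @geom_half_gt0 R n.+1; have gq := @geom_half_quad R n.+1.
have gl := @geom_half_linear R n.+1.
have hm : `|2 / n.+1%:R * (\sum_(k < n.+1) dev_mean k * dev_mean (n - k)%N)| <=
   4 * C' ^+ 2 * 2^-1 ^+ n.+1.
  rewrite normrM ger0_norm ?divr_ge0 // -ler_pdivlMl ?divr_gt0 //.
  apply: (le_trans (ler_norm_sum _ _ _)).
  apply: le_trans (_ : \sum_(k < n.+1) C' ^+ 2 * 2^-1 ^+ n <= _).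
    apply: ler_sum => k _; rewrite normrM.
    have := ler_pM (normr_ge0 _) (normr_ge0 _) (mC k) (mC (n - k)%N).
    by rewrite mulrACA -expr2 -exprD subnKC // -ltnS.
  rewrite sumr_const card_ord geom_half_double -mulr_natl invf_div.
  by rewrite le_eqVlt; apply/orP; left; apply/eqP; field.
have hp : `|toll_prob t n.+1 * (1 - 2 * (n.+2%:R * beta))| <=
    C * 2^-1 ^+ n.+1 * (2 * n.+2%:R).
  rewrite normrM; have /andP[p0 _] := toll_prob_bounds t n.+1.
  rewrite ger0_norm // ler_pM //; first exact: pC.
  have n2 : (2 : R) <= n.+2%:R by rewrite ler_nat.
  have : n.+2%:R * beta <= n.+2%:R by rewrite ler_piMr.
  have : 0 <= n.+2%:R * beta by rewrite mulr_ge0.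
  rewrite ler_norml => ? ?; apply/andP; split; lra.
have n0 : 0 <= n.+2%:R :> R by [].
have C2 : 0 <= C' ^+ 2 by rewrite sqr_ge0.
apply: le_trans (_ : (4 * C' ^+ 2 * 2^-1 ^+ n.+1 +
    C * 2^-1 ^+ n.+1 * (2 * n.+2%:R)) * n.+2%:R <= _).
  by rewrite ler_wpM2r // (le_trans (ler_normD _ _)) // lerD.
have -> : (4 * C' ^+ 2 * 2^-1 ^+ n.+1 + C * 2^-1 ^+ n.+1 * (2 * n.+2%:R)) * n.+2%:R =
  4 * C' ^+ 2 * (n.+2%:R * 2^-1 ^+ n.+1) + 2 * C * (n.+2%:R ^+ 2 * 2^-1 ^+ n.+1) by ring.
apply: lerD.
  by rewrite (le_trans (ler_wpM2l _ gl)) ?mulr_ge0 // mulr1 ler_wpM2r // ler_nat.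
by rewrite (le_trans (ler_wpM2l _ gq)) ?mulr_ge0 //; lra.
Qed.

Definition fringe_var : R := renewal_lim sqr_toll.

(** An error that tends to 0, and is not merely bounded, is what forces [dev_sqr] to become small in
    the proof that the variance is positive. *)
Lemma dev_sqr_asymp : exists2 C : R, 0 <= C &
  forall n, `|dev_sqr n - n.+1%:R * fringe_var| <= C / n.+1%:R.
Proof.
have [C C0 bC] := sqr_toll_decay; exists (3 * C); first by rewrite mulr_ge0.
move=> n; rewrite -mulrA.
apply: (@renewal_bound _ _ sqr_toll _ C).
- by rewrite /sqr_toll big_ord0 mulr0 subr0.
- by move=> k; rewrite /sqr_toll addrC subrK.
- by move=> k; rewrite (le_trans (bC k)) // ler_pdivrMr ?ltr0n // ler_peMr // ler1n.
- move=> k nk; rewrite (le_trans (bC k)) // ler_wpM2l // lef_pV2 ?posrE ?ltr0n //.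
  by rewrite ler_nat.
Qed.

Lemma exists_small_dev n e : dev_sqr n < e ^+ 2 -> 0 < e ->
  exists2 T, bsize T = n & `|Y T| < e.
Proof.
move=> de e0; apply: contrapT => h; move: de; apply/negP; rewrite -leNgt.
rewrite -(bstE_cst n (e ^+ 2)); apply: le_bstE => T sT.
rewrite -(real_normK (num_real (Y T))) lerXn2r ?nnegrE ?(ltW e0) //.
by rewrite leNgt; apply/negP => YT; apply: h; exists T.
Qed.

End FixedTree.
End Moments.

(** * Positivity of the variance and higher moments *)

Section HigherMoments.
Context {R : realType}.
Variable t : btree.
Hypothesis ft : full t.
Let t0 : t != EmptyTree := full_neq0 ft.
Notation beta := (fringe_rate t : R).
Notation Y := (fringe_dev t : btree -> R).

(* If the variance were sublinear it would tend to 0, and the values of [Y],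
   which lie in [Z - (n + 1) beta], would force [beta] to be an integer. *)
Lemma fringe_var_gt0 : 0 < fringe_var t :> R.
Proof.
rewrite ltNge; apply/negP => v0.
have [C C0 hC] := @dev_sqr_asymp R t t0.
have b0 : 0 < beta by exact: fringe_rate_gt0.
have b1 : beta < 1 by exact: fringe_rate_lt1.
(* Trees of sizes [N] and [N + 1] with [|Y| < e] have counts whose difference is an integer within
   [2 e] of [beta], hence strictly between 0 and 1. *)
pose e := Num.min beta (1 - beta) / 2.
have e0 : 0 < e by rewrite divr_gt0 // lt_min b0 subr_gt0.
have eb : 2 * e <= beta by rewrite mulrC divfK // ge_min lexx.
have eb1 : 2 * e <= 1 - beta by rewrite mulrC divfK // ge_min lexx orbT.
clearbody e.
have [N hN] : exists N, C / e ^+ 2 < N%:R.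
  by exists (Num.truncn (C / e ^+ 2)).+1; exact: Num.Theory.truncnS_gt.
have small n : (N <= n)%N -> dev_sqr t n < e ^+ 2.
  move=> Nn; have := hC n; rewrite ler_norml => /andP[_].
  have : n.+1%:R * fringe_var t <= 0 :> R by rewrite mulr_ge0_le0.
  have : C / n.+1%:R < e ^+ 2.
    rewrite ltr_pdivrMr // mulrC -ltr_pdivrMr ?exprn_gt0 //.
    by rewrite (lt_le_trans hN) // ler_nat (leq_trans Nn).
  by move: (C / _) (n.+1%:R * _) => ? ?; lra.
have [T sT yT] := exists_small_dev (small N (leqnn _)) e0.
have [T' sT' yT'] := exists_small_dev (small N.+1 (leqnSn _)) e0.
have s2 : N.+2%:R = N.+1%:R + 1 :> R by rewrite natr1.
move: yT yT'; rewrite /fringe_dev sT sT' s2 !ltr_norml.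
case: (leqP (fringe_count t (compress T')) (fringe_count t (compress T))) => le.
  have : fringe_nb t T' <= fringe_nb t T :> R by rewrite ler_nat.
  by move=> ? /andP[? ?] /andP[? ?]; lra.
have : fringe_nb t T + 1 <= fringe_nb t T' :> R by rewrite natr1 ler_nat.
by move=> ? /andP[? ?] /andP[? ?]; lra.
Qed.

Lemma dev_mean_bound : exists2 C : R, 0 <= C & forall n, `|dev_mean t n| <= C.
Proof.
have [C C0 h] := @dev_mean_decay R t t0; exists C => // n.
apply: (le_trans (h n)); rewrite ler_piMr //.
by have := @geom_half_le R _ _ (leq0n n); rewrite expr0.
Qed.

Lemma dev_sqr_bound : exists2 C : R, 0 <= C & forall n, dev_sqr t n <= C * n.+1%:R.
Proof.
have [C C0 h] := @dev_sqr_asymp R t t0.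
have v0 := ltW fringe_var_gt0.
exists (C + fringe_var t); first exact: addr_ge0.
move=> n; have := h n; rewrite ler_norml => /andP[_].
have : C / n.+1%:R <= C * n.+1%:R.
  by rewrite ler_wpM2l // (@le_trans _ _ 1) ?ler1n // invf_le1 // ler1n.
rewrite mulrDl (mulrC (fringe_var t)); move: (C / _) (n.+1%:R * _) => ? ?; lra.
Qed.

Lemma dev_cube_le k : `|bstE k (fun T => Y T ^+ 3)| <= k.+1%:R * dev_sqr t k.
Proof.
apply: (le_trans (ler_norm_bstE _ _)); rewrite /dev_sqr -bstEZ; apply: le_bstE.
move=> T sT; rewrite exprS normrM normrX real_normK ?num_real //.
by rewrite ler_wpM2r ?sqr_ge0 // -sT norm_fringe_dev.
Qed.

Definition dev_quart n : R := bstE n (fun T => Y T ^+ 4).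

Lemma sum_sqr_le n : \sum_(k < n.+1) (k.+1%:R : R) ^+ 2 <= n.+1%:R * n.+2%:R ^+ 2 / 3.
Proof.
rewrite ler_pdivlMr //; elim: n => [|n IH].
  by rewrite big_ord_recl big_ord0 addr0 expr1n; lra.
rewrite big_ord_recr mulrDl /=; apply: (le_trans (lerD IH (lexx _))).
have -> : n.+3%:R = n.+1%:R + 2 :> R by rewrite -natrD addn2.
have -> : n.+2%:R = n.+1%:R + 1 :> R by rewrite natr1.
have : 0 <= n.+1%:R :> R by [].
move: n.+1%:R => x x0; rewrite -subr_ge0.
have -> : (x + 1) * (x + 2) ^+ 2 - (x * (x + 1) ^+ 2 + (x + 1) ^+ 2 * 3) =
  x + 1 by ring.
by rewrite addr_ge0.
Qed.

Lemma expr4_norm (x : R) : `|x| ^+ 4 = x ^+ 4.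
Proof. by rewrite -normrX ger0_norm // exprn_even_ge0. Qed.

Lemma bstE_add_quart k m (f : btree -> R) :
  bstE k (fun l => bstE m (fun r => (f l + f r) ^+ 4)) =
  bstE k (fun T => f T ^+ 4) + bstE m (fun T => f T ^+ 4) +
  (4 * (bstE k (fun T => f T ^+ 3) * bstE m f) +
   4 * (bstE k f * bstE m (fun T => f T ^+ 3)) +
   6 * (bstE k (fun T => f T ^+ 2) * bstE m (fun T => f T ^+ 2))).
Proof.
transitivity (bstE k (fun l => bstE m (fun r =>
   f l ^+ 4 + f r ^+ 4 + (4 * (f l ^+ 3 * f r) + 4 * (f l * f r ^+ 3) +
   6 * (f l ^+ 2 * f r ^+ 2))))).
  by apply: eq_bstE => l _; apply: eq_bstE => r _; ring.
under eq_bstE => l _ do rewrite !bstED !bstEZ bstE_cst.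
by rewrite !bstED !bstEZ bstE_cst !bstEZr.
Qed.

(** Bounded means make the crude estimate of third moments by [n^2] sufficient in the cross terms.
    Averaging turns a bound [C (k + 1)^2] into 2/3 of the same bound, so the induction closes once
    [C] exceeds [3 K]; the extra 1 covers the empty tree. *)
Lemma dev_quart_bound : exists2 C : R, 0 <= C &
  forall n, dev_quart n <= C * n.+1%:R ^+ 2.
Proof.
have [Cm Cm0 hm] := dev_mean_bound.
have [Cs Cs0 hs] := dev_sqr_bound.
have [Cp Cp0 hp] := @toll_prob_decay R t.
pose K := 8 * (Cs * Cm) + 6 * Cs ^+ 2 + 16 * Cp.
have K0 : 0 <= K by rewrite !addr_ge0 ?mulr_ge0 ?exprn_ge0.
exists (3 * K + 1); first by rewrite addr_ge0 ?mulr_ge0.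
elim/ltn_ind => -[|n] IH.
  rewrite /dev_quart bstE0 /= expr1n mulr1.
  have h := @norm_fringe_dev R t EmptyTree; rewrite -expr4_norm.
  rewrite (@le_trans _ _ 1) //; last by rewrite lerDr mulr_ge0.
  by rewrite exprn_ile1.
have rec : dev_quart n.+1 <= n.+1%:R^-1 * (\sum_(k < n.+1)
    (dev_quart k + dev_quart (n - k)%N + (8 * (Cs * Cm) + 6 * Cs ^+ 2) * n.+2%:R ^+ 2))
    + 16 * Cp * n.+2%:R ^+ 2.
  have -> : dev_quart n.+1 = bstE n.+1 (fun T => (Y T - (toll t T)%:R) ^+ 4) +
     bstE n.+1 (fun T => Y T ^+ 4 - (Y T - (toll t T)%:R) ^+ 4).
    by rewrite -bstED; apply: eq_bstE => T _; rewrite addrC subrK.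
  apply: lerD; last first.
    apply: le_trans (_ : bstE n.+1 (fun T => n.+2%:R ^+ 4 * (toll t T)%:R) <= _).
      apply: le_bstE => T sT; case: (boolP (toll t T)) => tT; last first.
        by rewrite subr0 subrr mulr0.
      rewrite mulr1 lerBlDr (@le_trans _ _ (n.+2%:R ^+ 4)) ?lerDl //; last first.
        by rewrite exprn_even_ge0.
      have h := @norm_fringe_dev R t T; rewrite sT in h.
      by rewrite -expr4_norm lerXn2r ?nnegrE.
    rewrite bstEZ; have g0 := @geom_half_gt0 R n.+1; have gq := @geom_half_quad R n.+1.
    apply: le_trans (_ : n.+2%:R ^+ 4 * (Cp * 2^-1 ^+ n.+1) <= _).
      by rewrite ler_wpM2l ?exprn_ge0 // hp.
    have -> : n.+2%:R ^+ 4 * (Cp * 2^-1 ^+ n.+1) =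
      Cp * (n.+2%:R ^+ 2 * 2^-1 ^+ n.+1) * n.+2%:R ^+ 2 by ring.
    rewrite ler_wpM2r ?exprn_ge0 //.
    apply: (le_trans (ler_wpM2l Cp0 gq)); lra.
  rewrite bstES ler_pM2l ?invr_gt0 ?ltr0n //; apply: ler_sum => k _.
  have kn : (k <= n)%N by rewrite -ltnS.
  have -> : bstE k (fun l => bstE (n - k)%N (fun r =>
       (Y (BNode l r) - (toll t (BNode l r))%:R) ^+ 4)) =
    dev_quart k + dev_quart (n - k)%N +
    (4 * (bstE k (fun T => Y T ^+ 3) * dev_mean t (n - k)%N) +
     4 * (dev_mean t k * bstE (n - k)%N (fun T => Y T ^+ 3)) +
     6 * (dev_sqr t k * dev_sqr t (n - k)%N)).
    rewrite -bstE_add_quart; apply: eq_bstE => l _; apply: eq_bstE => r _.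
    by rewrite fringe_dev_node // addrK.
  rewrite lerD2l.
  have k1 : k.+1%:R <= n.+2%:R :> R by rewrite ler_nat ltnS ltnW.
  have k2 : (n - k).+1%:R <= n.+2%:R :> R by rewrite ler_nat ltnS (leq_trans (leq_subr _ _)).
  have cube j : j.+1%:R <= n.+2%:R :> R ->
      `|bstE j (fun T => Y T ^+ 3)| <= Cs * n.+2%:R ^+ 2.
    move=> jn; apply: (le_trans (dev_cube_le j)).
    apply: le_trans (_ : n.+2%:R * (Cs * n.+2%:R) <= _).
      apply: ler_pM => //; first by apply: bstE_ge0 => T _; exact: sqr_ge0.
      by apply: (le_trans (hs j)); rewrite ler_wpM2l.
    by rewrite mulrCA -expr2.
  have c1 : bstE k (fun T => Y T ^+ 3) * dev_mean t (n - k)%N <= Cs * n.+2%:R ^+ 2 * Cm.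
    by rewrite (le_trans (ler_norm _)) // normrM ler_pM // cube.
  have c2 : dev_mean t k * bstE (n - k)%N (fun T => Y T ^+ 3) <= Cm * (Cs * n.+2%:R ^+ 2).
    by rewrite (le_trans (ler_norm _)) // normrM ler_pM // cube.
  have c3 : dev_sqr t k * dev_sqr t (n - k)%N <= (Cs * n.+2%:R) * (Cs * n.+2%:R).
    apply: ler_pM; try by apply: bstE_ge0 => T _; exact: sqr_ge0.
      by apply: (le_trans (hs k)); rewrite ler_wpM2l.
    by apply: (le_trans (hs (n - k)%N)); rewrite ler_wpM2l.
  lra.
apply: (le_trans rec).
rewrite !big_split /= sum_bstE_rev.
have cstE (c : R) : \sum_(k < n.+1) c = n.+1%:R * c.
  by rewrite sumr_const card_ord mulr_natl.
rewrite cstE.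
have hsum : \sum_(k < n.+1) dev_quart k <= (3 * K + 1) * (n.+1%:R * n.+2%:R ^+ 2 / 3).
  apply: le_trans (_ : \sum_(k < n.+1) (3 * K + 1) * k.+1%:R ^+ 2 <= _).
    by apply: ler_sum => k _; exact: IH.
  by rewrite -mulr_sumr ler_wpM2l ?sum_sqr_le // addr_ge0 // mulr_ge0.
have n0 : 0 < n.+1%:R :> R by [].
have X0 : 0 <= n.+2%:R ^+ 2 :> R by rewrite exprn_ge0.
rewrite -lerBrDr ler_pdivrMl //.
move: hsum n0 X0; rewrite /K; move: (\sum_(k < n.+1) _) (n.+1%:R : R) (n.+2%:R ^+ 2 : R).
move=> S x X hS x0 X0; rewrite mulrCA in hS.
apply: (le_trans (lerD (lerD hS hS) (lexx _))); rewrite -subr_ge0.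
rewrite [leRHS](_ : _ = x * X / 3); last by field.
by rewrite divr_ge0 // mulr_ge0 // ltW.
Qed.

(** Interpolation: [|Y|^3 <= s Y^2 + Y^4 / s], at the scale [s = sqrt (n + 1)]. *)
Lemma dev_norm3_bound : exists2 C : R, 0 <= C & forall n,
  bstE n (fun T => `|Y T| ^+ 3) <= C * Num.sqrt n.+1%:R ^+ 3.
Proof.
have [Cs Cs0 hs] := dev_sqr_bound.
have [Cq Cq0 hq] := dev_quart_bound.
exists (Cs + Cq); first exact: addr_ge0.
move=> n; set s := Num.sqrt _.
have s0 : 0 < s by rewrite sqrtr_gt0.
have s2 : n.+1%:R = s ^+ 2 by rewrite sqr_sqrtr.
have h T : `|Y T| ^+ 3 <= s * Y T ^+ 2 + s^-1 * Y T ^+ 4.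
  rewrite -(real_normK (num_real (Y T))) -(ler_pM2l s0) mulrDr mulVKf ?gt_eqF //.
  have -> : Y T ^+ 4 = (`|Y T| ^+ 2) ^+ 2.
    by rewrite real_normK ?num_real // -exprM.
  have := normr_ge0 (Y T); move: `|Y T| => y y0.
  have -> : s * (s * y ^+ 2) + y ^+ 2 ^+ 2 =
    s * y ^+ 3 + y ^+ 2 * ((s - y / 2) ^+ 2 + 3 / 4 * y ^+ 2) by field.
  by rewrite lerDl mulr_ge0 ?sqr_ge0 // addr_ge0 ?sqr_ge0 // mulr_ge0 ?sqr_ge0 // divr_ge0.
apply: le_trans (_ : s * dev_sqr t n + s^-1 * dev_quart n <= _).
  by rewrite -!bstEZ -bstED; apply: le_bstE => T _; exact: h.
have -> : (Cs + Cq) * s ^+ 3 = s * (Cs * s ^+ 2) + s^-1 * (Cq * (s ^+ 2) ^+ 2).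
  by field; rewrite gt_eqF.
have si : 0 < s^-1 by rewrite invr_gt0.
by rewrite lerD // ler_pM2l // -s2.
Qed.

End HigherMoments.

(** * Comparison with Gaussian operators *)

Section Induction.
Context {R : realType}.

(* The affine sequence [A (n + 1) - c] reproduces itself exactly under the
   recursion, which is why the error committed before [K] is only magnified by
   the factor [n / K]. *)
Lemma renewal_induction (Q : nat -> R -> Prop) (A B c : R) (K : nat) :
  A = 2 * (B + c) / K.+1%:R ->
  (forall n e e', e <= e' -> Q n e -> Q n e') ->
  (forall n, (n < K)%N -> Q n B) ->
  (forall n (D : nat -> R), (forall k, (k <= n)%N -> Q k (D k)) ->
    Q n.+1 (2 / n.+1%:R * (\sum_(k < n.+1) D k) + c)) ->
  (0 < K)%N -> forall n, (K <= n)%N -> Q n (A * n.+1%:R - c).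
Proof.
move=> AE Qle QB QS K0.
pose D n := if (n < K)%N then B else A * n.+1%:R - c.
have sumD n : (K <= n)%N -> \sum_(k < n) D k <= A * (n%:R * n.+1%:R) / 2 - n%:R * c.
  elim: n => [|n IH]; first by rewrite leqn0 => /eqP K00; rewrite K00 in K0.
  rewrite leq_eqVlt => /predU1P[<-|].
    (* The value of [A] is the one that makes this bound an equality at [n = K]. *)
    rewrite (eq_bigr (fun=> B)) => [|k _]; last by rewrite /D ltn_ord.
    rewrite sumr_const card_ord AE -mulr_natl.
    by rewrite le_eqVlt; apply/orP; left; apply/eqP; field; rewrite nat1r pnatr_eq0.
  rewrite ltnS => Kn; rewrite big_ord_recr /= {2}/D ltnNge Kn /=.
  apply: (le_trans (lerD (IH Kn) (lexx _))).
  have -> : n.+2%:R = n%:R + 2 :> R by rewrite -natrD addn2.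
  have -> : n.+1%:R = n%:R + 1 :> R by rewrite natr1.
  by rewrite le_eqVlt; apply/orP; left; apply/eqP; field.
suff QD n : Q n (D n).
  by move=> n Kn; have := QD n; rewrite /D ltnNge Kn.
elim/ltn_ind: n => n IH; rewrite /D; case: ltnP => [/QB //|Kn].
case: n => [|n] in IH Kn *; first by rewrite leqn0 in Kn; rewrite (eqP Kn) in K0.
apply: Qle (QS n D _) => [|k kn]; last exact: IH.
have n0 : 0 < n.+1%:R :> R by [].
rewrite -lerBrDr mulrAC ler_pdivrMr //.
apply: (le_trans (ler_wpM2l _ (sumD _ Kn))) => //.
by rewrite le_eqVlt; apply/orP; left; apply/eqP; field.
Qed.

Lemma lipschitz_continuous (h : R -> R) L :
  (forall x y, `|h (x + y) - h x| <= L * `|y|) -> continuous h.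
Proof.
move=> hL x; have L1 : 0 < `|L| + 1 by rewrite ltr_wpDl.
apply/cvgrPdist_le => e e0.
have d0 : 0 < e / (`|L| + 1) by rewrite divr_gt0.
have /cvgrPdist_le/(_ _ d0) H : id z @[z --> x] --> x by exact: cvg_id.
near=> z.
have -> : z = x + (z - x) by rewrite addrC subrK.
rewrite distrC (le_trans (hL _ _)) //.
apply: le_trans (_ : (`|L| + 1) * `|z - x| <= _).
  by rewrite ler_wpM2r // (le_trans (ler_norm L)) // lerDl.
rewrite mulrC -ler_pdivlMr // distrC.
Unshelve. all: end_near. Qed.

End Induction.

Section TestFunctionCLT.
Context {R : realType}.
Variable t : btree.
Hypothesis ft : full t.
Notation beta := (fringe_rate t : R).
Notation Y := (fringe_dev t : btree -> R).

Definition fringe_std : R := Num.sqrt (fringe_var t).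
Notation gam := fringe_std.

Lemma fringe_std_gt0 : 0 < gam.
Proof. by rewrite sqrtr_gt0; exact: fringe_var_gt0. Qed.

Lemma fringe_std_sqr : gam ^+ 2 = fringe_var t.
Proof. by rewrite sqr_sqrtr // ltW // fringe_var_gt0. Qed.

Variables (h a b : R -> R) (L : R).
Hypothesis h01 : forall x, 0 <= h x <= 1.
Hypothesis hL : forall x y, `|h (x + y) - h x| <= L * `|y|.
Hypothesis aL : forall x, `|a x| <= L.
Hypothesis bL : forall x, `|b x| <= L.
Hypothesis hT : forall x y,
  `|h (x + y) - h x - a x * y - b x / 2 * y ^+ 2| <= L * `|y| ^+ 3.

Let L0 : 0 <= L. Proof. exact: le_trans (aL 0). Qed.

Let ch : continuous h. Proof. exact: lipschitz_continuous hL. Qed.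

Lemma gauss_int_shift s x : gauss_int s (fun y => h (x + y)).
Proof.
apply: (@gauss_int_dom _ s _ (fun=> 1)); last exact: gauss_int_cst.
  apply: measurableT_comp; first exact: continuous_measurable_fun.
  exact: measurable_funD.
by move=> y; have /andP[? ?] := h01 (x + y); rewrite ger0_norm.
Qed.

Definition bst_op lam n x : R := bstE n (fun T => h (x + lam * Y T)).
Definition gauss_op s x : R := gaussE s (fun y => h (x + y)).
(** Since [(k + 1) + (n - k + 1) = (n + 1) + 1], the variances of the two subtrees add up to that of
    the whole tree without any error. *)
Definition gauss_sd lam n : R := lam * gam * Num.sqrt n.+1%:R.

Lemma gauss_sd_gt0 lam n : 0 < lam -> 0 < gauss_sd lam n.
Proof. by move=> l0; rewrite !mulr_gt0 ?fringe_std_gt0 ?sqrtr_gt0. Qed.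

Lemma gauss_op_lip s x y : `|gauss_op s (x + y) - gauss_op s x| <= L * `|y|.
Proof.
have i1 := gauss_int_shift s (x + y); have i2 := gauss_int_shift s x.
rewrite -gaussEB // -[leRHS](gaussE_cst s).
apply: ler_norm_gaussE; last by move=> z; rewrite addrAC hL.
  exact: (gauss_intD i1 (gauss_intN i2)).
exact: gauss_int_cst.
Qed.

Lemma gauss_op_bound s x : `|gauss_op s x| <= 1.
Proof.
rewrite -[leRHS](gaussE_cst s); apply: ler_norm_gaussE.
- exact: gauss_int_shift.
- exact: gauss_int_cst.
- by move=> y; have /andP[? ?] := h01 (x + y); rewrite ger0_norm.
Qed.

Lemma gauss_int_gauss_op s s' x : gauss_int s (fun y => gauss_op s' (x + y)).
Proof.
apply: (@gauss_int_dom _ s _ (fun=> 1)); last exact: gauss_int_cst.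
  apply: measurableT_comp; last exact: measurable_funD.
  apply: continuous_measurable_fun; exact: (lipschitz_continuous (gauss_op_lip s')).
by move=> y; exact: gauss_op_bound.
Qed.

Lemma gauss_op_conv s s' x : 0 < s -> 0 < s' ->
  gaussE s (fun y => gauss_op s' (x + y)) = gauss_op (Num.sqrt (s ^+ 2 + s' ^+ 2)) x.
Proof.
move=> s0 s'0; rewrite /gauss_op.
have chx : continuous (fun y => h (x + y)).
  apply: (@lipschitz_continuous _ _ L) => y z.
  by rewrite addrA hL.
rewrite -(gaussE_conv s0 s'0 chx (fun y => h01 (x + y))).
by congr gaussE; apply/funext => y; congr gaussE; apply/funext => z; rewrite addrA.
Qed.

Lemma gaussE_bst_op s lam n x : gauss_int s (fun y => bst_op lam n (x + y)) /\
  gaussE s (fun y => bst_op lam n (x + y)) =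
  bstE n (fun T => gauss_op s (x + lam * Y T)).
Proof.
have [] := @gaussE_sum _ s _ (trees n) bst_weight
  (fun T y => h (x + lam * Y T + y)) (fun T => gauss_int_shift s _).
rewrite /bst_op /bstE /gauss_op.
have -> : (fun y => \sum_(T <- trees n) bst_weight T * h (x + lam * Y T + y)) =
  (fun y => \sum_(T <- trees n) bst_weight T * h (x + y + lam * Y T)).
  by apply/funext => y; apply: eq_bigr => T _; rewrite addrAC.
by [].
Qed.

Lemma bst_op_rec lam n (D : nat -> R) : 0 < lam ->
  (forall k, (k <= n)%N -> forall x, `|bst_op lam k x - gauss_op (gauss_sd lam k) x| <= D k) ->
  forall x, `|bst_op lam n.+1 x - gauss_op (gauss_sd lam n.+1) x| <=
    2 / n.+1%:R * (\sum_(k < n.+1) D k) + L * lam.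
Proof.
move=> l0 hD x.
have t0 := full_neq0 ft.
(* The expectation with the toll removed; as the toll is at most 1, this costs at most [L * lam]. *)
pose V := n.+1%:R^-1 * \sum_(k < n.+1) bstE k (fun l => bst_op lam (n - k)%N (x + lam * Y l)).
have hV : `|bst_op lam n.+1 x - V| <= L * lam.
  have -> : V = bstE n.+1 (fun T => h (x + lam * (Y T - (toll t T)%:R))).
    rewrite /V bstES; congr (_ * _); apply: eq_bigr => k _.
    apply: eq_bstE => l _; apply: eq_bstE => r _.
    by rewrite fringe_dev_node //; congr h; ring.
  rewrite -bstEB (le_trans (ler_norm_bstE _ _)) // bstE_le_cst // => T _.
  have -> : x + lam * Y T = x + lam * (Y T - (toll t T)%:R) + lam * (toll t T)%:R by ring.
  apply: (le_trans (hL _ _)); rewrite ler_wpM2l // normrM (gtr0_norm l0).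
  by rewrite ler_piMr ?(ltW l0) // ger0_norm //; case: (toll t T).
have hk (k : 'I_n.+1) : `|bstE k (fun l => bst_op lam (n - k)%N (x + lam * Y l)) -
    gauss_op (gauss_sd lam n.+1) x| <= D (n - k)%N + D k.
  have kn : (k <= n)%N by rewrite -ltnS.
  set s := gauss_sd lam (n - k); set s' := gauss_sd lam k.
  have s0 : 0 < s by exact: gauss_sd_gt0.
  have s'0 : 0 < s' by exact: gauss_sd_gt0.
  have [i1 e1] := gaussE_bst_op s lam k x.
  have i2 := gauss_int_gauss_op s s' x.
  have -> : gauss_op (gauss_sd lam n.+1) x = gaussE s (fun y => gauss_op s' (x + y)).
    rewrite gauss_op_conv //; apply: (congr1 (fun u => gauss_op u x)).
    have -> : s ^+ 2 + s' ^+ 2 = (lam * gam) ^+ 2 * n.+2%:R.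
      have s2 j : gauss_sd lam j ^+ 2 = (lam * gam) ^+ 2 * j.+1%:R.
        by rewrite /gauss_sd [LHS]exprMn sqr_sqrtr.
      rewrite /s /s' !s2 -mulrDr -natrD.
      by congr (_ * _%:R); rewrite addSn addnS subnK.
    rewrite sqrtrM ?sqr_ge0 // sqrtr_sqr ger0_norm //.
    by rewrite mulr_ge0 // ltW // fringe_std_gt0.
  (* The right subtree is made Gaussian first; commuting the two operators by [gaussE_bst_op] then
     exposes the left one. Each replacement happens under an average, which does not increase the
     error. *)
  apply: le_trans (ler_distD (bstE k (fun l => gauss_op s (x + lam * Y l))) _ _) _.
  apply: lerD.
    rewrite -bstEB (le_trans (ler_norm_bstE _ _)) // bstE_le_cst // => T _.
    by apply: hD; exact: leq_subr.
  rewrite -e1 -gaussEB // -[leRHS](gaussE_cst s); apply: ler_norm_gaussE.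
  - exact: (gauss_intD i1 (gauss_intN i2)).
  - exact: gauss_int_cst.
  - by move=> y; exact: hD.
apply: (le_trans (ler_distD V _ _)); rewrite addrC lerD //.
have n0 : n.+1%:R != 0 :> R by rewrite pnatr_eq0.
have -> : V - gauss_op (gauss_sd lam n.+1) x = n.+1%:R^-1 * \sum_(k < n.+1)
   (bstE k (fun l => bst_op lam (n - k)%N (x + lam * Y l)) - gauss_op (gauss_sd lam n.+1) x).
  by rewrite sumrB sumr_const card_ord mulrBr -(mulr_natl (gauss_op _ _)) mulKf.
rewrite normrM ger0_norm ?invr_ge0 // -[leRHS]mulrA [leRHS]mulrCA.
rewrite ler_pM2l ?invr_gt0 ?ltr0n //.
apply: (le_trans (ler_norm_sum _ _ _)).
apply: le_trans (_ : \sum_(k < n.+1) (D (n - k)%N + D k) <= _).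
  by apply: ler_sum => k _; exact: hk.
rewrite big_split /= mulr_natl mulr2n lerD2r.
by rewrite (reindex_inj rev_ord_inj) /= le_eqVlt; apply/orP; left; apply/eqP;
   apply: eq_bigr => k _; rewrite subSS subKn // -ltnS.
Qed.

(** The three terms are the errors in the mean, which is bounded, in the variance, and in the Taylor
    remainders of both operators. *)
Lemma bst_op_small : exists2 C : R, 0 <= C & forall lam n x, 0 < lam ->
  `|bst_op lam n x - gauss_op (gauss_sd lam n) x| <=
  C * (lam + lam ^+ 2 + (lam * Num.sqrt n.+1%:R) ^+ 3).
Proof.
have t0 := full_neq0 ft.
have [Cm Cm0 hm] := @dev_mean_bound R t ft.
have [Cs Cs0 hs] := @dev_sqr_asymp R t t0.
have [C3 C30 h3] := @dev_norm3_bound R t ft.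
have g0 := fringe_std_gt0.
pose C := L * Cm + L * Cs + L * C3 + L * (12 * expR 2 * gam ^+ 3).
have e20 : 0 <= 12 * expR 2 * gam ^+ 3 by rewrite !mulr_ge0 ?expR_ge0 ?exprn_ge0 ?ltW.
exists C; first by rewrite !addr_ge0 ?mulr_ge0 // ltW.
move=> lam n x l0; set s := Num.sqrt _.
have s0 : 0 < s by rewrite sqrtr_gt0.
have l00 := ltW l0; have s00 := ltW s0.
have gE : `|gauss_op (gauss_sd lam n) x - h x -
    b x / 2 * (lam ^+ 2 * fringe_var t * n.+1%:R)| <=
    L * (12 * expR 2 * gam ^+ 3) * (lam * s) ^+ 3.
  have := gaussE_taylor (gauss_sd_gt0 n l0) (gauss_int_shift _ x) (hT x).
  rewrite /gauss_sd -/s -/(gauss_op _ x) !exprMn fringe_std_sqr sqr_sqrtr //.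
  by move=> /le_trans; apply; rewrite le_eqVlt; apply/orP; left; apply/eqP; ring.
have bE : `|bst_op lam n x - h x - a x * (lam * dev_mean t n) -
    b x / 2 * (lam ^+ 2 * dev_sqr t n)| <= L * C3 * (lam * s) ^+ 3.
  have -> : bst_op lam n x - h x - a x * (lam * dev_mean t n) -
    b x / 2 * (lam ^+ 2 * dev_sqr t n) =
    bstE n (fun T => h (x + lam * Y T) - h x - a x * (lam * Y T) - b x / 2 * (lam * Y T) ^+ 2).
    rewrite /dev_mean /dev_sqr -!bstEZ -[in LHS](bstE_cst n (h x)) -!bstEB.
    by apply: eq_bstE => T _; rewrite exprMn.
  apply: (le_trans (ler_norm_bstE _ _)).
  apply: le_trans (_ : bstE n (fun T => L * lam ^+ 3 * `|Y T| ^+ 3) <= _).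
    apply: le_bstE => T _; apply: (le_trans (hT _ _)).
    by rewrite normrM exprMn mulrA (gtr0_norm l0).
  rewrite bstEZ (le_trans (ler_wpM2l _ (h3 n))) ?mulr_ge0 ?exprn_ge0 //.
  by rewrite -/s le_eqVlt; apply/orP; left; apply/eqP; ring.
have hmean : `|a x * (lam * dev_mean t n)| <= L * Cm * lam.
  rewrite !normrM (gtr0_norm l0) mulrCA mulrC ler_wpM2r //.
  by rewrite ler_pM.
have hvar : `|b x / 2 * (lam ^+ 2 * (dev_sqr t n - n.+1%:R * fringe_var t))| <= L * Cs * lam ^+ 2.
  rewrite normrM (normrM (lam ^+ 2)) (ger0_norm (sqr_ge0 lam)) mulrCA mulrC.
  rewrite ler_wpM2r ?exprn_ge0 // ler_pM //.
    rewrite normrM (@le_trans _ _ `|b x|) // ler_piMr // normfV ger0_norm //.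
    by rewrite invf_le1 // ler1n.
  by rewrite (le_trans (hs n)) // ler_pdivrMr ?ltr0n // ler_peMr // ler1n.
have -> : bst_op lam n x - gauss_op (gauss_sd lam n) x =
  (bst_op lam n x - h x - a x * (lam * dev_mean t n) - b x / 2 * (lam ^+ 2 * dev_sqr t n)) -
  (gauss_op (gauss_sd lam n) x - h x - b x / 2 * (lam ^+ 2 * fringe_var t * n.+1%:R)) +
  (a x * (lam * dev_mean t n) +
   b x / 2 * (lam ^+ 2 * (dev_sqr t n - n.+1%:R * fringe_var t))) by ring.
apply: (le_trans (ler_normD _ _)).
apply: (le_trans (lerD (ler_normB _ _) (ler_normD _ _))).
apply: (le_trans (lerD (lerD bE gE) (lerD hmean hvar))).
set u := (lam * s) ^+ 3; have u0 : 0 <= u by rewrite exprn_ge0 // mulr_ge0.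
have l2 : 0 <= lam ^+ 2 by rewrite sqr_ge0.
rewrite /C; set E := 12 * expR 2 * gam ^+ 3 in e20 *.
rewrite -subr_ge0.
have -> : (L * Cm + L * Cs + L * C3 + L * E) * (lam + lam ^+ 2 + u) -
  (L * C3 * u + L * E * u + (L * Cm * lam + L * Cs * lam ^+ 2)) =
  L * Cm * (lam ^+ 2 + u) + L * Cs * (lam + u) + (L * C3 + L * E) * (lam + lam ^+ 2) by ring.
by repeat first [assumption | apply: addr_ge0 | apply: mulr_ge0].
Qed.

(** With [lam = 1 / sqrt N] and [K] about [N / r^2], the error below [K] is of order [lam + r^-3]
    and is multiplied by at most [2 r^2]. This leaves terms of order [r^2 / sqrt N] and [1 / r]: [r]
    is chosen first, then [N]. *)
Lemma bst_op_clt e : 0 < e -> exists N0, forall N x, (N0 <= N)%N ->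
  `|bst_op (Num.sqrt N%:R)^-1 N x - gauss_op (gauss_sd (Num.sqrt N%:R)^-1 N) x| <= e.
Proof.
move=> e0; have [C C0 hC] := bst_op_small.
(* At least 2, which ensures [K <= N] below. *)
pose r := (Num.truncn (32 * C / e)).+2.
have r0 : 0 < r%:R :> R by rewrite ltr0n.
have hr : 16 * C / r%:R <= e / 2.
  have : 32 * C / e < r%:R.
    by rewrite (lt_trans (Num.Theory.truncnS_gt _)) // ltr_nat.
  by rewrite ltr_pdivrMr // ler_pdivrMr //; lra.
pose M := (2 * (2 * C + L) * (r ^ 2)%:R) / (e / 2).
have M0 : 0 <= M by rewrite divr_ge0 ?mulr_ge0 ?addr_ge0 ?mulr_ge0 // ltW.
exists (maxn (r ^ 2) (Num.truncn (M ^+ 2)).+1) => N x; rewrite geq_max => /andP[rN MN].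
have N0 : (0 < N)%N by rewrite (leq_trans _ MN).
set s := Num.sqrt N%:R.
have s0 : 0 < s by rewrite sqrtr_gt0 ltr0n.
have s2 : N%:R = s ^+ 2 by rewrite sqr_sqrtr.
set lam := s^-1.
have l0 : 0 < lam by rewrite invr_gt0.
have l1 : lam <= 1.
  by rewrite invf_le1 // -[leLHS]sqrtr1 ler_wsqrtr // ler1n.
have lM : 2 * (2 * C + L) * (r ^ 2)%:R * lam <= e / 2.
  have : M <= s.
    rewrite -(ler_pXn2r (ltn0Sn 1)) ?nnegrE ?(ltW s0) // -s2.
    by rewrite ltW // (lt_le_trans (Num.Theory.truncnS_gt _)) // ler_nat.
  rewrite /M /lam ler_pdivrMr ?divr_gt0 // => hh.
  by rewrite ler_pdivrMr // [leRHS]mulrC.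
pose K := (N %/ r ^ 2).+1.
have r2 : (0 < r ^ 2)%N by rewrite expn_gt0.
have KN : (N < r ^ 2 * K)%N by rewrite mulnC ltn_ceil.
have NK : (K * r ^ 2 <= 2 * N)%N.
  by rewrite /K mulSn mul2n -addnn leq_add // leq_divM.
have KN' : (K <= N)%N.
  by rewrite ltn_Pdiv // (@leq_trans (2 ^ 2)) // leq_exp2r.
have lK : (lam * Num.sqrt K%:R) ^+ 3 <= 4 / r%:R ^+ 3.
  (* Rounding up in [K] costs a factor 2: [K r^2 <= 2 N], so the square is at most 2, and
     [(3 / 2)^3 <= 4]. *)
  have h2 : lam * Num.sqrt K%:R * r%:R <= 3 / 2.
    rewrite -(ler_pXn2r (ltn0Sn 1)) ?nnegrE ?mulr_ge0 ?(ltW l0) ?(ltW r0) //.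
    rewrite !exprMn sqr_sqrtr // exprVn -s2 -mulrA ler_pdivrMl ?ltr0n //.
    rewrite -natrX -natrM; apply: (@le_trans _ _ (2 * N%:R)).
      by rewrite -natrM ler_nat.
    have : 0 < N%:R :> R by rewrite ltr0n.
    by rewrite exprVn; lra.
  rewrite ler_pdivlMr ?exprn_gt0 // -exprMn.
  have z0 : 0 <= lam * Num.sqrt K%:R * r%:R.
    by rewrite !mulr_ge0 ?sqrtr_ge0 ?(ltW l0) ?(ltW r0).
  apply: le_trans (_ : (3 / 2) ^+ 3 <= _).
    by rewrite lerXn2r ?nnegrE // divr_ge0.
  by rewrite !exprS expr0; lra.
pose B := C * (2 * lam + 4 / r%:R ^+ 3).
pose Q n e' := forall x, `|bst_op lam n x - gauss_op (gauss_sd lam n) x| <= e'.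
have QB n : (n < K)%N -> Q n B.
  move=> nK y; apply: (le_trans (hC lam n y l0)); rewrite ler_wpM2l // lerD //.
    have : lam ^+ 2 <= lam by rewrite expr2 ler_piMl // ltW.
    lra.
  apply: le_trans lK; rewrite lerXn2r ?nnegrE ?mulr_ge0 ?(ltW l0) //.
  by rewrite ler_wpM2l ?(ltW l0) // ler_wsqrtr // ler_nat.
have BE : 0 <= B.
  by rewrite mulr_ge0 // addr_ge0 ?mulr_ge0 ?(ltW l0) // divr_ge0 // exprn_ge0 // ltW.
have /(_ x) hQ := @renewal_induction _ Q (2 * (B + L * lam) / K.+1%:R) B (L * lam) K erefl
  (fun n e1 e2 e12 he y => le_trans (he y) e12) QB
  (fun n D hD => bst_op_rec l0 hD) (ltn0Sn _) N KN'.
apply: (le_trans hQ); rewrite lerBlDr.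
have Ll0 : 0 <= L * lam by rewrite mulr_ge0 // ltW.
apply: le_trans (_ : 2 * (B + L * lam) * (r ^ 2)%:R <= _).
  rewrite [leLHS]mulrAC ler_pdivrMr // -[leRHS]mulrA.
  rewrite ler_wpM2l ?mulr_ge0 ?addr_ge0 //.
  by rewrite -natrM ler_nat (leq_trans KN) // leq_mul2l leqnSn orbT.
have -> : 2 * (B + L * lam) * (r ^ 2)%:R =
  2 * (2 * C + L) * (r ^ 2)%:R * lam + 8 * C / r%:R.
  by rewrite /B natrX; field; rewrite gt_eqF.
have : 8 * C / r%:R <= 16 * C / r%:R.
  by rewrite ler_wpM2r ?invr_ge0 ?(ltW r0) // ler_wpM2r //; lra.
lra.
Qed.

End TestFunctionCLT.

(** * Convergence of distribution functions *)

Section CLT.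
Context {R : realType}.
Variable t : btree.
Hypothesis ft : full t.
Notation beta := (fringe_rate t : R).
Notation gam := (fringe_std t : R).

Lemma eventually_inv_sqrt (e : R) : 0 < e ->
  exists N0, forall N, (N0 <= N)%N -> (0 < N)%N /\ (Num.sqrt N%:R)^-1 <= e.
Proof.
move=> e0; exists (Num.truncn (e ^- 2)).+1 => N hN; have N0 : (0 < N)%N by exact: leq_trans hN.
split=> //; rewrite -[leRHS]invrK lef_pV2 ?posrE ?invr_gt0 ?sqrtr_gt0 ?ltr0n //.
rewrite -(ler_pXn2r (ltn0Sn 1)) ?nnegrE ?invr_ge0 ?(ltW e0) ?sqrtr_ge0 //.
rewrite sqr_sqrtr // exprVn ltW // (lt_le_trans (Num.Theory.truncnS_gt _)) //.
by rewrite ler_nat.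
Qed.

(** Replaces [n + 1] by [n], both in the centring, a shift by [beta * lam], and in the variance.
    Each costs at most a multiple of [1 / sqrt N] as [h] is Lipschitz. *)
Lemma bstE_clt_test (h a b : R -> R) (L : R) :
  (forall x, 0 <= h x <= 1) ->
  (forall x y, `|h (x + y) - h x| <= L * `|y|) ->
  (forall x, `|a x| <= L) -> (forall x, `|b x| <= L) ->
  (forall x y, `|h (x + y) - h x - a x * y - b x / 2 * y ^+ 2| <= L * `|y| ^+ 3) ->
  forall e, 0 < e -> exists N0, forall N, (N0 <= N)%N ->
    `|bstE N (fun T => h ((fringe_nb t T - N%:R * beta) / Num.sqrt N%:R)) -
      gaussE gam h| <= e.
Proof.
move=> h01 hL aL bL hT e e0.
have L0 : 0 <= L by exact: le_trans (aL 0).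
have g0 : 0 < gam by exact: fringe_std_gt0.
have b0 : 0 < beta by exact: fringe_rate_gt0.
have e20 : 0 < e / 2 by rewrite divr_gt0.
have [N1 hN1] := bst_op_clt ft h01 hL aL bL hT e20.
have D0 : 0 < L * (beta + gam) + 1 by rewrite ltr_wpDl // mulr_ge0 // addr_ge0 // ltW.
have [N2 hN2] := eventually_inv_sqrt (divr_gt0 e20 D0).
exists (maxn N1 N2) => N; rewrite geq_max => /andP[/hN1 + /hN2 [N0]].
set lam := (Num.sqrt N%:R)^-1 => clt lame.
have l0 : 0 < lam by rewrite invr_gt0 sqrtr_gt0 ltr0n.
have lN : lam ^+ 2 * N%:R = 1 by rewrite exprVn sqr_sqrtr // mulVf // pnatr_eq0 -lt0n.
have -> : bstE N (fun T => h ((fringe_nb t T - N%:R * beta) * lam)) =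
    bst_op t h lam N (beta * lam).
  apply: eq_bstE => T sT; congr h; rewrite /fringe_dev sT -natr1; ring.
set s := gauss_sd t lam N.
have h1 := clt (beta * lam).
have h2 := gauss_op_lip h01 hL s 0 (beta * lam).
have gl0 : 0 < gam * lam by rewrite mulr_gt0.
(* The Gaussian variable of deviation [s] is one of deviation [gam] plus an independent one of
   deviation [gam * lam], whose mean absolute value is at most [gam * lam]. *)
have h3 : `|gauss_op h s 0 - gaussE gam h| <= L * (gam * lam).
  have -> : s = Num.sqrt (gam ^+ 2 + (gam * lam) ^+ 2).
    have lg0 : 0 <= lam * gam by rewrite mulr_ge0 ?(ltW l0) ?(ltW g0).
    rewrite /s /gauss_sd -(ger0_norm lg0) -sqrtr_sqr.
    rewrite -sqrtrM ?sqr_ge0 //; congr Num.sqrt; rewrite -natr1 mulrDr mulr1 !exprMn.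
    by rewrite mulrAC lN mul1r (mulrC (lam ^+ 2)).
  rewrite -(gauss_op_conv h01 hL) //.
  have i1 := gauss_int_gauss_op h01 hL gam (gam * lam) 0.
  have -> : gaussE gam h = gaussE gam (fun y => h (0 + y)).
    by congr gaussE; apply/funext => y; rewrite add0r.
  have i2 := gauss_int_shift h01 hL gam 0.
  rewrite -gaussEB // -[leRHS](gaussE_cst gam); apply: ler_norm_gaussE.
  - exact: (gauss_intD i1 (gauss_intN i2)).
  - exact: gauss_int_cst.
  move=> y; rewrite -[X in _ - X](gaussE_cst (gam * lam)) /gauss_op.
  have j1 := gauss_int_shift h01 hL (gam * lam) (0 + y).
  have j2 := gauss_int_cst (gam * lam) (h (0 + y)).
  have [n1 n2] := gaussE_norm_le gl0.
  rewrite -gaussEB // (@le_trans _ _ (L * gaussE (gam * lam) (fun z => `|z|))) //.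
    rewrite -gaussEZ //; apply: ler_norm_gaussE.
    - exact: (gauss_intD j1 (gauss_intN j2)).
    - exact: gauss_intZ.
    - by move=> z; exact: hL.
  by rewrite ler_wpM2l.
rewrite add0r in h2.
have h4 : L * `|beta * lam| + L * (gam * lam) <= e / 2.
  have bl0 : 0 <= beta * lam by rewrite mulr_ge0 ?(ltW b0) ?(ltW l0).
  rewrite (ger0_norm bl0).
  have : (L * (beta + gam) + 1) * lam <= e / 2 by rewrite mulrC -ler_pdivlMr.
  by apply: le_trans; rewrite mulrDl mul1r mulrDr mulrDl -!mulrA lerDl ltW.
have -> : bst_op t h lam N (beta * lam) - gaussE gam h =
  (bst_op t h lam N (beta * lam) - gauss_op h s (beta * lam)) +
  ((gauss_op h s (beta * lam) - gauss_op h s 0) + (gauss_op h s 0 - gaussE gam h)).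
  by ring.
apply: (le_trans (ler_normD _ _)).
apply: (le_trans (lerD h1 (le_trans (ler_normD _ _) (lerD h2 h3)))).
by rewrite [leRHS]splitr lerD2l.
Qed.

Lemma bstE_clt_logistic (k c e : R) : 0 < k -> 0 < e ->
  exists N0, forall N, (N0 <= N)%N ->
    `|bstE N (fun T => logistic (k * ((fringe_nb t T - N%:R * beta) / Num.sqrt N%:R - c))) -
      gaussE gam (fun y => logistic (k * (y - c)))| <= e.
Proof.
move=> k0 e0; have k00 := ltW k0.
have k2 : 0 <= k ^+ 2 by rewrite sqr_ge0.
have k3 : 0 <= k ^+ 3 by rewrite exprn_ge0.
pose L := k + k ^+ 2 + 13 * k ^+ 3.
apply: (@bstE_clt_test (fun x => logistic (k * (x - c)))
  (fun x => k * logistic1 (k * (x - c))) (fun x => k ^+ 2 * logistic2 (k * (x - c))) L) => //.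
- by move=> x; exact: logistic_bounds.
- move=> x y; rewrite addrAC mulrDr (le_trans (logistic_lip _ _)) //.
  by rewrite normrM (gtr0_norm k0) ler_wpM2r // /L; lra.
- move=> x; rewrite normrM (gtr0_norm k0).
  have := logistic1_bound (k * (x - c)); have := normr_ge0 (logistic1 (k * (x - c))).
  by move=> ? ?; rewrite (@le_trans _ _ k) ?ler_piMr // /L; lra.
- move=> x; rewrite normrM (ger0_norm k2).
  have := logistic2_bound (k * (x - c)); have := normr_ge0 (logistic2 (k * (x - c))).
  by move=> ? ?; rewrite (@le_trans _ _ (k ^+ 2)) ?ler_piMr // /L; lra.
move=> x y; have := taylor2_logistic (k * (x - c)) (k * y).
have -> : k * (x + y - c) = k * (x - c) + k * y by ring.
have -> : k ^+ 2 * logistic2 (k * (x - c)) / 2 * y ^+ 2 =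
  logistic2 (k * (x - c)) / 2 * (k * y) ^+ 2 by ring.
have -> : k * logistic1 (k * (x - c)) * y = logistic1 (k * (x - c)) * (k * y) by ring.
move=> /le_trans; apply; rewrite normrM (gtr0_norm k0) exprMn mulrA.
by rewrite ler_wpM2r ?exprn_ge0 // /L; lra.
Qed.

Definition gauss_cdf (s r : R) : R := fine (normal_prob 0 s `]-oo, r]%classic).

Lemma gauss_cdfE s r : gauss_int s (fun y => (y <= r)%R%:R) /\
  gauss_cdf s r = gaussE s (fun y => (y <= r)%R%:R).
Proof.
have e : (fun y : R => (y <= r)%R%:R) = \1_(`]-oo, r]%classic) :> (R -> R).
  by apply/funext => y; rewrite indicE mem_setE in_itv.
split.
  apply: (@gauss_int_dom _ s _ (fun=> 1)); last exact: gauss_int_cst.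
    by rewrite e; exact: measurable_indic.
  by move=> y; case: (y <= r); rewrite ?normr1 ?normr0 ?lexx ?ler01.
rewrite e; transitivity (\int[@lebesgue_measure R]_(y in `]-oo, r]) normal_pdf 0 s y)%R.
  by [].
rewrite Rintegral_mkcond.
apply: eq_Rintegral => y _; rewrite patchE indicE.
by case: ifP => _; rewrite ?mul1r ?mul0r.
Qed.

Lemma logistic_step (k c d eta x : R) : 0 < d -> 0 < eta -> k = (d * eta)^-1 ->
  (x <= c - d)%R%:R - eta <= logistic (k * (x - c)) <= (x <= c + d)%R%:R + eta.
Proof.
move=> d0 eta0 kE; have k0 : 0 < k by rewrite kE invr_gt0 mulr_gt0.
have kd : (k * d)^-1 = eta by rewrite kE invfM invrK mulrAC divff ?mul1r ?gt_eqF.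
have small y : d <= y -> logistic (k * y) <= eta.
  move=> dy; have ky0 : 0 < k * y by rewrite mulr_gt0 // (lt_le_trans d0).
  apply: (le_trans (logistic_le ky0)).
  by rewrite -kd lef_pV2 ?posrE // ?(mulr_gt0 k0 d0) // ler_wpM2l // ltW.
have /andP[l0 l1] := logistic_bounds (k * (x - c)).
apply/andP; split.
  case: (leP x (c - d)) => [xc|_]; last by rewrite sub0r; lra.
  have dcx : d <= c - x by lra.
  have := small _ dcx; rewrite -logisticC -mulrN opprB /=; lra.
case: (leP x (c + d)) => [_|xc]; first by move=> /=; lra.
by rewrite add0r small //; lra.
Qed.

Lemma bstE_clt_cdf r :
  {for r, continuous (fun y : R => normal_prob 0 gam `]-oo, y]%classic)} ->
  forall e, 0 < e -> exists N0, forall N, (N0 <= N)%N ->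
  `|bstE N (fun T => ((fringe_nb t T - N%:R * beta) / Num.sqrt N%:R <= r)%R%:R) -
    gauss_cdf gam r| <= e.
Proof.
(* Four errors: two comparisons of a logistic function with an indicator, the convergence for that
   function, and the continuity of the limit within [2 d] of [r]. *)
move=> cr e e0; pose eta := e / 4.
have eta0 : 0 < eta by rewrite divr_gt0.
have cF : {for r, continuous (gauss_cdf gam)}.
  rewrite /continuous_at /gauss_cdf; apply: fine_cvg.
  by rewrite fineK ?fin_num_measure.
have [d d0 hd] : exists2 d, 0 < d & forall y, `|y - r| <= 2 * d ->
    `|gauss_cdf gam y - gauss_cdf gam r| <= eta.
  move/cvgrPdist_le: cF => /(_ _ eta0) [d /= d0 hd].
  exists (d / 3); first by rewrite divr_gt0.
  move=> y yr; rewrite distrC; apply: hd => /=; rewrite distrC (le_lt_trans yr) //.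
  lra.
pose k := (d * eta)^-1.
have k0 : 0 < k by rewrite invr_gt0 mulr_gt0.
have [N1 hN1] := bstE_clt_logistic (r + d) k0 eta0.
have [N2 hN2] := bstE_clt_logistic (r - d) k0 eta0.
exists (maxn N1 N2) => N; rewrite geq_max => /andP[/hN1 + /hN2].
rewrite !ler_norml => /andP[h1 h2] /andP[h3 h4].
set z := fun T => (fringe_nb t T - N%:R * beta) / Num.sqrt N%:R in h1 h2 h3 h4 *.
have il c : gauss_int gam (fun y => logistic (k * (y - c))).
  apply: (@gauss_int_dom _ gam _ (fun=> 1)); last exact: gauss_int_cst.
    apply: measurableT_comp.
      apply: continuous_measurable_fun; apply: (@lipschitz_continuous _ _ 1) => x y.
      by rewrite mul1r logistic_lip.
    by apply: measurable_funM => //; exact: measurable_funB.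
  by move=> y; have /andP[? ?] := logistic_bounds (k * (y - c)); rewrite ger0_norm.
have ic := gauss_int_cst gam eta.
have up : gaussE gam (fun y => logistic (k * (y - (r + d)))) <= gauss_cdf gam (r + 2 * d) + eta.
  have [i ->] := gauss_cdfE gam (r + 2 * d).
  rewrite -[in leRHS](gaussE_cst gam eta) -gaussED //; apply: le_gaussE => //.
    exact: gauss_intD.
  move=> y; have /andP[_] := logistic_step (r + d) y d0 eta0 erefl.
  by have -> : r + d + d = r + 2 * d by ring.
have lo : gauss_cdf gam (r - 2 * d) - eta <= gaussE gam (fun y => logistic (k * (y - (r - d)))).
  have [i ->] := gauss_cdfE gam (r - 2 * d).
  rewrite -[in leLHS](gaussE_cst gam eta) -gaussEB //; apply: le_gaussE => //.
    exact: (gauss_intD i (gauss_intN ic)).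
  move=> y; have /andP[+ _] := logistic_step (r - d) y d0 eta0 erefl.
  by have -> : r - d - d = r - 2 * d by ring.
have bup : bstE N (fun T => (z T <= r)%R%:R) - eta <=
    bstE N (fun T => logistic (k * (z T - (r + d)))).
  rewrite -(bstE_cst N eta) -bstEB; apply: le_bstE => T _.
  have /andP[+ _] := logistic_step (r + d) (z T) d0 eta0 erefl.
  by rewrite addrK.
have blo : bstE N (fun T => logistic (k * (z T - (r - d)))) <=
    bstE N (fun T => (z T <= r)%R%:R) + eta.
  rewrite -(bstE_cst N eta) -bstED; apply: le_bstE => T _.
  have /andP[_] := logistic_step (r - d) (z T) d0 eta0 erefl.
  by rewrite subrK.
have : `|r + 2 * d - r| <= 2 * d by rewrite addrAC subrr add0r ger0_norm // mulr_ge0 // ltW.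
have : `|r - 2 * d - r| <= 2 * d.
  by rewrite addrAC subrr add0r normrN ger0_norm // mulr_ge0 // ltW.
move=> /hd; rewrite ler_norml => /andP[? ?] /hd; rewrite ler_norml => /andP[? ?].
have e4 : e = 4 * eta by rewrite /eta; field.
rewrite e4; apply/andP; split; lra.
Qed.

End CLT.

(** * From tree expectations to random variables *)

Section FiniteIntegral.
Context d (Omega : measurableType d) (R : realType) (P : probability Omega R).

Lemma integral_sum_indic (I : Type) (s : seq I) (c : I -> R) (X : I -> set Omega) :
  (forall i, measurable (X i)) ->
  (\int[P]_w (\sum_(i <- s) c i * \1_(X i) w)%:E)%E =
  (\sum_(i <- s) c i * fine (P (X i)))%:E.
Proof.
move=> mX; have iX i : P.-integrable setT (fun w => (c i)%:E * (\1_(X i) w)%:E)%E.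
  by apply: integrableZl => //; exact: integrable_indic.
under eq_integral => w _.
  rewrite -sumEFin; under eq_bigr => i _ do rewrite EFinM.
  over.
rewrite integral_sum // -sumEFin; apply: eq_bigr => i _.
rewrite integralZl //; last exact: integrable_indic.
by rewrite integral_indic // setIT EFinM fineK // fin_num_measure.
Qed.

Lemma measurable_sum_indic (I : Type) (s : seq I) (c : I -> R) (X : I -> set Omega) :
  (forall i, measurable (X i)) ->
  measurable_fun setT (fun w => \sum_(i <- s) c i * \1_(X i) w).
Proof.
move=> mX; apply: measurable_sum => i; apply: measurable_funM => //.
Qed.

Lemma integral_eq_off (N : set Omega) (f g : Omega -> R) :
  measurable N -> P N = 0 -> measurable_fun setT f -> measurable_fun setT g ->
  (forall w, ~ N w -> f w = g w) ->
  (\int[P]_w (f w)%:E = \int[P]_w (g w)%:E)%E.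
Proof.
move=> mN PN mf mg fg; apply: ae_eq_integral => //.
- exact/measurable_EFinP.
- exact/measurable_EFinP.
exists N; split=> // w /= h; apply: contrapT => nN; apply: h => _.
by rewrite fg.
Qed.

Lemma sum_indic_disjoint (I : eqType) (s : seq I) (c : I -> R) (X : I -> set Omega) w i :
  uniq s -> i \in s -> (forall j, X j w <-> j = i) ->
  \sum_(j <- s) c j * \1_(X j) w = c i.
Proof.
move=> us si Xi; rewrite (bigD1_seq i) //= big1 => [|j ji].
  by rewrite addr0 indicE mem_set ?mulr1 //; apply/Xi.
by rewrite indicE memNset ?mulr0 // => /Xi e; rewrite e eqxx in ji.
Qed.

End FiniteIntegral.

Section Transfer.
Context d (Omega : measurableType d) (R : realType) (P : probability Omega R).
Variables (s : seq R) (n : nat) (B : {RV P >-> btree}).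
Hypotheses (us : uniq s) (sz : size s = n) (hB : is_random_bst P s B).

Lemma measurable_btree_fun d' (T : measurableType d') (f : btree -> T) :
  measurable_fun setT f.
Proof. by []. Qed.

Lemma measurable_event (p : btree -> Prop) : measurable [set w | p (B w)].
Proof.
rewrite (_ : [set w | p (B w)] = B @^-1` [set T | p T]) //.
by rewrite -[X in measurable X]setTI; apply: measurable_funPT.
Qed.

Lemma measurable_rv (f : btree -> R) : measurable_fun setT (fun w => f (B w)).
Proof. by apply: measurableT_comp; [exact: measurable_btree_fun|exact: measurable_funPT]. Qed.

Lemma prob_bst T : P [set w | B w = T] = ((bsize T == n)%:R * bst_weight T)%:E.
Proof. by rewrite hB bst_pmfE // sz eq_sym. Qed.

Lemma integral_bst_sum (f : btree -> R) :
  (\int[P]_w (\sum_(T <- trees n) f T * \1_([set w | B w = T]) w)%:E)%E =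
  (bstE n f)%:E.
Proof.
rewrite integral_sum_indic => [|T]; last exact: (measurable_event (fun U => U = T)).
congr _%:E; apply: eq_big_seq => T; rewrite mem_trees => sT.
by rewrite prob_bst sT mul1r mulrC.
Qed.

Lemma bst_size_event w : bsize (B w) = n -> forall f : btree -> R,
  \sum_(T <- trees n) f T * \1_([set w | B w = T]) w = f (B w).
Proof.
move=> sB f; apply: sum_indic_disjoint; first exact: trees_uniq.
  by rewrite mem_trees sB.
by move=> T /=; split=> ->.
Qed.

(** [is_random_bst] prescribes the probabilities of single trees, and those of the trees with [n]
    nodes already sum to 1. *)
Lemma bst_size_ae : P [set w | bsize (B w) <> n] = 0.
Proof.
have mN := measurable_event (fun T => bsize T <> n).
have mD := measurable_event (fun T => bsize T = n).
have : P [set w | bsize (B w) = n] = 1%E.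
  rewrite -[1%E]/((1 : R)%:E) -(bstE_cst n 1) -integral_bst_sum.
  rewrite -[[set w | bsize (B w) = n]]setIT -integral_indic //.
  apply: eq_integral => w _; congr _%:E; rewrite indicE.
  case: (eqVneq (bsize (B w)) n) => sB.
    by rewrite mem_set // bst_size_event.
  rewrite memNset /=; last exact/eqP.
  rewrite big1_seq // => T /=; rewrite mem_trees => /eqP sT.
  by rewrite indicE memNset ?mulr0 //= => e; rewrite e sT eqxx in sB.
have -> : [set w | bsize (B w) <> n] = ~` [set w | bsize (B w) = n] by [].
by rewrite probability_setC // => ->; rewrite subee.
Qed.

Lemma integral_bst (f : btree -> R) : (\int[P]_w (f (B w))%:E)%E = (bstE n f)%:E.
Proof.
rewrite -integral_bst_sum.
apply: (integral_eq_off _ bst_size_ae).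
- exact: (measurable_event (fun T => bsize T <> n)).
- exact: measurable_rv.
- by apply: measurable_sum_indic => T; exact: (measurable_event (fun U => U = T)).
by move=> w /contrapT sB; rewrite bst_size_event.
Qed.

Lemma prob_bst_event (p : pred btree) : P [set w | p (B w)] = (bstE n (fun T => (p T)%:R))%:E.
Proof.
rewrite -integral_bst -[[set w | p (B w)]]setIT -integral_indic //; last first.
  exact: (measurable_event (fun T => p T)).
apply: eq_integral => w _; rewrite indicE.
by case: (boolP (p (B w))) => [h|/negP h]; [rewrite mem_set|rewrite memNset].
Qed.

(** * The fringe tree at a uniformly random node *)

Section RandomNode.
Variable V : {RV P >-> address}.
Hypothesis hV : is_random_node P (compress \o B) V.
Variable t : btree.
Hypothesis t0 : t != EmptyTree.

Let Bstar w := fringe (compress (B w)) (V w).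

Lemma measurable_joint_event (p : btree -> address -> Prop) :
  measurable [set w | p (B w) (V w)].
Proof.
have -> : [set w | p (B w) (V w)] =
    \bigcup_(T in [set: btree]) ([set w | B w = T] `&` V @^-1` [set v | p T v]).
  apply/seteqP; split=> [w /= pw|w [T _] /= [<-]] //.
  by exists (B w).
apply: countable_bigcupT_measurable; first exact: countableP.
move=> T; apply: measurableI; first exact: (measurable_event (fun U => U = T)).
by rewrite -[X in measurable X]setTI; apply: measurable_funPT.
Qed.

(** Off the nodes [fringe] is [EmptyTree]; as [t] is not, the event places [V] among the nodes of
    [tau], where its law is prescribed. *)
Lemma prob_fringe_joint tau :
  P [set w | compress (B w) = tau /\ Bstar w = t] =
  (((fringe_count t tau)%:R / (bsize tau)%:R)%:E * P [set w | compress (B w) = tau])%E.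
Proof.
pose X v := [set w | compress (B w) = tau /\ V w = v].
have mX v : measurable (X v).
  exact: (measurable_joint_event (fun T u => compress T = tau /\ u = v)).
have mA := measurable_joint_event (fun T v => compress T = tau /\ fringe (compress T) v = t).
set A := [set w | _ /\ Bstar w = t].
have -> : P A = (\sum_(v <- nodes tau) (fringe tau v == t)%:R * fine (P (X v)))%:E.
  rewrite -integral_sum_indic // -[A]setIT -integral_indic //.
  apply: eq_integral => w _; congr _%:E; rewrite indicE.
  have [[cw fw]|nA] := pselect (A w).
    rewrite mem_set //; have vn : V w \in nodes tau.
      by rewrite -[_ \in _]negbK -fringe_nodes -cw -/(Bstar w) fw.
    rewrite (sum_indic_disjoint (i := V w) _ (nodes_uniq _) vn).
      by rewrite -cw -/(Bstar w) fw eqxx.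
    by move=> v; split=> [[]//|->].
  rewrite memNset // big1_seq // => v /= vn; rewrite indicE.
  have [[cw vw]|nX] := pselect (X v w); last by rewrite memNset // mulr0.
  case: eqP => [fv|_]; last by rewrite mul0r.
  by exfalso; apply: nA; split=> //; rewrite /Bstar cw vw.
under eq_big_seq => v vn do rewrite /X (hV vn).
rewrite -mulr_suml EFinM.
have pf : P [set w | compress (B w) = tau] \is a fin_num.
  by apply: fin_num_measure; exact: (measurable_event (fun T => compress T = tau)).
rewrite /comp fineM // EFinM (fineK pf) [(P _ * _)%E]muleC muleA -EFinM.
congr (_%:E * _)%E; congr (_ / _); rewrite /fringe_count -sum1_count natr_sum [RHS]big_mkcond /=.
by apply: eq_bigr => v _; case: (_ == t).
Qed.

(** Where [B w] has [n] nodes, the conditioning event contains the event that [B] equals that tree,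
    which has positive weight; the default value of [cond_prob] is thus confined to a null event. *)
Lemma cond_prob_fringe : {ae P, forall w,
  cond_prob P [set w' | Bstar w' = t] (fun w => compress (B w)) w =
  (fringe_count t (compress (B w)))%:R / (bsize (compress (B w)))%:R}.
Proof.
exists [set w | bsize (B w) <> n]; split; first exact: (measurable_event (fun T => bsize T <> n)).
  exact: bst_size_ae.
move=> w /= h sB; apply: h; rewrite /cond_prob.
set tau := compress (B w).
have -> : [set w' | Bstar w' = t] `&` (fun w => compress (B w)) @^-1` [set tau] =
    [set w' | compress (B w') = tau /\ Bstar w' = t].
  by apply/seteqP; split=> w' /= [].
rewrite prob_fringe_joint.
have -> : (fun w => compress (B w)) @^-1` [set tau] = [set w' | compress (B w') = tau] by [].
have mt := measurable_event (fun T => compress T = tau).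
have pf : P [set w | compress (B w) = tau] \is a fin_num by exact: fin_num_measure.
have p0 : fine (P [set w | compress (B w) = tau]) != 0.
  rewrite gt_eqF // fine_gt0 // ltey_eq pf orTb andbT.
  apply: (@lt_le_trans _ _ (P [set w' | B w' = B w])).
    by rewrite prob_bst sB eqxx mul1r lte_fin bst_weight_gt0.
  apply: le_measure; rewrite ?inE //; first exact: (measurable_event (fun U => U = B w)).
  by move=> w' /= ->.
by rewrite fineM // mulfK.
Qed.

Lemma prob_fringe : P [set w | Bstar w = t] =
  (\int[P]_w ((fringe_count t (compress (B w)))%:R / (bsize (compress (B w)))%:R)%:E)%E.
Proof.
(* Compression is not injective; each compressed tree must be listed once for the indicators to be
   disjoint. *)
pose cs := undup [seq compress T | T <- trees n].
have ucs : uniq cs by exact: undup_uniq.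
have csB w : bsize (B w) = n -> compress (B w) \in cs.
  by move=> sB; rewrite mem_undup map_f // mem_trees sB.
have mN := measurable_event (fun T => bsize T <> n).
pose X tau := [set w | compress (B w) = tau].
pose Xt tau := [set w | compress (B w) = tau /\ Bstar w = t].
have mX tau : measurable (X tau) by exact: (measurable_event (fun T => compress T = tau)).
have mXt tau : measurable (Xt tau).
  exact: (measurable_joint_event (fun T v => compress T = tau /\ fringe (compress T) v = t)).
have mA : measurable [set w | Bstar w = t].
  exact: (measurable_joint_event (fun T v => fringe (compress T) v = t)).
transitivity (\int[P]_w (\sum_(tau <- cs) 1 * \1_(Xt tau) w)%:E)%E.
  rewrite -[[set w | Bstar w = t]]setIT -integral_indic //.
  apply: (integral_eq_off mN bst_size_ae).
  - exact: measurable_indic.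
  - exact: measurable_sum_indic.
  move=> w /contrapT sB; rewrite indicE.
  have [fw|nfw] := pselect (Bstar w = t).
    rewrite mem_set // (sum_indic_disjoint (i := compress (B w)) _ ucs (csB _ sB)) //.
    by move=> tau; split=> [[]//|->].
  rewrite memNset // big1 // => tau _; rewrite indicE memNset ?mulr0 //.
  by move=> [].
rewrite integral_sum_indic //.
transitivity (\int[P]_w (\sum_(tau <- cs)
   ((fringe_count t tau)%:R / (bsize tau)%:R) * \1_(X tau) w)%:E)%E.
  rewrite integral_sum_indic //; congr _%:E; apply: eq_bigr => tau _.
  rewrite mul1r /Xt prob_fringe_joint fineM //.
  by apply: fin_num_measure; exact: mX.
apply: (integral_eq_off mN bst_size_ae).
- exact: measurable_sum_indic.
- exact: (measurable_rv (fun T => (fringe_count t (compress T))%:R / (bsize (compress T))%:R)).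
move=> w /contrapT sB.
rewrite (sum_indic_disjoint (i := compress (B w)) _ ucs (csB _ sB)) //.
Qed.

End RandomNode.
End Transfer.

(** * The size of the compressed tree *)

Section CompressedSize.
Context {R : realType}.

Lemma full_leaf : full leaf. Proof. by []. Qed.

Lemma toll_leaf T : toll leaf T = (T == leaf).
Proof.
case: T => [|l r] //; rewrite /toll compress_node /branching.
case: (eqVneq l EmptyTree) => [->|l0]; case: (eqVneq r EmptyTree) => [->|r0] //=.
- by rewrite [RHS]btree_eqE (negbTE r0) andbF.
- by rewrite [RHS]btree_eqE (negbTE l0).
by rewrite !btree_eqE compress_eq0 (negbTE l0).
Qed.

Lemma toll_prob_leaf n : toll_prob leaf n = (n == 1)%N%:R :> R.
Proof.
rewrite -(bstE_cst n ((n == 1)%N%:R)); apply: eq_bstE => -[|l r] sT.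
  by rewrite -sT.
rewrite toll_leaf btree_eqE -!bsize_eq0 -sT bsize_node eqSS addn_eq0.
by [].
Qed.

(** The toll is 1 at size 1 and 0 elsewhere, so the series is the single term [2 / (2 * 3)]. *)
Lemma fringe_rate_leaf : fringe_rate leaf = 3^-1 :> R.
Proof.
have b0 k : (2 <= k)%N -> `|toll_prob leaf k : R| <= 0.
  by case: k => [|[|k]] // _; rewrite toll_prob_leaf normr0.
have := renewal_lim_dist (norm_toll_prob leaf) b0.
rewrite mulr0 mul0r normr_le0 subr_eq0 -/(fringe_rate leaf) => /eqP <-.
rewrite /renewal_sum !big_ord_recr big_ord0 /= !toll_prob_leaf /=.
by field.
Qed.

Definition hat_size (T : btree) : R := (bsize (compress T))%:R.

Lemma hat_sizeE T : T != EmptyTree -> hat_size T = 2 * fringe_nb leaf T - 1.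
Proof.
move=> /full_compress/bsize_full e; rewrite /hat_size /fringe_nb -natrM -e.
by rewrite -natr1 addrK.
Qed.

Lemma hat_size_node l r :
  hat_size (BNode l r) = hat_size l + hat_size r + (branching (BNode l r))%:R.
Proof.
rewrite /hat_size compress_node.
case: ifP => br; first by rewrite bsize_node -addn1 !natrD.
move: br; rewrite addr0 /branching.
case: (eqVneq l EmptyTree) => [-> _|_]; first by rewrite add0r.
case: (eqVneq r EmptyTree) => [-> _|_] //; exact: (esym (addr0 _)).
Qed.

Definition branching_prob n : R := bstE n (fun T => (branching T)%:R).

Lemma norm_branching_prob n : `|branching_prob n| <= 1.
Proof.
by have /andP[b0 b1] := @bstE_bool_bounds R n branching; rewrite ger0_norm.
Qed.

(* The expected size of the compressed tree is computed in two ways: from the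
   toll [branching], and as twice the number of leaves minus one. *)
Lemma branching_rate : renewal_lim branching_prob = 2 / 3.
Proof.
have hs n : `|bstE n hat_size - n.+1%:R * renewal_lim branching_prob| <= 3 * 1.
  apply: (@renewal_bound _ (fun n => bstE n hat_size) branching_prob 1 1).
  - by rewrite /branching_prob !bstE0.
  - by move=> k; exact: bstES_additive hat_size_node.
  - exact: norm_branching_prob.
  - by move=> k _; exact: norm_branching_prob.
have hl n : `|bstE n (fringe_nb leaf) - n.+1%:R * fringe_rate leaf| <= 3 * 1 :> R.
  apply: (@renewal_bound _ (fun n => bstE n (fringe_nb leaf)) (toll_prob leaf) 1 1).
  - by rewrite /toll_prob !bstE0.
  - by move=> k; exact: dev_mean_rec.
  - exact: norm_toll_prob.
  - by move=> k _; exact: norm_toll_prob.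
apply/eqP; rewrite -subr_eq0; apply/eqP/eqP; rewrite -normr_le0.
apply/ler_addgt0Pr => e e0; rewrite add0r.
(* [10 = 3 + 2 * 3 + 1]: the errors of the two expansions of the expected size and the 1 of
   [hat_sizeE]. *)
pose n := (Num.truncn (10 / e)).+1.
have n0 : 0 < n.+1%:R :> R by [].
have ne : 10 / e <= n.+1%:R.
  by rewrite ltW // (lt_trans (Num.Theory.truncnS_gt _)) // ltr_nat.
have E : bstE n hat_size = 2 * bstE n (fringe_nb leaf) - 1.
  rewrite -[X in _ - X](bstE_cst n) -bstEZ -bstEB; apply: eq_bstE => T sT.
  by rewrite hat_sizeE // -bsize_eq0 sT.
rewrite -(ler_pM2l n0) -[X in X * `|_|](ger0_norm (ltW n0)) -normrM.
apply: (@le_trans _ _ 10); last by rewrite mulrC -ler_pdivrMl // mulrC.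
have := hs n; have := hl n; rewrite E fringe_rate_leaf !ler_norml.
move: (renewal_lim _) (bstE n _) (n.+1%:R : R) n0 => a m x x0.
by move=> /andP[? ?] /andP[? ?]; apply/andP; split; lra.
Qed.

Variable t : btree.
Hypothesis ft : full t.
Notation beta := (fringe_rate t : R).

Definition fringe_frac T : R := fringe_nb t T / hat_size T.

Lemma fringe_frac_bounds T : 0 <= fringe_frac T <= 1.
Proof.
rewrite /fringe_frac divr_ge0 //=.
have := fringe_count_le t (compress T); rewrite /fringe_nb /hat_size.
case: (bsize _) => [|n]; first by rewrite invr0 mulr0.
by move=> ?; rewrite ler_pdivrMr ?ltr0n // mul1r ler_nat.
Qed.

(** The quotient [q] satisfies [q (2 l - 1) = N], with [l] the number of leaves. Solving for
    [(q - 3/2 beta) n] gives a combination of the two centred counts and 1 whose coefficients are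
    bounded because [0 <= q <= 1]. The constant 432 is [3 * 12^2]. *)
Lemma fringe_frac_dist T n : bsize T = n -> (0 < n)%N ->
  (fringe_frac T - 3 / 2 * beta) ^+ 2 <= 432 / n%:R ^+ 2 *
  ((fringe_nb t T - n%:R * beta) ^+ 2 +
   (fringe_nb leaf T - n%:R * fringe_rate leaf) ^+ 2 + 1).
Proof.
move=> sT n0; rewrite fringe_rate_leaf.
have T0 : T != EmptyTree by rewrite -bsize_eq0 sT -lt0n.
have b0 := ltW (@fringe_rate_gt0 R t ft); have b1 := ltW (@fringe_rate_lt1 R t).
have hs := hat_sizeE T0.
have hs0 : 0 < hat_size T by rewrite ltr0n lt0n bsize_eq0 compress_eq0.
have /andP[q0 q1] := fringe_frac_bounds T.
have qE : fringe_frac T * (2 * fringe_nb leaf T - 1) = fringe_nb t T.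
  by rewrite -hs divfK // gt_eqF.
have m0 : 0 < n%:R :> R by rewrite ltr0n.
move: (fringe_frac T) (fringe_nb leaf T) (fringe_nb t T) (n%:R : R) b0 b1 q0 q1 qE m0.
move: beta => b q l N m b0 b1 q0 q1 qE m0.
set x := N - m * b; set y := l - m * 3^-1.
rewrite [leRHS]mulrAC ler_pdivlMr ?exprn_gt0 // -exprMn.
have D : (q - 3 / 2 * b) * m =
  3 / 2 * x - 9 / 2 * b * y + 9 / 4 * b - 3 * (q - 3 / 2 * b) * y + 3 / 2 * (q - 3 / 2 * b).
  by rewrite /x /y -qE; field.
rewrite D; set k := q - 3 / 2 * b.
have k1 : - 2 <= k by rewrite /k; lra.
have k2 : k <= 2 by rewrite /k; lra.
have : `|3 / 2 * x - 9 / 2 * b * y + 9 / 4 * b - 3 * k * y + 3 / 2 * k| <=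
    12 * (`|x| + `|y| + 1).
  have hby : `|9 / 2 * b * y| <= 9 / 2 * `|y|.
    by rewrite normrM ler_wpM2r // ger0_norm ?mulr_ge0 //; lra.
  have hky : `|3 * k * y| <= 6 * `|y|.
    by rewrite normrM ler_wpM2r // ler_norml; apply/andP; split; lra.
  have xx := ler_norm x; have xx' := lerNnormlW (lexx `|x|).
  move: hby hky; rewrite !ler_norml => /andP[? ?] /andP[? ?].
  have y0 := normr_ge0 y.
  by apply/andP; split; lra.
set F := 3 / 2 * x - _ + _ - _ + _ => hF.
apply: (@le_trans _ _ ((12 * (`|x| + `|y| + 1)) ^+ 2)).
  by rewrite -(real_normK (num_real F)) lerXn2r ?nnegrE // mulr_ge0 // !addr_ge0.
rewrite -(real_normK (num_real x)) -(real_normK (num_real y)).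
move: (`|x|) (`|y|) => u v.
rewrite -subr_ge0 (_ : _ - _ = 144 * ((u - v) ^+ 2 + (u - 1) ^+ 2 + (v - 1) ^+ 2)); last by ring.
by rewrite mulr_ge0 // !addr_ge0 ?sqr_ge0.
Qed.

End CompressedSize.

(** * The limiting fringe tree *)

Section LimitLaw.
Context {R : realType}.

Let limit_weight_ge0 k T :
  0 <= 3 / (k.+1%:R * k.+2%:R) * (bst_weight T * (branching T)%:R) :> R.
Proof. by rewrite mulr_ge0 // mulr_ge0 // ltW // bst_weight_gt0. Qed.

Definition limit_weight k T : {nonneg R} := NngNum (limit_weight_ge0 k T).

(* The law of [compress B_K] given that the root of [B_K] has outdegree 0 or 2,
   where [K] has density proportional to [1 / ((k + 1) (k + 2))]. *)
Definition fringe_limit : set btree -> \bar R :=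
  mseries (fun k => msum (fun i =>
    mscale (limit_weight k (nth EmptyTree (trees k) i))
      (dirac (compress (nth EmptyTree (trees k) i)))) (size (trees k))) 0.

HB.instance Definition _ := Measure.on fringe_limit.

(** For [p := pred1 t] this is [toll_prob t], for [p := full] it is [branching_prob]; one
    computation thus gives both the point masses and the total mass of the limit law. *)
Definition branching_event (p : pred btree) n : R :=
  bstE n (fun T => (branching T && p (compress T))%:R).

Lemma fringe_limitE (p : pred btree) :
  fringe_limit [set T | p T] = (3 / 2 * renewal_lim (branching_event p))%:E.
Proof.
have bp k : `|branching_event p k| <= 1.
  have /andP[b0 b1] := @bstE_bool_bounds R k (fun T => branching T && p (compress T)).
  by rewrite ger0_norm.
rewrite /fringe_limit /mseries.
transitivity (limn (fun n => (3 / 2 * renewal_sum (branching_event p) n)%:E)).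
  congr (lim (_ @ \oo)); apply/funext => n; rewrite /renewal_sum mulr_sumr -sumEFin big_mkord.
  apply: eq_bigr => k _; rewrite /msum /branching_event /bstE.
  transitivity (\sum_(T <- trees k) (limit_weight k T)%:num * (p (compress T))%:R)%:E.
    rewrite (big_nth EmptyTree) big_mkord -sumEFin; apply: eq_bigr => i _.
    set T := nth _ _ _.
    transitivity ((limit_weight k T)%:num%:E * dirac (compress T) [set U | p U])%E.
      by [].
    rewrite diracE EFinM; congr (_ * _%:E)%E.
    case: (boolP (p _)) => [h|/negP h]; first by rewrite mem_set.
    by rewrite memNset.
  congr _%:E; rewrite mulrA [in RHS]mulrA divfK // -mulrA [_ * _^-1]mulrC mulrA mulr_sumr.
  by apply: eq_bigr => T _ /=; rewrite -mulnb natrM !mulrA.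
apply: cvg_lim => //; apply: cvg_EFin; first by near=> n.
by apply: cvgMr; exact: (cvg_renewal_sum bp).
Unshelve. all: end_near. Qed.

Lemma branching_event_full n : branching_event full n = branching_prob n.
Proof.
apply: eq_bstE => T _; case: (boolP (branching T)) => //= bT.
by rewrite full_compress //; case: T bT.
Qed.

(** [branching_rate] is 2/3, the inverse of the normalising factor. *)
Lemma fringe_limit_full : fringe_limit [set T | full T] = 1%E.
Proof.
rewrite fringe_limitE (_ : branching_event full = branching_prob); last first.
  by apply/funext => n; exact: branching_event_full.
by rewrite branching_rate; congr _%:E; field.
Qed.

Let fringe_limit_setT : fringe_limit setT = 1%E.
Proof.
have -> : [set: btree] = [set T | predT T] by apply/seteqP; split.
rewrite -[RHS]fringe_limit_full !fringe_limitE.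
congr (_ * renewal_lim _)%:E; apply/funext => n; rewrite branching_event_full.
by apply: eq_bstE => T _; rewrite andbT.
Qed.

HB.instance Definition _ :=
  @Measure_isProbability.Build _ _ R fringe_limit fringe_limit_setT.

Lemma fringe_limit_set1 t : fringe_limit [set t] = (3 / 2 * fringe_rate t)%:E.
Proof.
rewrite (_ : [set t] = [set T | pred1 t T]); last first.
  by apply/seteqP; split=> T /= /eqP.
by rewrite fringe_limitE.
Qed.

End LimitLaw.

(** * Rates of convergence *)

Section Rates.
Context {R : realType}.

Lemma cvg_EFin_eps (u : nat -> R) l :
  (forall e, 0 < e -> exists N0, forall N, (N0 <= N)%N -> `|u N - l| <= e) ->
  (u n)%:E @[n --> \oo] --> l%:E.
Proof.
move=> h; apply: cvg_EFin; first by near=> n.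
apply/cvgrPdist_le => e /h [N0 hN].
by near=> n; rewrite distrC; apply: hN; near: n; exact: nbhs_infty_ge.
Unshelve. all: end_near. Qed.

Lemma cvg_EFin_rate (u : nat -> R) l C :
  (forall n, (0 < n)%N -> `|u n - l| <= C * (Num.sqrt n%:R)^-1) ->
  (u n)%:E @[n --> \oo] --> l%:E.
Proof.
move=> h; have C0 : 0 <= C.
  by have := h 1%N isT; rewrite sqrtr1 invr1 mulr1; exact: le_trans.
apply: cvg_EFin_eps => e e0.
have C1 : 0 < C + 1 by rewrite ltr_wpDl.
have [N0 hN] := eventually_inv_sqrt (divr_gt0 e0 C1).
exists N0 => N /hN [N1]; rewrite ler_pdivlMr // => hC.
apply: (le_trans (h N N1)); apply: le_trans hC; rewrite mulrC ler_wpM2l ?invr_ge0 //.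
by rewrite lerDl.
Qed.

Lemma inv_nat_le_inv_sqrt n : (n%:R^-1 : R) <= (Num.sqrt n%:R)^-1.
Proof.
case: n => [|n]; first by rewrite sqrtr0.
rewrite lef_pV2 ?posrE ?sqrtr_gt0 ?ltr0n //.
rewrite -[leRHS]sqr_sqrtr // expr2 ler_peMl ?sqrtr_ge0 //.
by rewrite -[leLHS]sqrtr1 ler_wsqrtr // ler1n.
Qed.

Lemma cvg_EFin_rate1 (u : nat -> R) l C :
  (forall n, (0 < n)%N -> `|u n - l| <= C / n%:R) ->
  (u n)%:E @[n --> \oo] --> l%:E.
Proof.
move=> h; have C0 : 0 <= C.
  by have := h 1%N isT; rewrite divr1; exact: le_trans.
apply: (@cvg_EFin_rate _ _ C) => n n0.
by rewrite (le_trans (h n n0)) // ler_wpM2l // inv_nat_le_inv_sqrt.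
Qed.

Lemma bstE_chebyshev n (f : btree -> R) e : 0 < e ->
  bstE n (fun T => (e < `|f T|)%R%:R) <= bstE n (fun T => f T ^+ 2) / e ^+ 2.
Proof.
move=> e0; rewrite -bstEZr; apply: le_bstE => T _.
rewrite -(real_normK (num_real (f T))) -expr_div_n.
case: ltP => [ef|_] /=; last by rewrite sqr_ge0.
by rewrite exprn_ege1 // ler_pdivlMr // mul1r ltW.
Qed.

Lemma bstE_chebyshev_cvg (f : nat -> btree -> R) C :
  (forall n, (0 < n)%N -> bstE n (fun T => f n T ^+ 2) <= C / n%:R) ->
  forall e, 0 < e ->
  (bstE n (fun T => (e < `|f n T|)%R%:R))%:E @[n --> \oo] --> (0 : R)%:E.
Proof.
move=> h e e0; apply: (@cvg_EFin_rate1 _ _ (C / e ^+ 2)) => n n0.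
have /andP[b0 _] := @bstE_bool_bounds R n (fun T => e < `|f n T|).
rewrite subr0 ger0_norm // (le_trans (bstE_chebyshev _ _ e0)) // mulrAC.
by rewrite ler_wpM2r ?invr_ge0 ?sqr_ge0 // h.
Qed.

Lemma bstE_var n (f : btree -> R) : bstE n (fun T => (f T - bstE n f) ^+ 2) =
  bstE n (fun T => f T ^+ 2) - bstE n f ^+ 2.
Proof.
transitivity (bstE n (fun T => f T ^+ 2 - 2 * bstE n f * f T + bstE n f ^+ 2)).
  by apply: eq_bstE => T _; ring.
by rewrite bstED bstEB bstEZ bstE_cst; ring.
Qed.

Lemma sqr_bstE_le n (f : btree -> R) : bstE n f ^+ 2 <= bstE n (fun T => f T ^+ 2).
Proof.
rewrite -subr_ge0 -bstE_var; apply: bstE_ge0 => T _; exact: sqr_ge0.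
Qed.

End Rates.

Section CenteredCount.
Context {R : realType}.
Variable t : btree.
Hypothesis ft : full t.
Notation beta := (fringe_rate t : R).

Definition fringe_ctr n T : R := fringe_nb t T - n%:R * beta.

Lemma fringe_ctrE n T : bsize T = n -> fringe_ctr n T = fringe_dev t T + beta.
Proof. by move=> sT; rewrite /fringe_ctr /fringe_dev sT -natr1; ring. Qed.

Lemma fringe_ctr_moments : exists2 C : R, 0 <= C & forall n,
  `|bstE n (fringe_ctr n)| <= C /\
  `|bstE n (fun T => fringe_ctr n T ^+ 2) - n%:R * fringe_var t| <= C.
Proof.
have [Cm Cm0 hm] := @dev_mean_bound R t ft.
have [Cs Cs0 hs] := @dev_sqr_asymp R t (full_neq0 ft).
have v0 : 0 < fringe_var t :> R by exact: fringe_var_gt0.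
have b0 : 0 < beta by exact: fringe_rate_gt0.
have b1 : beta < 1 by exact: fringe_rate_lt1.
exists (Cs + fringe_var t + 2 * Cm + 1).
  by rewrite !addr_ge0 ?mulr_ge0 // ltW.
move=> n; have -> : bstE n (fringe_ctr n) = dev_mean t n + beta.
  rewrite -(bstE_cst n beta) -bstED; apply: eq_bstE => T; exact: fringe_ctrE.
have -> : bstE n (fun T => fringe_ctr n T ^+ 2) =
    dev_sqr t n + 2 * beta * dev_mean t n + beta ^+ 2.
  rewrite -[beta ^+ 2](bstE_cst n) -bstEZ -!bstED; apply: eq_bstE => T sT.
  by rewrite fringe_ctrE //; ring.
have := hm n; have := hs n.
have : Cs / n.+1%:R <= Cs by rewrite ler_pdivrMr ?ltr0n // ler_peMr // ler1n.
rewrite -natr1; move: (Cs / _) (dev_sqr t n) (dev_mean t n) => q w m qs.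
rewrite !ler_norml => /andP[? ?] /andP[? ?].
have bm : - Cm <= beta * m <= Cm by apply/andP; split; nra.
have bb : 0 <= beta ^+ 2 <= 1 by apply/andP; split; nra.
move: bm bb => /andP[? ?] /andP[? ?].
by split; apply/andP; split; lra.
Qed.

Lemma fringe_ctr_sqr_bound : exists2 C : R, 0 <= C & forall n, (0 < n)%N ->
  bstE n (fun T => fringe_ctr n T ^+ 2) <= C * n%:R.
Proof.
have [C C0 h] := fringe_ctr_moments.
have v0 : 0 < fringe_var t :> R by exact: fringe_var_gt0.
exists (C + fringe_var t); first by rewrite addr_ge0 // ltW.
move=> n n0; have [_] := h n; rewrite ler_norml => /andP[_].
have : C <= C * n%:R by rewrite ler_peMr // ler1n.
by rewrite mulrDl (mulrC _ (fringe_var t)); move: (_ * _) (_ * _) => ? ?; lra.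
Qed.

End CenteredCount.

Section FractionRate.
Context {R : realType}.
Variable t : btree.
Hypothesis ft : full t.

Lemma fringe_frac_sqr_bound : exists C : R, forall n, (0 < n)%N ->
  bstE n (fun T => (fringe_frac t T - 3 / 2 * fringe_rate t) ^+ 2) <= C / n%:R.
Proof.
have [C C0 h] := @fringe_ctr_sqr_bound R t ft.
have [C' C'0 h'] := @fringe_ctr_sqr_bound R leaf full_leaf.
exists (432 * (C + C' + 1)) => n n0.
have m0 : 0 < n%:R :> R by rewrite ltr0n.
apply: le_trans (_ : bstE n (fun T => 432 / n%:R ^+ 2 *
   (fringe_ctr t n T ^+ 2 + fringe_ctr leaf n T ^+ 2 + 1)) <= _).
  by apply: le_bstE => T sT; exact: fringe_frac_dist.
rewrite bstEZ !bstED bstE_cst.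
apply: le_trans (_ : 432 / n%:R ^+ 2 * (C * n%:R + C' * n%:R + n%:R) <= _).
  apply: ler_wpM2l; first by rewrite divr_ge0 // sqr_ge0.
  by apply: lerD (lerD (h n n0) (h' n n0)) _; rewrite ler1n.
by rewrite le_eqVlt; apply/orP; left; apply/eqP; field; rewrite gt_eqF.
Qed.

End FractionRate.

Section ExpectationTransfer.
Context d (Omega : measurableType d) (R : realType) (P : probability Omega R).
Variables (s : seq R) (n : nat) (B : {RV P >-> btree}).
Hypotheses (us : uniq s) (sz : size s = n) (hB : is_random_bst P s B).

Lemma expectation_bst (f : btree -> R) :
  ('E_P[fun w => f (B w)])%E = (bstE n f)%:E.
Proof. by rewrite unlock; exact: (integral_bst us sz hB). Qed.

Lemma variance_bst (f : btree -> R) :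
  ('V_P[fun w => f (B w)])%E = (bstE n (fun T => f T ^+ 2) - bstE n f ^+ 2)%:E.
Proof.
rewrite /variance covariance.unlock expectation_bst /= -bstE_var.
rewrite -[RHS](expectation_bst (fun T => (f T - bstE n f) ^+ 2)).
by congr expectation.
Qed.

End ExpectationTransfer.

Theorem theorem5p1 (R : realType) :
  exists (beta gamma : btree -> R) (Binfty : probability btree R),
    (forall t : btree, full t -> 0 < beta t /\ 0 < gamma t) /\
    Binfty [set t | full t] = 1%E /\
    (forall t : btree, full t -> Binfty [set t] = (3%:R / 2%:R * beta t)%:E) /\
    forall (d : measure_display) (Omega : measurableType d)
           (P : probability Omega R)
           (x : nat -> seq R)
           (B : nat -> {RV P >-> btree}) (V : nat -> {RV P >-> address}),
      (forall n : nat, uniq (x n) /\ size (x n) = n) ->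
      (forall n : nat, is_random_bst P (x n) (B n)) ->
      (forall n : nat, is_random_node P (compress \o B n) (V n)) ->
      let Bhat (n : nat) (w : Omega) : btree := compress (B n w) in
      let Bstar (n : nat) (w : Omega) : btree := fringe (Bhat n w) (V n w) in
      forall t : btree, full t ->
        let N (n : nat) (w : Omega) : R := (fringe_count t (Bhat n w))%:R in
        let Z (n : nat) (w : Omega) : R :=
          (N n w - n%:R * beta t) / Num.sqrt n%:R in
        let Q (n : nat) (w : Omega) : R := N n w / (bsize (Bhat n w))%:R in
        (* asymptotic normality, with convergence of mean and variance *)
        cvg_in_distribution P Z (normal_prob 0 (gamma t)) /\
        'E_P[Z n]%E @[n --> \oo] --> 0%E /\
        'V_P[Z n]%E @[n --> \oo] --> (gamma t ^+ 2)%:E /\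
        cvg_in_probability P (fun n w => N n w / n%:R) (beta t) /\
        (* quenched version *)
        (forall n : nat, (0 < n)%N ->
          {ae P, forall w,
             cond_prob P [set w' | Bstar n w' = t] (Bhat n) w = Q n w}) /\
        cvg_in_probability P Q (fine (Binfty [set t])) /\
        (* annealed version *)
        (forall n : nat, (0 < n)%N ->
          P [set w | Bstar n w = t] = 'E_P[Q n]%E) /\
        P [set w | Bstar n w = t] @[n --> \oo] --> Binfty [set t].
Proof.
exists fringe_rate, fringe_std, fringe_limit; split.
  by move=> t ft; split; [exact: fringe_rate_gt0|exact: fringe_std_gt0].
split; first exact: fringe_limit_full.
split; first by move=> t _; exact: fringe_limit_set1.
move=> d Omega P x B V hx hB hV Bhat Bstar t ft N Z Q.
have ux n : uniq (x n) by case: (hx n).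
have sx n : size (x n) = n by case: (hx n).
have t0 := full_neq0 ft.
have v0 : 0 < fringe_var t :> R by exact: fringe_var_gt0.
have [C C0 hC] := @fringe_ctr_moments R t ft.
have [C' hC'] := @fringe_frac_sqr_bound R t ft.
have [C2 C20 hC2] := @fringe_ctr_sqr_bound R t ft.
pose z n T : R := (fringe_nb t T - n%:R * fringe_rate t) / Num.sqrt n%:R.
have zE n : bstE n (z n) = bstE n (fringe_ctr t n) / Num.sqrt n%:R.
  by rewrite -bstEZr.
have mean_rate n : (0 < n)%N -> `|bstE n (z n)| <= C / Num.sqrt n%:R.
  move=> n0; rewrite zE normrM normfV (ger0_norm (sqrtr_ge0 _)).
  by rewrite ler_wpM2r ?invr_ge0 //; case: (hC n).
have annealed n : (0 < n)%N -> P [set w | Bstar n w = t] = (bstE n (fringe_frac t))%:E.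
  move=> n0; rewrite (prob_fringe (ux n) (sx n) (hB n) (hV n) t0).
  exact: (integral_bst (ux n) (sx n) (hB n) (fringe_frac t)).
have expQ n : ('E_P[Q n])%E = (bstE n (fringe_frac t))%:E.
  exact: (expectation_bst (ux n) (sx n) (hB n) (fringe_frac t)).
split; [|split; [|split; [|split; [|split; [|split; [|split]]]]]].
- move=> r cr.
  have -> : (fun n => P [set w | Z n w <= r]) =
      (fun n => (bstE n (fun T => (z n T <= r)%R%:R))%:E).
    by apply/funext => n; exact: (prob_bst_event (ux n) (sx n) (hB n) (fun T => z n T <= r)).
  have : (bstE n (fun T => (z n T <= r)%R%:R))%:E @[n --> \oo] -->
      (gauss_cdf (fringe_std t) r)%:E.
    by apply: cvg_EFin_eps => e e0; exact: bstE_clt_cdf.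
  by rewrite /gauss_cdf fineK // fin_num_measure.
- have -> : (fun n => 'E_P[Z n])%E = (fun n => (bstE n (z n))%:E).
    by apply/funext => n; exact: (expectation_bst (ux n) (sx n) (hB n) (z n)).
  by apply: (@cvg_EFin_rate _ _ _ C) => n n0; rewrite subr0; exact: mean_rate.
- have -> : (fun n => 'V_P[Z n])%E =
      (fun n => (bstE n (fun T => z n T ^+ 2) - bstE n (z n) ^+ 2)%:E).
    by apply/funext => n; exact: (variance_bst (ux n) (sx n) (hB n) (z n)).
  apply: (@cvg_EFin_rate1 _ _ _ (C + C ^+ 2)) => n n0.
  rewrite fringe_std_sqr //.
  have m0 : 0 < n%:R :> R by rewrite ltr0n.
  have -> : bstE n (fun T => z n T ^+ 2) = bstE n (fun T => fringe_ctr t n T ^+ 2) / n%:R.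
    by rewrite -bstEZr; apply: eq_bstE => T _; rewrite exprMn exprVn sqr_sqrtr.
  (* [C / n] bounds the error of the second moment, [C ^+ 2 / n] the squared mean. *)
  rewrite addrAC mulrDl; apply: (le_trans (ler_normB _ _)); apply: lerD.
    have [_ h] := hC n.
    have -> : bstE n (fun T => fringe_ctr t n T ^+ 2) / n%:R - (fringe_var t : R) =
      (bstE n (fun T => fringe_ctr t n T ^+ 2) - n%:R * fringe_var t) / n%:R.
      by rewrite mulrBl mulrAC divff ?mul1r // gt_eqF.
    by rewrite normrM normfV (gtr0_norm m0) ler_wpM2r ?invr_ge0 ?(ltW m0).
  have := mean_rate n n0; rewrite normrX => h.
  have -> : C ^+ 2 / n%:R = (C / Num.sqrt n%:R) ^+ 2.
    by rewrite expr_div_n sqr_sqrtr.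
  by rewrite lerXn2r ?nnegrE ?divr_ge0.
- move=> e e0.
  have -> : (fun n => P [set w | e < `|N n w / n%:R - fringe_rate t|]) =
      (fun n => (bstE n (fun T => (e < `|fringe_nb t T / n%:R - fringe_rate t|)%R%:R))%:E).
    apply/funext => n.
    exact: (prob_bst_event (ux n) (sx n) (hB n) (fun T => e < `|fringe_nb t T / n%:R - fringe_rate t|)).
  apply: (@bstE_chebyshev_cvg _ (fun n T => fringe_nb t T / n%:R - fringe_rate t) C2) => // n n0.
  have m0 : n%:R != 0 :> R by rewrite pnatr_eq0 -lt0n.
  have -> : bstE n (fun T => (fringe_nb t T / n%:R - fringe_rate t) ^+ 2) =
      bstE n (fun T => fringe_ctr t n T ^+ 2) / n%:R ^+ 2 :> R.
    by rewrite -bstEZr; apply: eq_bstE => T _; rewrite /fringe_ctr; field.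
  rewrite ler_pdivrMr ?exprn_gt0 ?ltr0n // expr2 mulrA divfK //.
  exact: hC2.
- by move=> n n0; exact: (cond_prob_fringe (ux n) (sx n) (hB n) (hV n) t0).
- rewrite [fine _](congr1 fine (fringe_limit_set1 t)) /= => e e0.
  have -> : (fun n => P [set w | e < `|Q n w - 3 / 2 * fringe_rate t|]) =
      (fun n => (bstE n (fun T => (e < `|fringe_frac t T - 3 / 2 * fringe_rate t|)%R%:R))%:E).
    apply/funext => n.
    exact: (prob_bst_event (ux n) (sx n) (hB n) (fun T => e < `|fringe_frac t T - 3 / 2 * fringe_rate t|)).
  by apply: (@bstE_chebyshev_cvg _ (fun n T => fringe_frac t T - 3 / 2 * fringe_rate t) C').
- by move=> n n0; rewrite expQ annealed.
(* Convergence of the expectations follows from the mean square rate by Jensen's inequality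
   [sqr_bstE_le], with error at most [sqrt (C' / n)]. *)
- have C'0 : 0 <= C'.
    have := hC' 1%N isT; rewrite divr1; apply: le_trans.
    by apply: bstE_ge0 => T _; exact: sqr_ge0.
  have : (bstE n (fringe_frac t))%:E @[n --> \oo] --> (3 / 2 * fringe_rate t : R)%:E.
    apply: (@cvg_EFin_rate _ _ _ (Num.sqrt C')) => n n0.
    rewrite -(bstE_cst n (3 / 2 * fringe_rate t)) -bstEB -sqrtrV // -sqrtrM //.
    rewrite -sqrtr_sqr ler_wsqrtr // (le_trans (sqr_bstE_le _ _)) //.
    exact: hC'.
  rewrite -fringe_limit_set1; apply: cvg_trans; apply: near_eq_cvg; near=> n; rewrite annealed //.
  by near: n; exact: nbhs_infty_gt.
Unshelve. all: end_near. Qed.
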